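(* Let $q=2$, $a_k=k^{\alpha}$ and $\sigma_k=k^{\beta}$, $k\in\mathbb N$, with $\alpha>0,\beta>0$; let $\kappa=(\alpha,\beta)$ and let $\Sigma$ be a compact subset of $(0,\infty)^2$. Put $\phi(\kappa)=\frac{4}{4\alpha+4\beta+1}$, $\phi(\Sigma)=\{\phi(\kappa):\kappa\in\Sigma\}$. All limits are as $\varepsilon\to0$. (a) (Lower bounds.) Suppose $\phi(\Sigma)$ contains an interval $[a,b]$, $0<a<b<\infty$. Then there exists a constant $d>0$ such that if $$\limsup_{\varepsilon\to0}\ \sup_{\kappa\in\Sigma}\frac{u_\varepsilon(\kappa)}{\sqrt{\log\log(\varepsilon^{-1})}}\le d,$$ then $\gamma_\varepsilon(\Theta_\varepsilon(\Sigma))\to1$. (b) (Upper bounds.) Let $C>2$, let $L=L_\varepsilon$ be integer-valued with $L_\varepsilon\to\infty$, $L_\varepsilon=o(\log(\varepsilon^{-1}))$, and let $$t_{\varepsilon,m}=\frac{1}{\sqrt{2m}}\sum_{k=1}^m\big((y_k/\varepsilon)^2-1\big),\quad m_k=2^k,\quad H_k=\sqrt{C\log k},\quad \psi_\varepsilon=\mathbf 1\{\exists\,k\ge L_\varepsilon:\ t_{\varepsilon,m_k}>H_k\}.$$ Then $\alpha_\varepsilon(\psi_\varepsilon)=o(1)$, and there exists a constant $D=D(\Sigma)>0$ such that if $$\liminf_{\varepsilon\to0}\ \inf_{\kappa\in\Sigma}\frac{u_\varepsilon(\kappa)}{\sqrt{\log\log(\varepsilon^{-1})}}>D,$$ then $\beta_\varepsilon(\Theta_\varepsilon(\Sigma),\psi_\varepsilon)=o(1)$.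 (c) (Adaptive separation rates.) For $\Sigma$ as in (a), the adaptive separation rates $r^{\mathrm{ad}}_\varepsilon(\kappa)$, $\kappa\in\Sigma$ (corresponding to $u^{\mathrm{ad}}_\varepsilon=\sqrt{\log\log(\varepsilon^{-1})}$), are given by $$r^{\mathrm{ad}}_\varepsilon(\kappa)=\Big(\varepsilon\sqrt[4]{\log\log(\varepsilon^{-1})}\Big)^{4\alpha/(4\alpha+4\beta+1)}.$$
   Context: Model: one observes $y=\{y_k\}_{k\in\mathbb N}$, $y_k=\eta_k+\varepsilon\xi_k$, with $\xi_k$ i.i.d. $N(0,1)$, $\varepsilon>0$ small, $\eta\in\ell^2$ unknown; $E_{\varepsilon,\eta}$ is the corresponding expectation. A test $\psi$ is a measurable function of $y$ with values in $[0,1]$; $\alpha_\varepsilon(\psi)=E_{\varepsilon,0}\psi$, $\beta_\varepsilon(\Theta,\psi)=\sup_{\eta\in\Theta}E_{\varepsilon,\eta}(1-\psi)$, $\gamma_\varepsilon(\Theta)=\inf_\psi\big(\alpha_\varepsilon(\psi)+\beta_\varepsilon(\Theta,\psi)\big)$. Adaptive setting: a family of radii $r_\varepsilon(\kappa)>0$, $\kappa\in\Sigma$, with $r_\varepsilon(\kappa)\to0$ as $\varepsilon\to0$, is given. For $\kappa\in\Sigma$ and $r>0$, $$\Theta_\varepsilon(\kappa,r)=\Big\{\eta\in\ell^2:\sum_k|a_k\sigma_k\eta_k|^2\le1,\ \sum_k\sigma_k^2\eta_k^2\ge r^2\Big\}$$ with $a_k=a_k(\kappa)$, $\sigma_k=\sigma_k(\kappa)$,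 and $\Theta_\varepsilon(\Sigma)=\bigcup_{\kappa\in\Sigma}\Theta_\varepsilon(\kappa,r_\varepsilon(\kappa))$. One tests $H_0:\eta=0$ against $H_1:\eta\in\Theta_\varepsilon(\Sigma)$. Define $u_\varepsilon(\kappa,r)$ by $u_\varepsilon^2(\kappa,r)=\frac{1}{2\varepsilon^4}\inf_{\eta\in\Theta_\varepsilon(\kappa,r)}\sum_k\eta_k^4$, and $u_\varepsilon(\kappa)=u_\varepsilon(\kappa,r_\varepsilon(\kappa))$. A family $u^{\mathrm{ad}}_\varepsilon\to\infty$ characterizes adaptive distinguishability if there are constants $0<d\le D<\infty$ (depending on $\Sigma$) such that $\gamma_\varepsilon(\Theta_\varepsilon(\Sigma))\to1$ when $\limsup_{\varepsilon\to0}\sup_{\kappa\in\Sigma}u_\varepsilon(\kappa)/u^{\mathrm{ad}}_\varepsilon<d$, and $\gamma_\varepsilon(\Theta_\varepsilon(\Sigma))\to0$ when $\liminf_{\varepsilon\to0}\inf_{\kappa\in\Sigma}u_\varepsilon(\kappa)/u^{\mathrm{ad}}_\varepsilon>D$. A family $r^{\mathrm{ad}}_\varepsilon(\kappa)$, $\kappa\in\Sigma$, with $u^{\mathrm{ad}}_\varepsilon\asymp u_\varepsilon(\kappa,r^{\mathrm{ad}}_\varepsilon(\kappa))$ is called the family of adaptive separation rates. ($\asymp$: ratio bounded above and away from $0$ for small $\varepsilon$.) *)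

(* Defs.v *)
From mathcomp Require Import all_boot all_order all_algebra.
From mathcomp Require Import all_classical all_reals all_analysis.

Set Implicit Arguments.
Unset Strict Implicit.
Unset Printing Implicit Defensive.

Import Order.TTheory GRing.Theory Num.Theory.
Import numFieldNormedType.Exports.

Local Open Scope classical_set_scope.
Local Open Scope ring_scope.

(* Coordinates of sequences are numbered from 1 in the mathematics and from 0
   here: index [i : nat] stands for the coordinate [k = i.+1]. *)

(* The product sigma-algebra on [nat -> R] is the one generated by the sets
   constraining a single coordinate. *)
Definition cylinders (R : realType) : set (set (nat -> R)) :=
  [set A | exists k (B : set R),
     measurable B /\ A = [set y : nat -> R | B (y k)]].

Definition is_test (R : realType) (psi : (nat -> R) -> R) : Prop :=
  measurable_fun [set: g_sigma_algebraType (@cylinders R)] psi /\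
  forall y, 0 <= psi y <= 1.

Section gaussian_sequence_model.
Context (d : measure_display) (Omega : measurableType d) (R : realType).
Variables (P : probability Omega R) (xi : nat -> {RV P >-> R}).
Implicit Types (Theta : set (nat -> R)) (psi : (nat -> R) -> R)
  (eta : nat -> R) (eps : R).

Definition mutually_independent : Prop :=
  forall (J : seq nat) (B : nat -> set R), uniq J ->
    (forall j, measurable (B j)) ->
    P (\bigcap_(j in [set` J]) (xi j @^-1` B j)) =
    (\prod_(j <- J) P (xi j @^-1` B j))%E.

Definition iid_standard_normal : Prop :=
  mutually_independent /\
  forall k (B : set R), measurable B ->
    distribution P (xi k) B = normal_prob 0 1 B.

Definition observation eps eta (w : Omega) : nat -> R :=
  fun k => eta k + eps * xi k w.

Definition Eobs eps eta (f : (nat -> R) -> R) : R :=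
  fine 'E_P[fun w => f (observation eps eta w)].

Definition alpha_err eps psi : R := Eobs eps (fun=> 0) psi.

(* Errors lie in [0, 1]; the real [sup] of the empty set is 0, which is the
   right value when there is no alternative. *)
Definition beta_err eps Theta psi : R :=
  sup [set Eobs eps eta (fun y => 1 - psi y) | eta in Theta].

Definition gamma_err eps Theta : R :=
  inf [set alpha_err eps psi + beta_err eps Theta psi
      | psi in [set psi | is_test psi]].

End gaussian_sequence_model.

Section alternatives.
Context (R : realType).
Implicit Types (a sigma : nat -> R) (S : set (R * R)) (kappa : R * R)
  (r : R -> R * R -> R) (eps rho : R).

Definition Theta_set a sigma rho : set (nat -> R) :=
  [set eta | [/\ (\sum_(0 <= k <oo) (eta k ^+ 2)%:E < +oo)%E,
      (\sum_(0 <= k <oo) (`|a k * sigma k * eta k| ^+ 2)%:E <= 1)%E &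
      (\sum_(0 <= k <oo) (sigma k ^+ 2 * eta k ^+ 2)%:E >= (rho ^+ 2)%:E)%E]].

Definition pow_seq (s : R) : nat -> R := fun i => i.+1%:R `^ s.

(* [kappa] is the pair (alpha, beta). *)
Definition Theta_kappa kappa rho : set (nat -> R) :=
  Theta_set (pow_seq kappa.1) (pow_seq kappa.2) rho.

Definition Theta_family S r eps : set (nat -> R) :=
  \bigcup_(kappa in S) Theta_kappa kappa (r eps kappa).

(* Extended-real valued: [+oo] exactly when [Theta_kappa kappa rho] is empty. *)
Definition u_eps eps kappa rho : \bar R :=
  sqrte (((2 * eps ^+ 4)^-1)%:E *
    ereal_inf [set (\sum_(0 <= k <oo) (eta k ^+ 4)%:E)%E
              | eta in Theta_kappa kappa rho])%E.

(* Only small noise levels matter, so positivity is required near 0 only. *)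
Definition radii_family S r : Prop :=
  (\forall eps \near 0^'+, forall kappa, S kappa -> 0 < r eps kappa) /\
  (forall kappa, S kappa -> r eps kappa @[eps --> 0^'+] --> (0 : R)).

Definition limsup_sup_ratio S r (uad : R -> R) : \bar R :=
  limf_esup (fun eps : R =>
    ereal_sup [set (u_eps eps kappa (r eps kappa) / (uad eps)%:E)%E
              | kappa in S]) (0 : R)^'+.

Definition liminf_inf_ratio S r (uad : R -> R) : \bar R :=
  limf_einf (fun eps : R =>
    ereal_inf [set (u_eps eps kappa (r eps kappa) / (uad eps)%:E)%E
              | kappa in S]) (0 : R)^'+.

Definition loglog eps : R := ln (ln eps^-1).

Definition sqrt_loglog eps : R := Num.sqrt (loglog eps).

Definition phi kappa : R := 4 / (4 * kappa.1 + 4 * kappa.2 + 1).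

Definition r_adaptive eps kappa : R :=
  (eps * loglog eps `^ 4^-1) `^ (4 * kappa.1 / (4 * kappa.1 + 4 * kappa.2 + 1)).

End alternatives.

Section adaptive_distinguishability.
Context (d : measure_display) (Omega : measurableType d) (R : realType).
Variables (P : probability Omega R) (xi : nat -> {RV P >-> R}).
Implicit Types (S : set (R * R)) (uad : R -> R) (rad : R -> R * R -> R).

Definition characterizes_adaptive_distinguishability S uad : Prop :=
  uad eps @[eps --> 0^'+] --> +oo /\
  exists dl Du : R, [/\ 0 < dl, dl <= Du &
    forall r, radii_family S r ->
      ((limsup_sup_ratio S r uad < dl%:E)%E ->
        gamma_err xi eps (Theta_family S r eps) @[eps --> 0^'+] --> (1 : R)) /\
      ((liminf_inf_ratio S r uad > Du%:E)%E ->
        gamma_err xi eps (Theta_family S r eps) @[eps --> 0^'+] --> (0 : R))].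

(* The constants in the two-sided bound are uniform over [S]. *)
Definition adaptive_separation_rates S uad rad : Prop :=
  [/\ characterizes_adaptive_distinguishability S uad,
      radii_family S rad &
      exists c C : R, [/\ 0 < c, 0 < C &
        \forall eps \near 0^'+, forall kappa, S kappa ->
          (c%:E <= u_eps eps kappa (rad eps kappa) / (uad eps)%:E <= C%:E)%E]].

End adaptive_distinguishability.

Section adaptive_test.
Context (R : realType).
Implicit Types (eps C : R) (y : nat -> R).

Definition t_stat eps (m : nat) y : R :=
  (Num.sqrt (2 * m%:R))^-1 * \sum_(i < m) ((y i / eps) ^+ 2 - 1).

Definition threshold C (k : nat) : R := Num.sqrt (C * ln k%:R).

Definition psi_adaptive C (L : int) eps : (nat -> R) -> R :=
  \1_[set y | exists k : nat, [/\ (0 < k)%N, L <= k%:Z &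
                                  t_stat eps (2 ^ k)%N y > threshold C k]].

End adaptive_test.

(* Main.v *)
Require Import Defs.
From HB Require Import structures.
From mathcomp Require Import all_boot all_order all_algebra.
From mathcomp Require Import all_classical all_reals all_analysis.
From mathcomp Require Import measurable_realfun normal_distribution.
From mathcomp Require Import ring lra zify.
Import Order.TTheory GRing.Theory Num.Theory.
Import numFieldNormedType.Exports.

Local Open Scope classical_set_scope.
Local Open Scope ring_scope.

(**
Lower bound: since [phi S] contains an interval, about [ln (1 / eps)] dyadic
frequencies [2 ^ p] are critical for some [kappa] in [S], and for each of them
a block of constant amplitude on [2 ^ p <= k < 2 ^ p.+1] is an alternative with
[sum_k (eta_k / eps) ^ 4] a small multiple of [loglog eps].  Random signs on a
block give a prior whose likelihood ratio has second moment at most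
[exp (2 * sum_k (eta_k / eps) ^ 4)], a power [< 1] of [ln (1 / eps)], and
ratios of distinct blocks are uncorrelated; averaging over the
[ln (1 / eps)] blocks makes the variance vanish.

Upper bound: Chernoff bounds give
[P (t_(2 ^ k) > H_k) <= e * k ^ (- C / 2)], summable since [C > 2].  Given an
alternative, take the first [k] at which the frequencies beyond [2 ^ k] carry
at most half of [rho ^ 2].  A block at a frequency comparable to [2 ^ k] is
again an alternative, so [u_eps] is at most a constant times the mean of
[t_(2 ^ k)], which therefore exceeds [2 * H_k].
*)

(** * Densities and independence *)

(** The infimum defining [u_eps] is never computed. It is bounded below by Cauchy-Schwarz over the
    low frequencies and above by a single flat block, and the two bounds are compared by moving a
    fixed number [j] of dyadic levels. This [j] is chosen from bounds [lo], [hi] on the exponents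
    alone, so that [2 ^ (lo * j)] beats every factor like [2 ^ (alpha + beta)]; this makes all
    constants uniform over the parameter set. Dyadic powers are written as exponentials of multiples
    of [ln 2], which turns such comparisons into linear inequalities between exponents.

    A test sees an infinite sequence, but the priors are finitely supported. The likelihood ratio is
    therefore a finite product, and the change of measure need only be verified on finite
    rectangles.

    For the test, two regimes arise. A signal visible below the lowest scanned level is huge there,
    because [L_eps = o(ln (1 / eps))] keeps [2 ^ L_eps] subpolynomial in [1 / eps]. Otherwise the
    relevant level satisfies [k <= (ln (1 / eps)) ^ 2], so [ln k] costs at most [2 * loglog eps]. *)

Section density.
Local Open Scope ereal_scope.
Context (d : measure_display) (T : measurableType d) (R : realType).
Variables (m : {measure set T -> \bar R}) (G : T -> R).
Hypotheses (mG : measurable_fun setT G) (G0 : forall x, (0 <= G x)%R).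

(** The two anonymous arguments carry the proofs that make this set function a measure, so that the
    measure structure can be inferred from the term. *)
Definition mdensity & measurable_fun setT G & (forall x, (0 <= G x)%R) :
  set T -> \bar R := fun A => \int[m]_(x in A) (G x)%:E.

Local Notation mu := (mdensity mG G0).

Let mdensity0 : mu set0 = 0. Proof. exact: integral_set0. Qed.

Let mdensity_ge0 A : 0 <= mu A.
Proof. by apply: integral_ge0 => x _; rewrite lee_fin. Qed.

Let mdensity_additive : semi_sigma_additive mu.
Proof.
apply: semi_sigma_additive_nng_induced; last by move=> x; rewrite lee_fin.
exact/measurable_EFinP.
Qed.

HB.instance Definition _ := isMeasure.Build _ _ _ mu
  mdensity0 mdensity_ge0 mdensity_additive.

Import HBNNSimple.

(** Monotone convergence on both sides reduces to simple functions and linearity to indicators,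
    where the identity is the definition of [mdensity]. *)
Lemma ge0_integral_mdensity (f : T -> \bar R) :
  measurable_fun setT f -> (forall x, 0 <= f x) ->
  \int[mu]_x f x = \int[m]_x (f x * (G x)%:E).
Proof.
move=> mf f0; pose h := nnsfun_approx measurableT mf.
have mGE : measurable_fun setT (EFin \o G) by exact/measurable_EFinP.
have cvgh x : (EFin \o h n) x @[n --> \oo] --> f x by exact: cvg_nnsfun_approx.
have -> : \int[mu]_x f x = lim (\int[mu]_x (EFin \o h n) x @[n --> \oo]).
  have fE x : setT x -> f x = lim ((EFin \o h n) x @[n --> \oo]).
    by move=> _; apply/esym/cvg_lim.
  under eq_integral => x /[!inE] /fE -> //.
  apply: monotone_convergence => //.
  - by move=> n; apply/measurable_EFinP; exact/measurable_funP.
  - by move=> n x _ //=; rewrite lee_fin.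
  - by move=> x _ a b ab; rewrite lee_fin; exact/lefP/nd_nnsfun_approx.
have -> : \int[m]_x (f x * (G x)%:E) =
    lim (\int[m]_x ((EFin \o h n) \* (EFin \o G)) x @[n --> \oo]).
  have fg x : setT x ->
      f x * (G x)%:E = lim (((EFin \o h n) \* (EFin \o G)) x @[n --> \oo]).
    by move=> _; apply/esym/cvg_lim => //; apply: cvgeZr.
  under eq_integral => x /[!inE] /fg -> //.
  apply: monotone_convergence => [//| | |].
  - move=> n; apply/emeasurable_funM => //.
    by apply/measurable_EFinP.
  - by move=> n x _ /=; rewrite mule_ge0 ?lee_fin.
  - move=> x _ a b ab/=; rewrite lee_wpmul2r ?lee_fin//.
    exact/lefP/nd_nnsfun_approx.
suff suf n : \int[m]_x ((EFin \o h n) x * (EFin \o G) x) =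
    \int[mu]_x (EFin \o h n) x.
  by congr (limn _); apply/funext => n; rewrite -suf.
transitivity (\int[mu]_x
   (\sum_(y \in range (h n)) (y * \1_(h n @^-1` [set y]) x)%:E)); last first.
  by apply: eq_integral => t tE; rewrite /= fimfunE -fsumEFin.
have indich r : measurable_fun setT (fun x => (r * \1_(h n @^-1` [set r]) x)%:E).
  by apply: (measurable_comp measurableT) => //; exact: measurable_funM.
rewrite ge0_integral_fsum//; last by move=> y x _; exact: nnfun_muleindic_ge0.
transitivity (\int[m]_x (\sum_(y \in range (h n))
    (y * \1_(h n @^-1` [set y]) x)%:E * (G x)%:E)).
  under [RHS]eq_integral => x xE.
    rewrite -ge0_mule_fsuml => [|y]; last exact: nnfun_muleindic_ge0.
    rewrite fsumEFin // -(fimfunE _ x); over.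
  by [].
rewrite ge0_integral_fsum//; last 2 first.
  - by move=> y; apply: emeasurable_funM.
  - by move=> y x _; apply: mule_ge0; [exact: nnfun_muleindic_ge0|rewrite lee_fin].
apply: eq_fsbigr => r rh.
have r0 : (0 <= r)%R by move: rh; rewrite inE => -[t _ <-].
under eq_integral do rewrite EFinM -muleA.
have m1 : measurable_fun setT (fun x => (\1_(h n @^-1` [set r]) x)%:E : \bar R).
  by apply/measurable_EFinP; exact: measurable_indic.
rewrite ge0_integralZl_EFin//; last 2 first.
  - by move=> x _; rewrite mule_ge0 ?lee_fin.
  - by apply: emeasurable_funM.
under [RHS]eq_integral do rewrite EFinM.
rewrite ge0_integralZl_EFin//.
congr (_ * _); rewrite integral_indic// setIT /mdensity.
rewrite [RHS]integral_mkcond; apply: eq_integral => x _.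
rewrite patchE/= indicE; case: ifPn => _; by rewrite ?mul1e ?mul0e.
Qed.

End density.
Arguments mdensity {d T R} m {G}.

(** Both sides integrate [f] against an image measure, that of [G1 m1] under [Z1] or of [G2 m2]
    under [Z2]; the hypothesis says that these images coincide. It serves both the factorisation of
    expectations and the change of measure. *)
Lemma ge0_integral_weighted_transfer (d1 d2 d3 : measure_display)
    (T1 : measurableType d1) (T2 : measurableType d2) (Y : measurableType d3)
    (R : realType) (m1 : {measure set T1 -> \bar R})
    (m2 : {measure set T2 -> \bar R}) (G1 : T1 -> R) (G2 : T2 -> R)
    (Z1 : T1 -> Y) (Z2 : T2 -> Y) :
  measurable_fun setT G1 -> (forall x, 0 <= G1 x) -> measurable_fun setT Z1 ->
  measurable_fun setT G2 -> (forall x, 0 <= G2 x) -> measurable_fun setT Z2 ->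
  (forall B, measurable B ->
    (\int[m1]_(x in Z1 @^-1` B) (G1 x)%:E =
     \int[m2]_(x in Z2 @^-1` B) (G2 x)%:E)%E) ->
  forall f : Y -> \bar R, measurable_fun setT f -> (forall y, (0 <= f y)%E) ->
  (\int[m1]_x (f (Z1 x) * (G1 x)%:E) = \int[m2]_x (f (Z2 x) * (G2 x)%:E))%E.
Proof.
move=> mG1 G10 mZ1 mG2 G20 mZ2 H f mf f0.
have E (d' : measure_display) (T : measurableType d')
    (m : {measure set T -> \bar R}) (G : T -> R) (Z : T -> Y)
    (mG : measurable_fun setT G) (G0 : forall x, 0 <= G x) :
    measurable_fun setT Z ->
    (\int[m]_x (f (Z x) * (G x)%:E) =
     \int[pushforward (mdensity m mG G0) Z]_y f y)%E.
  move=> mZ; transitivity (\int[mdensity m mG G0]_x (f \o Z) x)%E.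
    rewrite ge0_integral_mdensity; [by []|exact: measurableT_comp|].
    by move=> x; exact: f0.
  by rewrite ge0_integral_pushforward.
rewrite (E _ _ m1 _ _ mG1 G10)// (E _ _ m2 _ _ mG2 G20)//.
by apply: eq_measure_integral => A mA _; exact: H.
Qed.

Section independence.
Context (d : measure_display) (Omega : measurableType d) (R : realType).
Variables (P : probability Omega R) (xi : nat -> {RV P >-> R}).
Hypothesis ind : mutually_independent xi.

(** Independence is given for events only; it is upgraded to functions one coordinate at a time. *)
Lemma ge0_expectation_prod (g : nat -> R -> R) (c : nat -> R) (J : seq nat) :
  uniq J -> (forall j, measurable_fun setT (g j)) ->
  (forall j x, 0 <= g j x) ->
  (forall j, (\int[P]_w (g j (xi j w))%:E = (c j)%:E)%E) ->
  (\int[P]_w (\prod_(j <- J) g j (xi j w))%:E = (\prod_(j <- J) c j)%:E)%E.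
Proof.
move=> uJ mg g0 gc.
have c0 j : 0 <= c j.
  by rewrite -lee_fin -gc; apply: integral_ge0 => w _; rewrite lee_fin.
(* Mixed statement for the induction: the coordinates in [J1] already carry functions, those in [J2]
   still carry indicators. For empty [J1] it is independence itself. *)
suff H J1 J2 (B : nat -> set R) : uniq (J1 ++ J2) ->
    (forall j, measurable (B j)) ->
    (\int[P]_w (\prod_(j <- J1) g j (xi j w) *
                \prod_(j <- J2) \1_(B j) (xi j w))%:E =
     (\prod_(j <- J1) c j)%:E * \prod_(j <- J2) P (xi j @^-1` B j))%E.
  have := H J [::] (fun=> setT); rewrite cats0 big_nil mule1 => <- //.
  by apply: eq_integral => w _; rewrite big_nil mulr1.
elim: J1 J2 B => [|i J1 IH] J2 B.
  move=> /= u mB; rewrite big_nil mul1e -ind//.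
  have mI : measurable (\bigcap_(j in [set` J2]) (xi j @^-1` B j)).
    apply: fin_bigcap_measurable => // j _.
    by rewrite -[X in measurable X]setTI; exact: measurable_funP.
  rewrite -[X in P X]setIT -integral_indic//.
  apply: eq_integral => w _; congr EFin; rewrite big_nil mul1r indicE.
  have [h|h] := boolP (w \in _).
    rewrite big1_seq// => j /andP[_ jJ]; rewrite indicE.
    by move: h => /set_mem /(_ j jJ) /= /mem_set ->.
  apply/eqP; rewrite prodf_seq_eq0.
  have [hh|/allPn[j jJ hj]] := boolP (all (fun j => xi j w \in B j) J2).
    case/negP: h; apply/mem_set => j jJ.
    by apply/set_mem; exact: (allP hh).
  by apply/hasP; exists j => //=; rewrite indicE (negbTE hj).
rewrite cat_cons => /= /andP[iJ u] mB.
pose G w := \prod_(j <- J1) g j (xi j w) * \prod_(j <- J2) \1_(B j) (xi j w).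
have mxi j : measurable_fun setT (xi j) by exact: measurable_funP.
have mG : measurable_fun setT G.
  apply: measurable_funM; apply: measurable_prod => j _.
    by apply: (measurableT_comp (mg j)).
  exact: measurableT_comp (measurable_indic (mB j)) (mxi j).
have G0 w : 0 <= G w by rewrite mulr_ge0// prodr_ge0.
pose p : \bar R := (\prod_(j <- J2) P (xi j @^-1` B j))%E.
have mpre j B0 : measurable B0 -> measurable (xi j @^-1` B0).
  by move=> mB0; rewrite -[X in measurable X]setTI; exact: mxi.
have pE : p = (fine p)%:E.
  rewrite fineK// /p; elim/big_ind : _ => //.
    by move=> x y; exact: fin_numM.
  by move=> j _; apply: fin_num_measure; exact: mpre.
have p0 : (0 <= p)%E by rewrite /p; elim/big_ind : _ => // x y; exact: mule_ge0.
pose C := \prod_(j <- J1) c j * fine p.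
have C0 : 0 <= C by rewrite mulr_ge0 ?prodr_ge0// fine_ge0.
have := @ge0_integral_weighted_transfer _ _ _ _ _ _ _ P P G (cst C) (xi i) (xi i)
  mG G0 (mxi i) (measurable_cst C) (fun=> C0) (mxi i).
move=> /(_ _ (EFin \o g i)) => H.
transitivity (\int[P]_w ((EFin \o g i) (xi i w) * (G w)%:E))%E.
  by apply: eq_integral => w _; rewrite big_cons /G/= -EFinM mulrA.
rewrite H.
- transitivity (\int[P]_x ((g i (xi i x))%:E * C%:E))%E; first by [].
  rewrite ge0_integralZr//; last 2 first.
  + by apply/measurable_EFinP; exact: measurableT_comp.
  + by move=> w _; rewrite lee_fin.
  by rewrite gc /C big_cons -/p pE -!EFinM mulrA.
- move=> B0 mB0; transitivity (C%:E * P (xi i @^-1` B0))%E; last first.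
    by rewrite -(integral_cst P (mpre i _ mB0) C%:E).
  rewrite integral_mkcond.
  (* Since [i] is not in [J2], the event [B0] can be added to the family without disturbing the
     other indicators; the induction hypothesis then applies to [i :: J2]. *)
  pose B' j := if j == i then B0 else B j.
  have jB' : {in J2, B' =1 B}.
    move=> j jJ; rewrite /B'; case: eqP => // ji.
    by move: iJ; rewrite -ji mem_cat jJ orbT.
  transitivity (\int[P]_w (\prod_(j <- J1) g j (xi j w) *
      \prod_(j <- i :: J2) \1_(B' j) (xi j w))%:E)%E.
    apply: eq_integral => w _; rewrite patchE big_cons.
    rewrite (@eq_big_seq _ _ _ _ J2 _ (fun j => \1_(B j) (xi j w))); last first.
      by move=> j /jB' ->.
    rewrite {1}/B' eqxx [in RHS]indicE.
    rewrite (_ : (xi i w \in B0) = (w \in xi i @^-1` B0)); last first.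
      by apply/idP/idP => /set_mem h; apply/mem_set.
    by case: ifPn => _; rewrite ?mul1r ?mul0r ?mulr0.
  rewrite IH.
  + rewrite big_cons {1}/B' eqxx /C EFinM -pE -muleA; congr (_ * _)%E.
    rewrite muleC; congr (_ * _)%E.
    by apply: eq_big_seq => j /jB' ->.
  + by rewrite (perm_uniq (permEl (perm_catCA J1 [:: i] J2))) /= iJ.
  + by move=> j; rewrite /B'; case: ifP.
- exact/measurable_EFinP.
- by move=> x /=; rewrite lee_fin.
Qed.

End independence.

(** * Gaussian shifts and likelihood ratios *)

Section standard_gaussian.
Context (d : measure_display) (Omega : measurableType d) (R : realType).
Variables (P : probability Omega R) (X : {RV P >-> R}).
Hypothesis normX : forall B : set R, measurable B ->
  distribution P X B = normal_prob 0 1 B.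
Local Notation mu := (@lebesgue_measure R).

Lemma normal_pdf01E (x : R) :
  normal_pdf 0 1 x = (Num.sqrt (pi *+ 2))^-1 * expR (- x ^+ 2 / 2).
Proof.
rewrite normal_pdfE ?oner_eq0// /normal_peak /normal_fun.
by rewrite expr1n mul1r subr0.
Qed.

Lemma integral_gaussian_comp (D : set R) (f : R -> R) : measurable D ->
  measurable_fun setT f -> (forall x, 0 <= f x) ->
  (\int[P]_(w in X @^-1` D) (f (X w))%:E =
   \int[mu]_(x in D) (f x * normal_pdf 0 1 x)%:E)%E.
Proof.
move=> mD mf f0.
have mfE : measurable_fun setT (EFin \o f) by exact/measurable_EFinP.
have mpdf : measurable_fun setT (normal_pdf (0 : R) 1).
  exact: measurable_normal_pdf.
have pdf0 x : 0 <= normal_pdf (0 : R) 1 x by exact: normal_pdf_ge0.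
have mX0 : measurable_fun setT X by exact: measurable_funP.
have mX : measurable_fun setT (X : Omega -> measurableTypeR R) := mX0.
transitivity (\int[pushforward P (X : Omega -> measurableTypeR R)]_(x in D)
    (f x)%:E)%E.
  rewrite ge0_integral_pushforward//.
  - exact: measurable_funTS.
  - by move=> x _; rewrite lee_fin.
transitivity (\int[mdensity mu mpdf pdf0]_(x in D) (f x)%:E)%E.
  by apply: eq_measure_integral => A mA _; exact: normX.
rewrite integral_mkcond ge0_integral_mdensity; last 2 first.
- by apply/(measurable_restrictT _ mD); exact: measurable_funTS.
- by move=> x; rewrite patchE; case: ifP => // _; rewrite lee_fin.
rewrite [RHS]integral_mkcond; apply: eq_integral => x _.
by rewrite !patchE; case: ifP => _; rewrite ?mul0e ?EFinM.
Qed.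

(** Completing the square turns the integrand into a constant times the normal density with mean
    [b / q] and variance [1 / q], where [q = 1 - 2 * c]. *)
Lemma expectation_exp_quadratic (c b : R) : c < 2^-1 ->
  (\int[P]_w (expR (c * X w ^+ 2 + b * X w))%:E =
  ((Num.sqrt (1 - 2 * c))^-1 * expR (b ^+ 2 / (2 * (1 - 2 * c))))%:E)%E.
Proof.
move=> c2; set q := 1 - 2 * c; have q0 : 0 < q by rewrite /q; lra.
pose s := (Num.sqrt q)^-1.
have s0 : 0 < s by rewrite invr_gt0 sqrtr_gt0.
have s2 : s ^+ 2 = q^-1 by rewrite exprVn sqr_sqrtr// ltW.
have mf : measurable_fun setT (fun x : R => expR (c * x ^+ 2 + b * x)).
  apply: measurableT_comp => //; apply: measurable_funD; apply: measurable_funM => //.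
rewrite -[X in (\int[P]_(w in X) _)%E](preimage_setT X).
rewrite (integral_gaussian_comp setT _ measurableT mf); last first.
  by move=> x; exact: expR_ge0.
under eq_integral.
  move=> x _.
  rewrite (_ : _ * _ = s * expR (b ^+ 2 / (2 * q)) * normal_pdf (b / q) s x); last first.
    rewrite normal_pdf01E normal_pdfE ?gt_eqF// /normal_peak /normal_fun.
    rewrite s2 [Num.sqrt (q^-1 * pi *+ 2)](_ : _ = s * Num.sqrt (pi *+ 2)); last first.
      by rewrite -mulrnAr sqrtrM ?invr_ge0 ?ltW// sqrtrV ?ltW.
    have -> : c * x ^+ 2 + b * x = b ^+ 2 / (2 * q) +
        (- (x - b / q) ^+ 2 / (q^-1 *+ 2)) + x ^+ 2 / 2.
      by rewrite /q; field; lra.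
    rewrite mulrCA -expRD [RHS]mulrACA -expRD [(s * _)^-1]invfM mulrA divff ?gt_eqF//.
    by rewrite mul1r; congr (_ * expR _); ring.
  rewrite EFinM; over.
rewrite ge0_integralZl_EFin//.
- by rewrite integral_normal_pdf mule1.
- by move=> x _; rewrite lee_fin normal_pdf_ge0.
- by apply/measurable_EFinP; exact: measurable_normal_pdf.
- by rewrite mulr_ge0 ?expR_ge0// ltW.
Qed.

Lemma lebesgue_measure_shift (v : R) (A : set R) : measurable A ->
  mu ((fun x => x + v) @^-1` A) = mu A.
Proof.
move=> mA.
have mv : measurable_fun setT (fun x : R => x + v).
  exact: measurable_funD.
pose T := measurableTypeR R.
pose mvP := @isMeasurableFun.Build _ _ T T _ mv.
pose mvf : {mfun T >-> T} := HB.pack (fun x : R => x + v : T) mvP.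
suff: mu A = pushforward mu mvf A by move=> ->.
apply: lebesgue_measure_unique => //= _ [[a b]] _ <-.
rewrite /pushforward.
rewrite (_ : _ @^-1` _ = `](a - v), (b - v)]%classic); last first.
  by apply/seteqP; split=> x /=; rewrite !in_itv/= ltrBlDr lerBrDr.
rewrite !lebesgue_measure_itv/= !lte_fin ltrD2r; case: ifP => // _.
by rewrite -!EFinD; congr EFin; ring.
Qed.

(** One-dimensional Cameron-Martin formula: the standard density at [x - v] is the one at [x] times
    [expR (v * x - v ^+ 2 / 2)]. *)
Lemma gaussian_shift_density (v : R) (B : set R) : measurable B ->
  P ((fun w => X w + v) @^-1` B) =
  (\int[P]_(w in X @^-1` B) (expR (v * X w - v ^+ 2 / 2))%:E)%E.
Proof.
move=> mB.
have mv : measurable_fun setT (fun x : R => x + v) by exact: measurable_funD.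
have mBv : measurable ((fun x => x + v) @^-1` B).
  by rewrite -[X in measurable X]setTI; exact: mv.
rewrite (integral_gaussian_comp B (fun x => expR (v * x - v ^+ 2 / 2)))//; last first.
  apply: measurableT_comp => //; apply: measurable_funB => //.
transitivity (\int[mu]_(x in (fun x : R => (x + v)%R) @^-1` B) (normal_pdf 0 1 x)%:E)%E.
  by rewrite -[RHS]/(normal_prob 0 1 _) -normX.
pose sh : measurableTypeR R -> measurableTypeR R := fun x : R => x + v.
have msh : measurable_fun setT sh := mv.
transitivity (\int[pushforward mu sh]_(x in B) (normal_pdf 0 1 (x - v)%R)%:E)%E.
  rewrite ge0_integral_pushforward//.
  - by apply: eq_integral => x _ /=; rewrite addrK.
  - apply/measurable_EFinP; apply: measurable_funTS.
    apply: (measurableT_comp (measurable_normal_pdf _ _)).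
    exact: measurable_funB.
  - by move=> x _; rewrite lee_fin normal_pdf_ge0.
transitivity (\int[mu]_(x in B) (normal_pdf 0 1 (x - v)%R)%:E)%E.
  by apply: eq_measure_integral => A mA _; exact: lebesgue_measure_shift.
apply: eq_integral => x _; congr EFin.
rewrite !normal_pdf01E mulrCA -expRD; congr (_ * expR _).
by field.
Qed.

End standard_gaussian.
Arguments expectation_exp_quadratic {d Omega R P X}.
Arguments gaussian_shift_density {d Omega R P X}.

(** * The product sigma-algebra on sequences *)

Section sequence_space.
Context (R : realType).
Local Notation seqT := (g_sigma_algebraType (@cylinders R)).

Lemma measurable_coordinate (k : nat) :
  measurable_fun [set: seqT] (fun y : seqT => (y : nat -> R) k).
Proof.
move=> _ B mB; rewrite setTI; apply: sub_sigma_algebra.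
by exists k, B.
Qed.

Lemma measurable_to_sequence (d : measure_display) (T : measurableType d)
    (h : T -> nat -> R) :
  (forall k, measurable_fun setT (h ^~ k)) ->
  measurable_fun setT (h : T -> seqT).
Proof.
move=> mh.
have H : preimage_set_system setT (h : T -> seqT) (@cylinders R) `<=` measurable.
  by move=> _ [_ [k [B [mB ->]]] <-]; exact: mh.
exact: (@measurability _ _ T seqT setT h (@cylinders R) erefl H).
Qed.

(** Single-coordinate cylinders generate the sigma-algebra but are not stable under intersection.
    Finite rectangles are, and independence computes their probabilities. *)
Definition rectangles : set (set (nat -> R)) :=
  [set A | exists M (B : nat -> set R), (forall i, measurable (B i)) /\
    A = [set y | forall i, (i < M)%N -> B i (y i)]].

Lemma rectangles_measurable (A : set seqT) : rectangles A -> measurable A.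
Proof.
move=> [M [B [mB ->]]].
rewrite (_ : [set y | _] = \bigcap_(i in `I_M)
    ((fun y : seqT => (y : nat -> R) i) @^-1` B i)); last by [].
apply: fin_bigcap_measurable => // i _.
by rewrite -[X in measurable X]setTI; exact: measurable_coordinate.
Qed.

Lemma rectangles_setI : setI_closed rectangles.
Proof.
move=> _ _ [M [B [mB ->]]] [N [C [mC ->]]].
exists (maxn M N).
exists (fun i => (if (i < M)%N then B i else setT) `&`
                 (if (i < N)%N then C i else setT)); split.
  by move=> i; apply: measurableI; case: ifP.
apply/seteqP; split=> y /=.
  by move=> [hB hC] i iMN; split; case: ifP => //; [exact: hB|exact: hC].
move=> h; split=> i iM; have [|hB hC] := h i.
- by rewrite leq_max iM.
- by move: hB; rewrite iM.
- by rewrite leq_max iM orbT.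
- by move: hC; rewrite iM.
Qed.

Lemma eq_measure_rectangles (m1 m2 : {measure set seqT -> \bar R}) :
  (forall A, rectangles A -> m1 A = m2 A) -> (m1 setT < +oo)%E ->
  forall A, measurable A -> m1 A = m2 A.
Proof.
move=> m12 m1oo A mA.
have rT : rectangles setT.
  exists 0%N, (fun=> setT); split; first by move=> i; exact: measurableT.
  by apply/seteqP; split.
apply: (@g_sigma_algebra_measure_unique _ R seqT rectangles _ (fun=> setT)) => //.
- by move=> B; exact: rectangles_measurable.
- by apply/seteqP; split=> // x _; exists 0%N.
- exact: rectangles_setI.
- move: A mA; apply: sub_sigma_algebra2 => B [k [C [mC ->]]].
  exists k.+1, (fun i => if i == k then C else setT); split.
    by move=> i; case: ifP.
  apply/seteqP; split=> y /=.
    by move=> Cy i _; case: eqP => // ->.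
  by move=> /(_ k (ltnSn k)); rewrite eqxx.
Qed.

End sequence_space.
Arguments rectangles {R}.

Definition lik {R : realType} (v x : R) : R := expR (v * x - v ^+ 2 / 2).

(** * Likelihood ratios of finitely supported signals *)

Section gaussian_sequence.
Context (d : measure_display) (Omega : measurableType d) (R : realType).
Variables (P : probability Omega R) (xi : nat -> {RV P >-> R}).
Hypothesis hxi : iid_standard_normal xi.
Local Notation seqT := (g_sigma_algebraType (@cylinders R)).
Let ind : mutually_independent xi := hxi.1.
Let normal k := hxi.2 k.

Lemma measurable_observation (eps : R) (eta : nat -> R) :
  measurable_fun setT (observation xi eps eta : Omega -> seqT).
Proof.
apply: measurable_to_sequence => k; apply: measurable_funD => //.
by apply: measurable_funM => //; exact: measurable_funP.
Qed.

Lemma lik_ge0 (v x : R) : 0 <= lik v x. Proof. exact: expR_ge0. Qed.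

Lemma measurable_lik (v : R) : measurable_fun setT (lik v).
Proof.
apply: measurableT_comp => //; apply: measurable_funB => //.
Qed.

Lemma measurable_prod_lik (v : nat -> R) (N : nat) :
  measurable_fun setT (fun w => \prod_(i < N) lik (v i) (xi i w)).
Proof.
apply: measurable_prod => i _; apply: (measurableT_comp (measurable_lik _)).
exact: measurable_funP.
Qed.

Lemma expectation_lik (k : nat) (v : R) :
  (\int[P]_w (lik v (xi k w))%:E = 1)%E.
Proof.
have := gaussian_shift_density (normal k) v setT measurableT.
rewrite !preimage_setT probability_setT => <- //.
Qed.

(** Both sides factor over coordinates, and each factor is an instance of [gaussian_shift_density]
    with shift [eta i / eps]. *)
Lemma shifted_rectangle_probability (eps : R) (eta : nat -> R) (N : nat)
    (A : set (nat -> R)) : 0 < eps ->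
  (forall i, (N <= i)%N -> eta i = 0) -> rectangles A ->
  P (observation xi eps eta @^-1` A) =
  (\int[P]_(w in observation xi eps (fun=> 0%R) @^-1` A)
     (\prod_(i < N) lik (eta i / eps) (xi i w))%:E)%E.
Proof.
move=> eps0 etaN [M [B [mB ->]]].
(* Enough coordinates to cover both the constraints of the rectangle and the support of [eta]. *)
pose K := (M + N)%N.
pose B' i := if (i < M)%N then B i else setT.
have mB' i : measurable (B' i) by rewrite /B'; case: ifP.
have mxi i : measurable_fun setT (xi i) by exact: measurable_funP.
pose h i (x : R) : R := \1_(B' i) (eta i + eps * x).
pose h0 i (x : R) := \1_(B' i) (eps * x) * lik (eta i / eps) x.
have mh i : measurable_fun setT (h i).
  apply: (measurableT_comp (measurable_indic (mB' i))).
  by apply: measurable_funD => //; exact: measurable_funM.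
have mh0 i : measurable_fun setT (h0 i).
  apply: measurable_funM; last exact: measurable_lik.
  apply: (measurableT_comp (measurable_indic (mB' i))).
  exact: measurable_funM.
have h_ge0 i x : 0 <= h i x by [].
have h0_ge0 i x : 0 <= h0 i x by rewrite mulr_ge0// lik_ge0.
pose D i := (fun x : R => eps * x) @^-1` B' i.
have mD i : measurable (D i).
  rewrite -[X in measurable X]setTI.
  by apply: measurable_funM.
have hE i : (\int[P]_w (h i (xi i w))%:E =
    P ((fun w => (xi i w + eta i / eps)%R) @^-1` D i))%E.
  have mw : measurable_fun setT (fun w => xi i w + eta i / eps).
    exact: measurable_funD.
  rewrite -[X in P X]setIT -integral_indic//; last first.
    by rewrite -[X in measurable X]setTI; exact: mw.
  apply: eq_integral => w _; congr EFin; rewrite /h !indicE.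
  congr (_%:R); congr nat_of_bool.
  have E : eta i + eps * xi i w = eps * (xi i w + eta i / eps).
    by field; rewrite gt_eqF.
  rewrite E; by apply/idP/idP => /set_mem H; apply/mem_set.
have h0E i : (\int[P]_w (h0 i (xi i w))%:E =
    P ((fun w => (xi i w + eta i / eps)%R) @^-1` D i))%E.
  rewrite (gaussian_shift_density (normal i))// [RHS]integral_mkcond.
  apply: eq_integral => w _; rewrite patchE /h0 indicE.
  rewrite (_ : (eps * xi i w \in B' i) = (w \in xi i @^-1` D i)); last first.
    by apply/idP/idP => /set_mem H; apply/mem_set.
  by case: ifPn => _; rewrite ?mul1r ?mul0r.
pose c i := fine (P ((fun w => (xi i w + eta i / eps)%R) @^-1` D i)).
have cE i : P ((fun w => (xi i w + eta i / eps)%R) @^-1` D i) = (c i)%:E.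
  rewrite fineK// fin_num_measure// -[X in measurable X]setTI.
  by apply: measurable_funD.
have uK : uniq (iota 0 K) by exact: iota_uniq.
have E1 := @ge0_expectation_prod _ _ _ _ _ ind h c _ uK mh h_ge0.
have E2 := @ge0_expectation_prod _ _ _ _ _ ind h0 c _ uK mh0 h0_ge0.
have allB y : (\prod_(j <- iota 0 K) \1_(B' j) (y j) : R) =
    \1_[set y | forall i, (i < M)%N -> B i (y i)] y.
  rewrite indicE; have [H|H] := boolP (y \in _).
    rewrite big1_seq// => j _; rewrite indicE mem_set// /B'.
    by case: ifP => // jM; move/set_mem: H; exact.
  apply/eqP; rewrite prodf_seq_eq0.
  have [hh|/allPn[j jJ hj]] := boolP (all (fun j => y j \in B' j) (iota 0 K)).
    case/negP: H; apply/mem_set => j jM.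
    have /(allP hh)/set_mem : j \in iota 0 K.
      by rewrite mem_iota add0n /K ltn_addr.
    by rewrite /B' jM.
  by apply/hasP; exists j => //=; rewrite indicE (negbTE hj).
have mrect : measurable (observation xi eps eta @^-1`
    [set y | forall i, (i < M)%N -> B i (y i)]).
  rewrite -[X in measurable X]setTI; apply: measurable_observation => //.
  by apply: rectangles_measurable; exists M, B.
transitivity (\prod_(j <- iota 0 K) c j)%:E.
  rewrite -E1; last by move=> j; rewrite hE cE.
  rewrite -[X in P X]setIT -integral_indic//.
  apply: eq_integral => w _; congr EFin; rewrite /h.
  by rewrite (allB (observation xi eps eta w)).
rewrite -E2; last by move=> j; rewrite h0E cE.
rewrite [RHS]integral_mkcond; apply: eq_integral => w _.
rewrite patchE /h0 big_split/=.
(* Beyond [N] the shift is zero and the likelihood factor is one. *)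
have -> : \prod_(j <- iota 0 K) lik (eta j / eps) (xi j w) =
    \prod_(i < N) lik (eta i / eps) (xi i w).
  rewrite -(big_mkord xpredT (fun i => lik (eta i / eps) (xi i w))).
  rewrite -[K in LHS]subn0 -/(index_iota 0 K) (@big_cat_nat _ _ _ N)//=; last first.
    by rewrite leq_addl.
  rewrite [X in _ * X]big_nat_cond [X in _ * X]big1 ?mulr1// => j.
  move=> /andP[/andP[Nj _] _]; rewrite etaN// /lik !mul0r expr0n/= mul0r subr0.
  exact: expR0.
have := allB (observation xi eps (fun=> 0) w); rewrite /observation.
under eq_bigr do rewrite add0r.
move=> ->; rewrite indicE.
rewrite (_ : (_ \in [set y | _]) = (w \in observation xi eps (fun=> 0) @^-1`
  [set y | forall i, (i < M)%N -> B i (y i)])); last first.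
  by apply/idP/idP => /set_mem H; apply/mem_set.
by case: ifPn => _; rewrite ?mul1r ?mul0r.
Qed.

(** The law of the shifted observation and the weighted law of pure noise agree on rectangles, hence
    on the whole product sigma-algebra, hence against every nonnegative measurable [f]. *)
Lemma change_of_measure (eps : R) (eta : nat -> R) (N : nat)
    (f : (nat -> R) -> R) : 0 < eps ->
  (forall i, (N <= i)%N -> eta i = 0) ->
  measurable_fun [set: seqT] f -> (forall y, 0 <= f y) ->
  (\int[P]_w (f (observation xi eps eta w))%:E =
   \int[P]_w (f (observation xi eps (fun=> 0%R) w) *
              \prod_(i < N) lik (eta i / eps) (xi i w))%:E)%E.
Proof.
move=> eps0 etaN mf f0.
pose L w := \prod_(i < N) lik (eta i / eps) (xi i w).
have mL : measurable_fun setT L by exact: (measurable_prod_lik (fun i => eta i / eps)).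
have L0 w : 0 <= L w by apply: prodr_ge0 => i _; exact: lik_ge0.
have mo := measurable_observation eps eta.
have mo0 := measurable_observation eps (fun=> 0).
have m1 : measurable_fun setT (cst 1 : Omega -> R) by exact: measurable_cst.
have := @ge0_integral_weighted_transfer _ _ _ _ _ seqT _ P P (cst 1) L
  (observation xi eps eta) (observation xi eps (fun=> 0)) m1 (fun=> ler01) mo
  mL L0 mo0.
move=> /(_ _ (EFin \o f)) H.
transitivity (\int[P]_w ((EFin \o f) (observation xi eps eta w) *
    (cst 1%R w)%:E))%E.
  by apply: eq_integral => w _; rewrite mule1.
rewrite H; first by [].
- have one0 (x : Omega) : 0 <= (cst 1 x : R) by exact: ler01.
  pose n1 : {measure set seqT -> \bar R} := pushforward (mdensity P m1 one0)
    (observation xi eps eta : Omega -> seqT).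
  pose n2 : {measure set seqT -> \bar R} := pushforward (mdensity P mL L0)
    (observation xi eps (fun=> 0) : Omega -> seqT).
  move=> A mA; apply: (@eq_measure_rectangles _ (n1 mo) (n2 mo0) _ _ A mA).
    move=> {mA}A rA; rewrite /n1 /n2 /pushforward /mdensity.
    transitivity (P (observation xi eps eta @^-1` A)); last first.
      exact: (shifted_rectangle_probability _ _ _ _ eps0 etaN rA).
    rewrite -[RHS]mul1e; apply: (integral_cst P _ 1%E).
    rewrite -[X in measurable X]setTI; apply: mo => //.
    exact: rectangles_measurable.
  have -> : n1 mo setT = (1 * P setT)%E.
    exact: (integral_cst P measurableT 1%E).
  by rewrite probability_setT mule1 ltry.
- exact/measurable_EFinP.
- by move=> y /=; rewrite lee_fin.
Qed.

End gaussian_sequence.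

(** * Chi-square tails and the errors of the adaptive test *)

Section elementary_exp.
Context (R : realType).
Implicit Types x z : R.

Lemma expR_ge_quadratic z : 0 <= z -> 1 + z + z ^+ 2 / 2 <= expR z.
Proof.
move=> z0; rewrite /expR.
have nd : nondecreasing_seq (series (exp_coeff z)).
  apply/nondecreasing_seqP => n; rewrite seriesSr lerDl.
  exact: exp_coeff_ge0.
have := nondecreasing_cvgn_le nd (is_cvg_series_exp_coeff z) 3%N.
rewrite /series/= !big_nat_recr//= big_geq// /exp_coeff/=.
by rewrite expr0 expr1 !divr1 add0r.
Qed.

(** The exponent is the second-order expansion of [- ln (1 - x)] with a generous cubic term.
    Multiplying the quadratic lower bound of the exponential by [1 - x] leaves an excess over one
    that is [x ^+ 3] times a factor positive on the given range. *)
Lemma invr_onem_le_expR x : 0 <= x <= 2^-1 ->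
  (1 - x)^-1 <= expR (x + x ^+ 2 / 2 + 2 * x ^+ 3).
Proof.
move=> /andP[x0 x1].
have x20 : 0 <= x ^+ 2 by exact: sqr_ge0.
have x30 : 0 <= x ^+ 3 by exact: exprn_ge0.
have z0 : 0 <= x + x ^+ 2 / 2 + 2 * x ^+ 3 by lra.
apply: le_trans (expR_ge_quadratic _ z0).
have q0 : 0 < 1 - x by lra.
rewrite -[leLHS]mul1r ler_pdivrMr//.
have zx : (x + x ^+ 2 / 2) ^+ 2 <= (x + x ^+ 2 / 2 + 2 * x ^+ 3) ^+ 2.
  by rewrite ler_sqr ?nnegrE; lra.
apply: (@le_trans _ _ ((1 + (x + x ^+ 2 / 2 + 2 * x ^+ 3) +
    (x + x ^+ 2 / 2) ^+ 2 / 2) * (1 - x))); last first.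
  by rewrite ler_pM2r//; lra.
rewrite -subr_ge0 (_ : _ - 1 = x ^+ 3 * (3 / 2 - 19 / 8 * x - x ^+ 2 / 8)); last by field.
rewrite mulr_ge0//.
have : x ^+ 2 <= x * 2^-1 by rewrite expr2 ler_wpM2l.
lra.
Qed.

(** From [(1 - y + y ^+ 2) * (1 + y) = 1 + y ^+ 3]. *)
Lemma invr_1D_le_expR y : 0 <= y -> (1 + y)^-1 <= expR (- y + y ^+ 2) :> R.
Proof.
move=> y0; have y1 : 0 < 1 + y by lra.
apply: le_trans (expR_ge1Dx _).
rewrite -[leLHS]mul1r ler_pdivrMr// -subr_ge0.
rewrite (_ : _ - 1 = y ^+ 3); last by ring.
exact: exprn_ge0.
Qed.

(** The sharp constant is one half; the cruder 2 has an elementary proof and is the source of the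
    factor 2 in the second moment of a block. If [x ^+ 2 <= 1 / 2], then [cosh x <= 1 / (1 - x ^+ 2)
    <= 1 + 2 * x ^+ 2]; otherwise [x] and [- x] are both at most [2 * x ^+ 2]. *)
Lemma cosh_le_expR x : (expR x + expR (- x)) / 2 <= expR (2 * x ^+ 2).
Proof.
have [h|h] := leP (x ^+ 2) (2^-1).
  have h1 : 0 < 1 - x ^+ 2 by lra.
  have x1 : x < 1 by nra.
  have x2 : -1 < x by nra.
  have e (y : R) : -1 < y -> y < 1 -> expR y <= (1 - y)^-1.
    move=> y1 y2; rewrite -[y in leLHS]opprK expRN lef_pV2 ?posrE ?expR_gt0//.
      by have := expR_ge1Dx (- y); lra.
    by lra.
  apply: (@le_trans _ _ (1 + 2 * x ^+ 2)); last exact: expR_ge1Dx.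
  have e1 := e x x2 x1; have := e (- x); rewrite opprK => e2.
  have {}e2 : expR (- x) <= (1 + x)^-1 by apply: e2; lra.
  apply: (@le_trans _ _ (((1 - x)^-1 + (1 + x)^-1) / 2)).
    by rewrite ler_pM2r ?invr_gt0//; exact: lerD.
  rewrite (_ : (_ + _) / 2 = (1 - x ^+ 2)^-1); last by field; nra.
  rewrite -[leLHS]mul1r ler_pdivrMr//.
  have : 0 <= x ^+ 2 by exact: sqr_ge0.
  by nra.
have [x0|x0] := leP 0 x.
  have : expR x <= expR (2 * x ^+ 2) by rewrite ler_expR; nra.
  have : expR (- x) <= expR (2 * x ^+ 2) by rewrite ler_expR; nra.
  lra.
have : expR x <= expR (2 * x ^+ 2) by rewrite ler_expR; nra.
have : expR (- x) <= expR (2 * x ^+ 2) by rewrite ler_expR; nra.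
lra.
Qed.

End elementary_exp.

Section chi_square_tails.
Context (d : measure_display) (Omega : measurableType d) (R : realType).
Variables (P : probability Omega R) (xi : nat -> {RV P >-> R}).
Hypothesis hxi : iid_standard_normal xi.
Local Notation seqT := (g_sigma_algebraType (@cylinders R)).

(** Laplace transform of a centred noncentral chi-square: by independence it is a product of
    Gaussian integrals of quadratic exponentials. *)
Lemma expectation_expR_chi_square (c : R) (a : nat -> R) (m : nat) : c < 2^-1 ->
  (\int[P]_w (expR (c * \sum_(i < m) ((a i + xi i w) ^+ 2 - 1)))%:E =
   (((Num.sqrt (1 - 2 * c))^-1 * expR (- c)) ^+ m *
     expR (c / (1 - 2 * c) * \sum_(i < m) a i ^+ 2))%:E)%E.
Proof.
move=> c2.
pose g i (x : R) := expR (c * ((a i + x) ^+ 2 - 1)).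
have mg i : measurable_fun setT (g i).
  apply: measurableT_comp => //; apply: measurable_funM => //.
  apply: measurable_funB => //; apply: measurable_funX.
  exact: measurable_funD.
pose cc i := (Num.sqrt (1 - 2 * c))^-1 * expR (- c) *
  expR (c / (1 - 2 * c) * a i ^+ 2).
have gE i : (\int[P]_w (g i (xi i w))%:E = (cc i)%:E)%E.
  have mX : measurable_fun setT (xi i) by exact: measurable_funP.
  transitivity (\int[P]_w ((expR (c * (a i ^+ 2 - 1)))%:E *
      (expR (c * xi i w ^+ 2 + (2 * c * a i) * xi i w))%:E))%E.
    apply: eq_integral => w _; rewrite -EFinM -expRD; congr (expR _)%:E.
    by ring.
  rewrite ge0_integralZl_EFin ?expR_ge0//; last first.
    apply/measurable_EFinP; apply: measurableT_comp => //.
    apply: measurable_funD; apply: measurable_funM => //.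
    exact: measurable_funX.
  rewrite (expectation_exp_quadratic (hxi.2 i))// -EFinM /cc; congr EFin.
  rewrite mulrCA -expRD -[RHS]mulrA -expRD; congr (_ * expR _).
  by field; lra.
have := @ge0_expectation_prod _ _ _ _ _ hxi.1 g cc (iota 0 m) (iota_uniq 0 m) mg
  (fun _ _ => expR_ge0 _) gE.
have iotaE (F : nat -> R) : \prod_(j <- iota 0 m) F j = \prod_(i < m) F i.
  by rewrite -(big_mkord xpredT F) /index_iota subn0.
rewrite (iotaE cc) /cc big_split/= prodr_const card_ord -expR_sum -mulr_sumr => <-.
apply: eq_integral => w _; congr EFin.
by rewrite (iotaE (fun j => g j (xi j w))) /g -expR_sum mulr_sumr.
Qed.

Lemma t_stat_observation (eps : R) (eta : nat -> R) (m : nat) (w : Omega) :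
  eps != 0 ->
  t_stat eps m (observation xi eps eta w) =
  (Num.sqrt (2 * m%:R))^-1 *
    \sum_(i < m) ((eta i / eps + xi i w) ^+ 2 - 1).
Proof.
move=> e0; rewrite /t_stat; congr (_ * _); apply: eq_bigr => i _.
by rewrite /observation mulrDl mulrAC divff// mul1r.
Qed.

Lemma measurable_t_stat (eps : R) (m : nat) :
  measurable_fun [set: seqT] (t_stat eps m : seqT -> R).
Proof.
apply: measurable_funM => //; apply: measurable_sum => i.
apply: measurable_funB => //; apply: measurable_funX; apply: measurable_funM => //.
exact: measurable_coordinate.
Qed.

Lemma measurable_t_stat_observation (eps : R) (eta : nat -> R) (m : nat) :
  measurable_fun setT (fun w => t_stat eps m (observation xi eps eta w)).
Proof.
exact: (measurableT_comp (measurable_t_stat eps m) (measurable_observation _ _ _ _ xi eps eta)).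
Qed.

(* Chernoff bound with parameter [H / sqrt (2 * m)]; [8 * H ^+ 6 <= m] bounds
   the cubic term of the exponent by [1]. *)
Lemma t_stat_upper_tail (eps H : R) (m : nat) : 0 < eps -> 0 <= H -> (0 < m)%N ->
  8 * H ^+ 2 <= m%:R -> 8 * H ^+ 6 <= m%:R ->
  (P [set w | (H < t_stat eps m (observation xi eps (fun=> 0) w))%R] <=
   (expR (1 - H ^+ 2 / 2))%:E)%E.
Proof.
move=> eps0 H0 m0 mH2 mH6.
have m0R : 0 < m%:R :> R by rewrite ltr0n.
pose s : R := Num.sqrt (2 * m%:R).
have s0 : 0 < s by rewrite sqrtr_gt0 mulr_gt0.
have s2 : s ^+ 2 = 2 * m%:R by rewrite sqr_sqrtr// mulr_ge0 ?ltW.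
pose c := H / s; pose x := 2 * c.
have c0 : 0 <= c by rewrite divr_ge0// ltW.
have x0 : 0 <= x by rewrite mulr_ge0.
(* This identity turns the quadratic part [m * x ^+ 2 / 4] of the exponent into [H ^+ 2 / 2], half
   of the gain [H ^+ 2]. *)
have x2 : m%:R * x ^+ 2 = 2 * H ^+ 2.
  by rewrite /x /c exprMn expr_div_n s2; field; rewrite gt_eqF.
have x1 : x <= 2^-1.
  rewrite -ler_sqr ?nnegrE ?invr_ge0// -(ler_pM2l m0R) x2; lra.
(* The cubic part [m * x ^+ 3] of the exponent; [m] times its square is [8 * H ^+ 6]. *)
have Hx : 2 * H ^+ 2 * x <= 1.
  have y0 : 0 <= 2 * H ^+ 2 * x by apply: mulr_ge0 => //; apply: mulr_ge0 => //; exact: exprn_ge0.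
  rewrite -(expr_le1 (n := 2) _ y0)//.
  rewrite -(ler_pM2l m0R) mulr1 exprMn mulrCA x2; lra.
have mA : measurable [set w | H < t_stat eps m (observation xi eps (fun=> 0) w)].
  rewrite [X in measurable X](_ : _ =
    (fun w => t_stat eps m (observation xi eps (fun=> 0) w)) @^-1` `]H, +oo[%classic); last first.
    by apply/seteqP; split=> w /=; rewrite in_itv/= andbT.
  by rewrite -[X in measurable X]setTI; apply: measurable_t_stat_observation.
rewrite -[X in P X]setIT -integral_indic//.
pose f w := expR (- H ^+ 2) * expR (c * \sum_(i < m) ((0 + xi i w) ^+ 2 - 1)).
apply: (@le_trans _ _ (\int[P]_w (f w)%:E)%E).
  apply: ge0_le_integral => //.
  - by apply/measurable_EFinP; exact: measurable_indic.
  - apply/measurable_EFinP; apply: measurable_funM => //.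
    apply: measurableT_comp => //; apply: measurable_funM => //.
    apply: measurable_sum => i; apply: measurable_funB => //.
    by apply: measurable_funX; apply: measurable_funD => //; exact: measurable_funP.
  - move=> w _; rewrite lee_fin indicE /f -expRD.
    have [/set_mem/= h|_] := boolP (_ \in _); last exact: expR_ge0.
    rewrite -[leLHS]expR0 ler_expR.
    have : H < s^-1 * \sum_(i < m) ((0 + xi i w) ^+ 2 - 1).
      move: h; rewrite t_stat_observation ?gt_eqF// -/s.
      by under eq_bigr do rewrite mul0r.
    move=> /ltW/(ler_wpM2l H0); rewrite /c; lra.
rewrite /f; under eq_integral do rewrite EFinM.
rewrite ge0_integralZl_EFin ?expR_ge0//; last first.
  apply/measurable_EFinP.
  apply: measurableT_comp => //; apply: measurable_funM => //.
  apply: measurable_sum => i; apply: measurable_funB => //.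
  by apply: measurable_funX; apply: measurable_funD => //; exact: measurable_funP.
have c2 : c < 2^-1 by rewrite -(@ltr_pM2l _ 2)// -/x; lra.
rewrite (expectation_expR_chi_square c (fun=> 0) m c2) -EFinM lee_fin.
rewrite expr0n/= big1// mulr0 expR0 mulr1.
have -> : (Num.sqrt (1 - 2 * c))^-1 = Num.sqrt ((1 - x)^-1).
  by rewrite sqrtrV// /x; lra.
have sqle : Num.sqrt ((1 - x)^-1) <= expR ((x + x ^+ 2 / 2 + 2 * x ^+ 3) / 2).
  rewrite -ler_sqr ?nnegrE ?sqrtr_ge0 ?expR_ge0// sqr_sqrtr ?invr_ge0; last by lra.
  rewrite -expRM_natl (_ : 2 * ((x + x ^+ 2 / 2 + 2 * x ^+ 3) / 2) =
    x + x ^+ 2 / 2 + 2 * x ^+ 3); last by field.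
  by apply: invr_onem_le_expR; rewrite x0.
apply: (@le_trans _ _ (expR (- H ^+ 2) *
    (expR ((x + x ^+ 2 / 2 + 2 * x ^+ 3) / 2) * expR (- c)) ^+ m)).
  rewrite ler_wpM2l ?expR_ge0// lerXn2r ?nnegrE ?mulr_ge0 ?sqrtr_ge0 ?expR_ge0//.
  by rewrite ler_wpM2r ?expR_ge0.
rewrite -expRD -expRM_natl -expRD ler_expR.
have -> : m%:R * ((x + x ^+ 2 / 2 + 2 * x ^+ 3) / 2 - c) =
    (m%:R * x ^+ 2) / 4 + (m%:R * x ^+ 2) * x by rewrite /x; field.
by rewrite x2; lra.
Qed.

(** The Laplace parameter is [l = 1 / sqrt (2 * m)]. The second-order noise terms sum to
    [2 * m * l ^+ 2 = 1], and [m >= 2] gives [l <= 1 / 2], so the signal enters with weight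
    [l / (1 + 2 * l) >= l / 2]. *)
Lemma t_stat_lower_tail (eps : R) (eta : nat -> R) (m : nat) :
  0 < eps -> (1 < m)%N ->
  (\int[P]_w (expR (- t_stat eps m (observation xi eps eta w)))%:E <=
   (expR (1 - (2 * Num.sqrt (2 * m%:R))^-1 *
     \sum_(i < m) (eta i / eps) ^+ 2))%:E)%E.
Proof.
move=> eps0 m1.
have m1R : 2 <= m%:R :> R by rewrite ler_nat.
set s := Num.sqrt (2 * m%:R).
have s2 : s ^+ 2 = 2 * m%:R by rewrite sqr_sqrtr//; lra.
have s_ge2 : 2 <= s.
  by rewrite -ler_sqr ?nnegrE ?sqrtr_ge0// s2; lra.
have s0 : 0 < s by lra.
pose l := s^-1.
have l0 : 0 < l by rewrite invr_gt0.
have l1 : l <= 2^-1 by rewrite /l lef_pV2 ?posrE.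
under eq_integral.
  move=> w _; rewrite t_stat_observation ?gt_eqF// -/s -mulNr; over.
rewrite (expectation_expR_chi_square (- s^-1) (fun i => eta i / eps)); last first.
  by rewrite -/l; lra.
rewrite -/l lee_fin.
have sqle : (Num.sqrt (1 - 2 * - l))^-1 <= expR (- l + 2 * l ^+ 2).
  rewrite -sqrtrV; last by lra.
  rewrite -ler_sqr ?nnegrE ?sqrtr_ge0 ?expR_ge0// sqr_sqrtr ?invr_ge0; last by lra.
  rewrite -expRM_natl (_ : 1 - 2 * - l = 1 + 2 * l); last by ring.
  rewrite (_ : 2 * (- l + 2 * l ^+ 2) = - (2 * l) + (2 * l) ^+ 2); last by ring.
  by apply: invr_1D_le_expR; lra.
apply: (@le_trans _ _ ((expR (- l + 2 * l ^+ 2) * expR (- - l)) ^+ m *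
    expR (- l / (1 - 2 * - l) * \sum_(i < m) (eta i / eps) ^+ 2))).
  rewrite ler_wpM2r ?expR_ge0// lerXn2r ?nnegrE ?mulr_ge0 ?invr_ge0 ?sqrtr_ge0 ?expR_ge0//.
  by rewrite ler_wpM2r ?expR_ge0.
rewrite -expRD -expRM_natl -expRD ler_expR.
have -> : m%:R * (- l + 2 * l ^+ 2 - - l) = 1.
  rewrite (_ : m%:R * (_ - _) = (2 * m%:R) * l ^+ 2); last by ring.
  by rewrite /l exprVn s2 divff// gt_eqF//; lra.
rewrite lerD2l !mulNr lerN2 ler_wpM2r ?sumr_ge0//.
  by move=> i _; exact: sqr_ge0.
rewrite invfM -/l mulrC ler_pM2l// lef_pV2 ?posrE; lra.
Qed.

End chi_square_tails.

Section zeta_tail.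
Context (R : realType).

Lemma expR_half_le2 : expR 2^-1 <= 2 :> R.
Proof.
rewrite -[X in expR X]opprK expRN -[leRHS]invrK lef_pV2 ?posrE ?expR_gt0//.
have := expR_ge1Dx (- 2^-1 : R); lra.
Qed.

(** From [2 >= expR (1 / 2)] and the fourth Taylor term at [k / 2]; the constant is
    [384 = 2 ^ 4 * 4!]. *)
Lemma pow2_ge_pow4 (k : nat) : k%:R ^+ 4 / 384 <= (2 ^ k)%:R :> R.
Proof.
rewrite natrX; apply: (@le_trans _ _ (expR 2^-1 ^+ k)); last first.
  by rewrite lerXn2r ?nnegrE ?expR_ge0// expR_half_le2.
rewrite -expRM_natr; apply: le_trans (expR_ge1Dxn 3 _); last by rewrite mulr_ge0.
rewrite (_ : 4`! = 24)%N// exprMn.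
have : 0 <= k%:R ^+ 4 :> R by exact: exprn_ge0.
lra.
Qed.

(* Makes [sum_k k ^ (- q - 1)] telescope, so the tail needs no integral test. *)
Lemma powR_sub_ge (q : R) (k : nat) : 0 < q -> (1 < k)%N ->
  expR (- (q + 1) * ln k%:R) <=
  q^-1 * (expR (- q * ln k.-1%:R) - expR (- q * ln k%:R)).
Proof.
move=> q0 k1; rewrite [leRHS]mulrC ler_pdivlMr//.
have k0 : 0 < k%:R :> R by rewrite ltr0n; lia.
have k10 : 0 < k.-1%:R :> R by rewrite ltr0n; lia.
have kE : k.-1%:R = k%:R - 1 :> R by rewrite -subn1 natrB//; lia.
have l1 : k%:R^-1 <= ln k%:R - ln k.-1%:R :> R.
  have := @le_ln1Dx R (- k%:R^-1).
  have k2 : k%:R^-1 < 1 :> R by rewrite invf_lt1// ltr1n.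
  move=> /(_ ltac:(lra)).
  rewrite (_ : 1 + - k%:R^-1 = k.-1%:R / k%:R); last first.
    by rewrite kE mulrBl divff ?gt_eqF// mul1r.
  by rewrite ln_div ?posrE//; lra.
have e1 : expR (- q * ln k.-1%:R) =
    expR (- q * ln k%:R) * expR (q * (ln k%:R - ln k.-1%:R)).
  by rewrite -expRD; congr expR; ring.
have e2 : expR (- (q + 1) * ln k%:R) = expR (- q * ln k%:R) * k%:R^-1.
  have <- : expR (- ln k%:R) = k%:R^-1 :> R by rewrite expRN lnK.
  by rewrite -expRD; congr expR; ring.
rewrite e1 e2 -mulrA -[in X in _ <= X](mulr1 (expR (- q * ln k%:R))).
rewrite -!mulrA -mulrBr ler_pM2l ?expR_gt0//.
have := expR_ge1Dx (q * (ln k%:R - ln k.-1%:R)).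
have : q * k%:R^-1 <= q * (ln k%:R - ln k.-1%:R) by rewrite ler_pM2l.
rewrite mul1r; lra.
Qed.

End zeta_tail.

(** * Error probabilities of the scanning test *)

Section adaptive_test_errors.
Context (d : measure_display) (Omega : measurableType d) (R : realType).
Variables (P : probability Omega R) (xi : nat -> {RV P >-> R}).
Hypothesis hxi : iid_standard_normal xi.
Local Notation seqT := (g_sigma_algebraType (@cylinders R)).
Implicit Types (eps C : R) (eta : nat -> R) (f psi : (nat -> R) -> R).

Lemma EobsE eps eta f :
  Eobs xi eps eta f = fine (\int[P]_w (f (observation xi eps eta w))%:E).
Proof. by rewrite /Eobs unlock. Qed.

Lemma measurable_comp_observation eps eta f :
  measurable_fun [set: seqT] f ->
  measurable_fun setT (fun w => f (observation xi eps eta w)).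
Proof.
move=> mf.
exact: (measurableT_comp mf (measurable_observation _ _ _ _ xi eps eta)).
Qed.

Lemma integral_observation_le1 eps eta f : measurable_fun [set: seqT] f ->
  (forall y, 0 <= f y <= 1) ->
  (\int[P]_w (f (observation xi eps eta w))%:E <= 1)%E.
Proof.
move=> mf f01; have {1}<- : (1 * P setT)%E = 1%E.
  by rewrite probability_setT mule1.
rewrite -(integral_cst P measurableT 1%E); apply: ge0_le_integral => //.
- by move=> w _; rewrite lee_fin; case/andP: (f01 (observation xi eps eta w)).
- exact/measurable_EFinP/measurable_comp_observation.
- by move=> w _; rewrite lee_fin; case/andP: (f01 (observation xi eps eta w)).
Qed.

Lemma EobsEFin eps eta f : measurable_fun [set: seqT] f ->
  (forall y, 0 <= f y <= 1) ->
  ((Eobs xi eps eta f)%:E = \int[P]_w (f (observation xi eps eta w))%:E)%E.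
Proof.
move=> mf f01; rewrite EobsE fineK// ge0_fin_numE; last first.
  by apply: integral_ge0 => w _; rewrite lee_fin; case/andP: (f01 (observation xi eps eta w)).
exact: le_lt_trans (integral_observation_le1 _ _ _ mf f01) (ltry _).
Qed.

Lemma Eobs_ge0 eps eta f : (forall y, 0 <= f y) -> 0 <= Eobs xi eps eta f.
Proof.
move=> f0; rewrite EobsE; apply: fine_ge0.
by apply: integral_ge0 => w _; rewrite lee_fin.
Qed.

Lemma Eobs_le1 eps eta f : measurable_fun [set: seqT] f ->
  (forall y, 0 <= f y <= 1) -> Eobs xi eps eta f <= 1.
Proof.
by move=> mf f01; rewrite -lee_fin EobsEFin//; exact: integral_observation_le1.
Qed.

Lemma measurable_test_rejection C (L : int) eps :
  measurable ([set y | exists k : nat, [/\ (0 < k)%N, L <= k%:Z &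
    t_stat eps (2 ^ k)%N y > threshold C k]] : set seqT).
Proof.
rewrite (_ : [set y | _] = \bigcup_k (if (0 < k)%N && (L <= k%:Z)
    then [set y | t_stat eps (2 ^ k)%N y > threshold C k] else set0)); last first.
  apply/seteqP; split=> y /=.
    by move=> [k [k0 Lk h]]; exists k => //; rewrite k0 Lk.
  by move=> [k _]; case: ifPn => // /andP[k0 Lk] h; exists k.
apply: bigcupT_measurable => k; case: ifP => // _.
rewrite (_ : [set y | _] = (t_stat eps (2 ^ k)%N : seqT -> R) @^-1`
    `]threshold C k, +oo[%classic); last first.
  by apply/seteqP; split=> w /=; rewrite in_itv/= andbT.
by rewrite -[X in measurable X]setTI; apply: measurable_t_stat.
Qed.

Lemma is_test_psi_adaptive C (L : int) eps : is_test (psi_adaptive C L eps).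
Proof.
split.
  exact: (measurable_indic (measurable_test_rejection C L eps)).
by move=> y; rewrite /psi_adaptive indicE; case: (_ \in _); rewrite ?ler01 ?lexx.
Qed.

(** Union bound over the levels [k >= n]. As [3072 = 8 * 384], the lower bound on [n] gives
    [8 * (C * k) ^+ 3 <= 2 ^ k], which implies both size conditions of [t_stat_upper_tail]. *)
Lemma alpha_psi_adaptive_le C (n : nat) eps : 2 < C -> 0 < eps ->
  (2 <= n)%N -> 3072 * C ^+ 3 <= n%:R ->
  alpha_err xi eps (psi_adaptive C n%:Z eps) <=
  expR 1 * (C / 2 - 1)^-1 * expR (- (C / 2 - 1) * ln n.-1%:R).
Proof.
move=> C2 eps0 n2 Cn; set q := C / 2 - 1.
have q0 : 0 < q by rewrite /q; lra.
have [mpsi psi01] := is_test_psi_adaptive C n%:Z eps.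
rewrite -lee_fin /alpha_err EobsEFin//.
pose A : set seqT := [set y | exists k : nat, [/\ (0 < k)%N, n%:Z <= k%:Z &
    t_stat eps (2 ^ k)%N y > threshold C k]].
have mobs := measurable_observation _ _ _ _ xi eps (fun=> 0).
have mA : measurable (observation xi eps (fun=> 0) @^-1` A).
  rewrite -[X in measurable X]setTI.
  by apply: mobs => //; exact: measurable_test_rejection.
rewrite [leLHS](_ : _ = P (observation xi eps (fun=> 0%R) @^-1` A)); last first.
  by rewrite -[X in P X]setIT -integral_indic.
pose F k := if (n <= k)%N then
  [set w | threshold C k < t_stat eps (2 ^ k)%N (observation xi eps (fun=> 0) w)]
  else set0.
have mF k : measurable (F k).
  rewrite /F; case: ifP => // _.
  rewrite (_ : [set y | _] = (fun w => t_stat eps (2 ^ k)%N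
      (observation xi eps (fun=> 0) w)) @^-1` `]threshold C k, +oo[%classic); last first.
    by apply/seteqP; split=> w /=; rewrite in_itv/= andbT.
  rewrite -[X in measurable X]setTI.
  by apply: measurable_t_stat_observation.
apply: (@le_trans _ _ (\sum_(0 <= k <oo) P (F k))%E).
  apply: measure_sigma_subadditive => // w [k [k0 nk h]].
  by exists k => //; rewrite /F; move: nk; rewrite lez_nat => ->.
pose u k : R := expR (- q * ln k%:R).
(* A telescoping majorant of [P (F k)]: half the squared threshold is [(q + 1) * ln k], the exponent
   in [powR_sub_ge]. *)
pose g k : R := if (n <= k)%N then expR 1 * (q^-1 * (u k.-1 - u k)) else 0.
have Fg k : (P (F k) <= (g k)%:E)%E.
  rewrite /F /g; case: ifPn => [nk|_]; last by rewrite measure0.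
  have k2 : (1 < k)%N by exact: leq_trans nk.
  have k1R : 1 <= k%:R :> R by rewrite ler1n; lia.
  have lnk0 : 0 <= ln k%:R :> R by exact: ln_ge0.
  have thr2 : threshold C k ^+ 2 = C * ln k%:R.
    by rewrite sqr_sqrtr// mulr_ge0//; lra.
  have lnk : ln k%:R <= k%:R :> R by apply/ltW/ln_sublinear; lra.
  have Ck : 3072 * C ^+ 3 <= k%:R.
    by apply: le_trans Cn _; rewrite ler_nat.
  have key : 8 * (C * k%:R) ^+ 3 <= (2 ^ k)%:R.
    apply: le_trans (pow2_ge_pow4 R k).
    rewrite exprMn [k%:R ^+ 4]exprS.
    have k30 : 0 <= k%:R ^+ 3 :> R by apply: exprn_ge0; lra.
    have := ler_wpM2r k30 Ck; lra.
  have Clk : C * ln k%:R <= C * k%:R by rewrite ler_pM2l//; lra.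
  have Ck1 : 1 <= C * k%:R.
    by apply: (@le_trans _ _ (1 * 1)); [rewrite mulr1|apply: ler_pM => //; lra].
  have Clk0 : 0 <= C * ln k%:R by rewrite mulr_ge0//; lra.
  apply: le_trans (_ : _ <= (expR (1 - threshold C k ^+ 2 / 2))%:E)%E _.
    apply: t_stat_upper_tail => //.
    - exact: sqrtr_ge0.
    - by rewrite expn_gt0.
    - rewrite thr2; apply: le_trans key; rewrite ler_pM2l//.
      apply: le_trans Clk _; rewrite -[leLHS]expr1.
      exact: ler_weXn2l.
    - rewrite (_ : threshold C k ^+ 6 = (threshold C k ^+ 2) ^+ 3); last by rewrite -exprM.
      rewrite thr2; apply: le_trans key; rewrite ler_pM2l//.
      by rewrite lerXn2r// nnegrE//; lra.
  rewrite lee_fin thr2 expRD ler_pM2l ?expR_gt0//.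
  apply: le_trans (powR_sub_ge R q k q0 k2); rewrite ler_expR /q; lra.
have g_sum N : \sum_(0 <= k < N) g k <= expR 1 * q^-1 * u n.-1.
  have e0 : 0 < expR 1 * q^-1 by rewrite mulr_gt0 ?expR_gt0 ?invr_gt0.
  suff -> : \sum_(0 <= k < N) g k =
      if (N <= n)%N then 0 else expR 1 * q^-1 * (u n.-1 - u N.-1).
    case: ifP => _; first by rewrite mulr_ge0 ?expR_ge0// ltW.
    by rewrite ler_pM2l// lerBlDr lerDl expR_ge0.
  elim: N => [|N IH]; first by rewrite big_geq.
  rewrite big_nat_recr//= IH /g.
  case: (ltngtP N n) => [Nn|nN|->].
  - by rewrite addr0.
  - by ring.
  - by rewrite add0r; ring.
apply: lime_le; first by apply: is_cvg_nneseries => k _ _; exact: measure_ge0.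
apply: nearW => N; apply: (@le_trans _ _ (\sum_(0 <= k < N) (g k)%:E)%E).
  by apply: lee_sum => k _; exact: Fg.
by rewrite sumEFin lee_fin.
Qed.

(** Acceptance forces the statistic below its threshold at every scanned level, so a Chernoff bound
    at one well-chosen level [k] is enough. *)
Lemma type_II_psi_adaptive_le C (L : int) eps eta (k : nat) : 0 < eps ->
  (0 < k)%N -> L <= k%:Z ->
  Eobs xi eps eta (fun y => 1 - psi_adaptive C L eps y) <=
  expR (1 + threshold C k - (2 * Num.sqrt (2 * (2 ^ k)%:R))^-1 *
     \sum_(i < (2 ^ k)%N) (eta i / eps) ^+ 2).
Proof.
move=> eps0 k0 Lk.
have [mpsi psi01] := is_test_psi_adaptive C L eps.
have psi01' y : 0 <= 1 - psi_adaptive C L eps y <= 1.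
  by case/andP: (psi01 y) => h1 h2; apply/andP; split; lra.
have m1psi : measurable_fun [set: seqT] (fun y => 1 - psi_adaptive C L eps y).
  exact: measurable_funB.
rewrite -lee_fin EobsEFin//.
pose G w := expR (threshold C k) *
  expR (- t_stat eps (2 ^ k)%N (observation xi eps eta w)).
have mE : measurable_fun setT (fun w =>
    (expR (- t_stat eps (2 ^ k)%N (observation xi eps eta w)))%:E).
  apply/measurable_EFinP; apply: measurableT_comp => //.
  apply: measurableT_comp => //; exact: measurable_t_stat_observation.
apply: (@le_trans _ _ (\int[P]_w (G w)%:E)%E).
  apply: ge0_le_integral => //.
  - by move=> w _; rewrite lee_fin; case/andP: (psi01' (observation xi eps eta w)).
  - exact/measurable_EFinP/(measurable_comp_observation _ _ _ m1psi).
  - rewrite /G; apply/measurable_EFinP/measurable_funM => //.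
    exact/measurable_EFinP.
  - move=> w _; rewrite lee_fin /G -expRD /psi_adaptive indicE.
    have [|h] := boolP (_ \in _).
      by rewrite subrr expR_ge0.
    rewrite subr0 -[leLHS]expR0 ler_expR subr_ge0 leNgt.
    by apply: contra h => h; apply/mem_set; exists k.
rewrite /G; under eq_integral do rewrite EFinM.
rewrite ge0_integralZl_EFin ?expR_ge0//.
apply: (@le_trans _ _ ((expR (threshold C k))%:E *
    (expR (1 - (2 * Num.sqrt (2 * (2 ^ k)%:R))^-1 *
     \sum_(i < (2 ^ k)%N) (eta i / eps) ^+ 2))%:E)%E).
  rewrite lee_wpmul2l ?lee_fin ?expR_ge0//; apply: t_stat_lower_tail => //.
  by rewrite -{1}(expn0 2) ltn_exp2l.
by rewrite -EFinM lee_fin -expRD ler_expR; lra.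
Qed.

End adaptive_test_errors.

(** * The ellipsoids and the quantity [u_eps] *)

Section ellipsoid.
Context (R : realType).
Implicit Types (f eta : nat -> R) (kappa : R * R) (eps rho x : R).

Lemma nneseries_leP f (B : R) : (forall k, 0 <= f k) ->
  (\sum_(0 <= k <oo) (f k)%:E <= B%:E)%E <->
  (forall N, \sum_(0 <= k < N) f k <= B).
Proof.
move=> f0; split=> [h N|h].
  rewrite -lee_fin -sumEFin; apply: le_trans h.
  by apply: nneseries_lim_ge => k _ _; rewrite lee_fin.
apply: lime_le; first by apply: is_cvg_nneseries => k _ _; rewrite lee_fin.
by apply: nearW => N; rewrite sumEFin lee_fin.
Qed.

Lemma le_nneseries f (B : R) (N : nat) : (forall k, 0 <= f k) ->
  B <= \sum_(0 <= k < N) f k -> (B%:E <= \sum_(0 <= k <oo) (f k)%:E)%E.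
Proof.
move=> f0 h; apply: (@le_trans _ _ (\sum_(0 <= k < N) (f k)%:E)%E).
  by rewrite sumEFin lee_fin.
by apply: nneseries_lim_ge => k _ _; rewrite lee_fin.
Qed.

Lemma pow_seq_le (s : R) (i m : nat) : 0 <= s -> (i < m)%N ->
  pow_seq s i <= m%:R `^ s.
Proof.
move=> s0 im; rewrite /pow_seq; apply: ge0_ler_powR => //.
- by rewrite nnegrE.
- by rewrite nnegrE.
- by rewrite ler_nat.
Qed.

Lemma pow_seq_ge (s : R) (i m : nat) : 0 <= s -> (m <= i)%N ->
  m%:R `^ s <= pow_seq s i.
Proof.
move=> s0 im; rewrite /pow_seq; apply: ge0_ler_powR => //.
- by rewrite nnegrE.
- by rewrite nnegrE.
- by rewrite ler_nat ltnW.
Qed.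

(* Frequencies beyond [m] contribute at most [m^(-2 alpha)], half of
   [rho ^+ 2], so the first [m] carry the other half. *)
Lemma Theta_kappa_low_energy kappa rho eta (m : nat) :
  0 <= kappa.1 -> 0 <= kappa.2 -> (0 < m)%N ->
  2 <= rho ^+ 2 * (m%:R `^ kappa.1) ^+ 2 -> Theta_kappa kappa rho eta ->
  rho ^+ 2 / 2 <= (m%:R `^ kappa.2) ^+ 2 * \sum_(0 <= i < m) eta i ^+ 2.
Proof.
move=> a0 b0 m0 hm [_ hX hs].
set a := kappa.1; set b := kappa.2; set s := \sum_(0 <= i < m) _.
have ma : 0 < m%:R `^ a by rewrite powR_gt0// ltr0n.
have ma2 : 0 < (m%:R `^ a) ^+ 2 by rewrite exprn_gt0.
pose X k := `|pow_seq a k * pow_seq b k * eta k| ^+ 2.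
have X0 k : 0 <= X k by exact: exprn_ge0.
have XN := (nneseries_leP X 1 X0).1 hX.
pose c := ((m%:R `^ a) ^+ 2)^-1.
have c0 : 0 <= c by rewrite invr_ge0 ltW.
(* Below [m] the weight is at most [m ^ b]; from [m] on, dividing the ellipsoid term [X k] by the
   squared smoothness weight gains at least [c]. *)
pose f k := if (k < m)%N then (m%:R `^ b) ^+ 2 * eta k ^+ 2 else 0.
have f0 k : 0 <= f k by rewrite /f; case: ifP => // _; rewrite mulr_ge0 ?sqr_ge0.
have fN N : \sum_(0 <= k < N) f k <= (m%:R `^ b) ^+ 2 * s.
  apply: (@le_trans _ _ (\sum_(0 <= k < m + N) f k)).
    rewrite (@big_cat_nat _ _ _ N 0 (m + N))//= ?leq_addl// lerDl.
    by apply: sumr_ge0.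
  rewrite (@big_cat_nat _ _ _ m 0 (m + N))//= ?leq_addr//.
  rewrite [X in _ + X]big_nat_cond [X in _ + X]big1 ?addr0; last first.
    by move=> i /andP[/andP[mi _] _]; rewrite /f ltnNge mi.
  rewrite mulr_sumr big_nat_cond [leRHS]big_nat_cond le_eqVlt; apply/orP; left.
  by apply/eqP/eq_bigr => i /andP[/andP[_ im] _]; rewrite /f im.
have le1 k : pow_seq b k ^+ 2 * eta k ^+ 2 <= f k + c * X k.
  rewrite /f; case: ltnP => km.
    rewrite -[leLHS]addr0 lerD ?mulr_ge0//.
    rewrite ler_wpM2r ?sqr_ge0// lerXn2r ?nnegrE ?powR_ge0 ?pow_seq_le//.
  rewrite add0r /X real_normK ?num_real// !exprMn /c -mulrA ler_pdivlMl//.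
  apply: ler_wpM2r; first by apply: mulr_ge0; exact: sqr_ge0.
  by rewrite lerXn2r ?nnegrE ?powR_ge0 ?pow_seq_ge.
have : rho ^+ 2 <= (m%:R `^ b) ^+ 2 * s + c.
  rewrite -lee_fin; apply: le_trans hs _.
  apply/nneseries_leP => [k|N]; first by rewrite mulr_ge0 ?sqr_ge0.
  apply: (@le_trans _ _ (\sum_(0 <= k < N) (f k + c * X k))).
    by apply: ler_sum => k _; exact: le1.
  rewrite big_split/= lerD// -mulr_sumr -[leRHS]mulr1 ler_wpM2l//.
have : c <= rho ^+ 2 / 2.
  by rewrite /c -[leLHS]mul1r ler_pdivrMr// mulrAC ler_pdivlMr// mul1r.
lra.
Qed.

(** Cauchy-Schwarz, read off from the nonnegativity of the sum of [(m * eta i ^+ 2 - s) ^+ 2]. *)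
Lemma sum_sqr_le_sum_pow4 eta (m : nat) :
  (\sum_(0 <= i < m) eta i ^+ 2) ^+ 2 <= m%:R * \sum_(0 <= i < m) eta i ^+ 4.
Proof.
case: m => [|m]; first by rewrite !big_geq// expr0n/= mul0r.
set s := \sum_(0 <= i < _) eta i ^+ 2; set q := \sum_(0 <= i < _) eta i ^+ 4.
have m0 : 0 < m.+1%:R :> R by rewrite ltr0n.
have : 0 <= \sum_(0 <= i < m.+1) (m.+1%:R * eta i ^+ 2 - s) ^+ 2.
  by apply: sumr_ge0 => i _; exact: sqr_ge0.
rewrite (eq_bigr (fun i => m.+1%:R ^+ 2 * eta i ^+ 4 +
    (- (2 * m.+1%:R * s)) * eta i ^+ 2 + s ^+ 2)); last by move=> i _; ring.
have -> : \sum_(0 <= i < m.+1) (m.+1%:R ^+ 2 * eta i ^+ 4 +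
    (- (2 * m.+1%:R * s)) * eta i ^+ 2 + s ^+ 2) =
    m.+1%:R ^+ 2 * q + (- (2 * m.+1%:R * s)) * s + m.+1%:R * s ^+ 2.
  rewrite !big_split/=; congr (_ + _ + _); [by rewrite -mulr_sumr..|].
  by rewrite sumr_const_nat subn0 mulr_natl.
rewrite (_ : m.+1%:R ^+ 2 * q + _ + _ = m.+1%:R * (m.+1%:R * q - s ^+ 2)); last first.
  by ring.
by rewrite pmulr_rge0// subr_ge0.
Qed.

Lemma Theta_kappa_low_pow4 kappa rho eta (m : nat) :
  0 <= kappa.1 -> 0 <= kappa.2 -> (0 < m)%N ->
  2 <= rho ^+ 2 * (m%:R `^ kappa.1) ^+ 2 -> Theta_kappa kappa rho eta ->
  ((rho ^+ 4 / (4 * m%:R * (m%:R `^ kappa.2) ^+ 4))%:E <=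
   \sum_(0 <= k <oo) (eta k ^+ 4)%:E)%E.
Proof.
move=> a0 b0 m0 hm hT.
have h := Theta_kappa_low_energy _ _ _ _ a0 b0 m0 hm hT.
have mR : 0 < m%:R :> R by rewrite ltr0n.
have mb : 0 < m%:R `^ kappa.2 by rewrite powR_gt0.
apply: (@le_nneseries _ _ m); first by move=> k; rewrite exprn_even_ge0.
rewrite ler_pdivrMr; last by rewrite !mulr_gt0// exprn_gt0.
have cs := sum_sqr_le_sum_pow4 eta m.
set s := \sum_(0 <= i < m) eta i ^+ 2 in h cs; set q := \sum_(0 <= i < m) _ in cs *.
have h2 : (rho ^+ 2 / 2) ^+ 2 <= ((m%:R `^ kappa.2) ^+ 2 * s) ^+ 2.
  have r0 : 0 <= rho ^+ 2 / 2 by rewrite divr_ge0// sqr_ge0.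
  by rewrite lerXn2r// nnegrE//; exact: le_trans h.
have b4 : 0 <= (m%:R `^ kappa.2) ^+ 4 by exact/exprn_ge0/ltW.
have := ler_wpM2l b4 cs; move: h2; lra.
Qed.

(** The lower bound on the infimum in [u_eps], turned into an upper bound on [rho]: since [u_eps]
    may be infinite, a finite bound on it is the convenient hypothesis. *)
Lemma u_eps_le_bound eps kappa rho x (m : nat) : 0 < eps -> 0 <= x ->
  0 <= kappa.1 -> 0 <= kappa.2 -> (0 < m)%N ->
  2 <= rho ^+ 2 * (m%:R `^ kappa.1) ^+ 2 ->
  (u_eps eps kappa rho <= x%:E)%E ->
  rho ^+ 4 <= 8 * eps ^+ 4 * x ^+ 2 * (m%:R * (m%:R `^ kappa.2) ^+ 4).
Proof.
move=> e0 x0 a0 b0 m0 hm; rewrite /u_eps.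
set I := ereal_inf _; set c := (2 * eps ^+ 4)^-1.
have e4 : 0 < 2 * eps ^+ 4 by rewrite mulr_gt0// exprn_gt0.
have c0 : 0 < c by rewrite invr_gt0.
have mR : 0 < m%:R :> R by rewrite ltr0n.
have mb : 0 < (m%:R `^ kappa.2) ^+ 4 by rewrite exprn_gt0// powR_gt0.
have -> : x%:E = sqrte (x ^+ 2)%:E by rewrite /= sqrtr_sqr ger0_norm.
rewrite lee_sqrt ?lee_fin ?sqr_ge0// => h.
have hI : ((rho ^+ 4 / (4 * m%:R * (m%:R `^ kappa.2) ^+ 4))%:E <= I)%E.
  apply: le_ereal_inf_tmp => _ [eta hT <-].
  exact: Theta_kappa_low_pow4.
have {hI} := lee_wpmul2l (ltW c0 : (0 <= c%:E)%E) hI.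
move=> /le_trans/(_ h); rewrite -EFinM lee_fin /c ler_pdivrMl//.
have d0 : 0 < 4 * m%:R * (m%:R `^ kappa.2) ^+ 4 by do 2 apply: mulr_gt0 => //.
rewrite ler_pdivrMr//; lra.
Qed.

(** Indices [n] to [n.*2 - 1] are the frequencies [n + 1] to [2 * n], where the weights lie between
    their values at [n] and at [2 * n]. The amplitudes [s] are left free so that flat and randomly
    signed blocks share one definition. *)
Definition block (n : nat) (s : nat -> R) : nat -> R :=
  fun i => if (n <= i < n.*2)%N then s i else 0.

Lemma sum_block (n N : nat) (g : nat -> R) :
  (forall i, 0 <= g i) -> (forall i, ~~ (n <= i < n.*2)%N -> g i = 0) ->
  \sum_(0 <= i < N) g i <= \sum_(n <= i < n.*2) g i.
Proof.
move=> g0 gn; apply: (@le_trans _ _ (\sum_(0 <= i < n.*2 + N) g i)).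
  rewrite (@big_cat_nat _ _ _ N 0 (n.*2 + N))//= ?leq_addl// lerDl.
  exact: sumr_ge0.
have n2 : (n <= n.*2)%N by rewrite -addnn leq_addr.
rewrite (@big_cat_nat _ _ _ n.*2 0)//= ?leq_addr//.
rewrite (@big_cat_nat _ _ _ n 0)//=.
rewrite [X in X + _ + _]big_nat_cond [X in X + _ + _]big1 ?add0r; last first.
  by move=> i /andP[/andP[_ iN] _]; apply: gn; lia.
rewrite [X in _ + X]big_nat_cond [X in _ + X]big1 ?addr0// => i.
by move=> /andP[/andP[iN _] _]; apply: gn; lia.
Qed.

(** Both constraints see only the squares of the amplitudes, so signs are arbitrary; the ellipsoid
    is checked with the weights at [n.*2], the energy with those at [n]. *)
Lemma Theta_kappa_block kappa rho (n : nat) (v : R) (s : nat -> R) :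
  0 <= kappa.1 -> 0 <= kappa.2 -> (forall i, s i ^+ 2 = v ^+ 2) ->
  n%:R * ((n.*2%:R `^ kappa.1 * n.*2%:R `^ kappa.2) ^+ 2 * v ^+ 2) <= 1 ->
  rho ^+ 2 <= n%:R * ((n%:R `^ kappa.2) ^+ 2 * v ^+ 2) ->
  Theta_kappa kappa rho (block n s).
Proof.
move=> a0 b0 sv h1 h2.
have bE i : (n <= i < n.*2)%N -> block n s i ^+ 2 = v ^+ 2.
  by move=> h; rewrite /block h.
have b00 i : ~~ (n <= i < n.*2)%N -> block n s i = 0.
  by move=> h; rewrite /block (negbTE h).
have cst_le (g : nat -> R) (c : R) : (forall i, (n <= i < n.*2)%N -> g i <= c) ->
    \sum_(n <= i < n.*2) g i <= n%:R * c.
  move=> gc; apply: (@le_trans _ _ (\sum_(n <= i < n.*2) c)).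
    by apply: ler_sum_nat => i /gc.
  by rewrite sumr_const_nat -addnn addnK mulr_natl.
split.
- apply: (@le_lt_trans _ _ (n%:R * v ^+ 2)%:E); last exact: ltry.
  apply/nneseries_leP => [k|N]; first exact: sqr_ge0.
  apply: le_trans (sum_block _ N _ _ _) (cst_le _ _ _).
  + by move=> i; exact: sqr_ge0.
  + by move=> i /b00 ->; rewrite expr0n.
  + by move=> i /bE ->.
- apply/nneseries_leP => [k|N]; first exact: exprn_ge0.
  apply: le_trans h1; apply: le_trans (sum_block _ N _ _ _) (cst_le _ _ _).
  + by move=> i; exact: exprn_ge0.
  + by move=> i /b00 ->; rewrite mulr0 normr0 expr0n.
  + move=> i h; rewrite real_normK ?num_real// exprMn bE//.
    rewrite ler_wpM2r ?sqr_ge0// lerXn2r ?nnegrE ?mulr_ge0 ?powR_ge0//.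
    by rewrite ler_pM ?powR_ge0 ?pow_seq_le//; lia.
- apply: (@le_nneseries _ _ n.*2); first by move=> k; rewrite mulr_ge0 ?sqr_ge0.
  apply: le_trans h2 _; rewrite (@big_cat_nat _ _ _ n 0)//=; last first.
    by rewrite -addnn leq_addr.
  rewrite -[leLHS]add0r lerD//.
    by apply: sumr_ge0 => k _; rewrite mulr_ge0 ?sqr_ge0.
  have -> (c : R) : n%:R * c = \sum_(n <= i < n.*2) c.
    by rewrite sumr_const_nat -addnn addnK mulr_natl.
  apply: ler_sum_nat => i h.
  rewrite bE// ler_wpM2r ?sqr_ge0// lerXn2r ?nnegrE ?powR_ge0//.
  by rewrite pow_seq_ge//; lia.
Qed.

(** A flat block whose amplitude [v] gives it guaranteed energy exactly [rho ^+ 2] is a competitor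
    in the infimum. The first condition on [rho] is its ellipsoid constraint, the second compares
    its fourth powers with [x]. *)
Lemma u_eps_le eps kappa rho x (n : nat) : 0 < eps -> 0 <= x ->
  0 <= kappa.1 -> 0 <= kappa.2 -> (0 < n)%N ->
  (2 `^ kappa.1 * 2 `^ kappa.2 * n%:R `^ kappa.1 * rho) ^+ 2 <= 1 ->
  rho ^+ 4 <= 2 * eps ^+ 4 * x ^+ 2 * (n%:R * (n%:R `^ kappa.2) ^+ 4) ->
  (u_eps eps kappa rho <= x%:E)%E.
Proof.
move=> e0 x0 a0 b0 n0 h1 h2.
have nR : 0 < n%:R :> R by rewrite ltr0n.
have nb : 0 < n%:R `^ kappa.2 by rewrite powR_gt0.
pose v := `|rho| / (Num.sqrt n%:R * n%:R `^ kappa.2).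
have v2 : v ^+ 2 = rho ^+ 2 / (n%:R * (n%:R `^ kappa.2) ^+ 2).
  by rewrite /v expr_div_n real_normK ?num_real// exprMn sqr_sqrtr ?ltW.
have n2E : n.*2%:R = 2 * n%:R :> R by rewrite -mul2n natrM.
have hT : Theta_kappa kappa rho (block n (fun=> v)).
  apply: (Theta_kappa_block _ _ _ v) => //.
    rewrite v2 n2E !powRM ?ler0n//; apply: le_trans _ h1.
    rewrite le_eqVlt; apply/orP; left; apply/eqP; field.
    by rewrite !gt_eqF.
  rewrite v2 le_eqVlt; apply/orP; left; apply/eqP; field.
  by rewrite !gt_eqF.
have v4 : v ^+ 4 = rho ^+ 4 / (n%:R ^+ 2 * (n%:R `^ kappa.2) ^+ 4).
  rewrite (_ : v ^+ 4 = (v ^+ 2) ^+ 2); last by rewrite -exprM.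
  by rewrite v2; field; rewrite !gt_eqF.
have c0 : 0 < 2 * eps ^+ 4 by rewrite mulr_gt0// exprn_gt0.
rewrite /u_eps (_ : x%:E = sqrte (x ^+ 2)%:E); last first.
  by rewrite /= sqrtr_sqr ger0_norm.
rewrite lee_sqrt ?lee_fin ?sqr_ge0// lee_pdivrMl//.
apply: (@le_trans _ _ (\sum_(0 <= k <oo) (block n (fun=> v) k ^+ 4)%:E)%E).
  by apply: ereal_inf_lbound; exists (block n (fun=> v)).
rewrite -EFinM; apply/nneseries_leP => [k|N]; first by rewrite exprn_even_ge0.
apply: (@le_trans _ _ (n%:R * v ^+ 4)).
  apply: le_trans (sum_block n N _ _ _) _.
  - by move=> i; rewrite exprn_even_ge0.
  - by move=> i h; rewrite /block (negbTE h) expr0n.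
  rewrite (_ : n%:R * v ^+ 4 = \sum_(n <= i < n.*2) v ^+ 4); last first.
    by rewrite sumr_const_nat -addnn addnK mulr_natl.
  apply: ler_sum_nat => i h.
  by rewrite /block h.
rewrite v4 (_ : n%:R * _ = rho ^+ 4 / (n%:R * (n%:R `^ kappa.2) ^+ 4)); last first.
  by field; rewrite !gt_eqF.
by rewrite ler_pdivrMr// mulr_gt0// exprn_gt0.
Qed.

End ellipsoid.

Section dyadic_powers.
Context (R : realType).
Implicit Types s : R.

Lemma ln2_ge_half : 2^-1 <= ln 2 :> R.
Proof.
rewrite -ler_expR lnK ?posrE//; exact: expR_half_le2.
Qed.

Lemma ln2_le1 : ln 2 <= 1 :> R.
Proof. by have := @le_ln1Dx R 1; rewrite (_ : 1 + 1 = 2)//; apply; lra. Qed.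

Lemma powR_pow2 s (k : nat) : (2 ^ k)%:R `^ s = expR (s * (k%:R * ln 2)).
Proof.
rewrite /powR pnatr_eq0 expn_eq0/= natrX lnXn//.
by rewrite -[ln 2 *+ k]mulr_natl.
Qed.

Lemma powR_2 s : 2 `^ s = expR (s * ln 2).
Proof. by rewrite /powR pnatr_eq0. Qed.

Lemma pow2_expR (k : nat) : (2 ^ k)%:R = expR (k%:R * ln 2) :> R.
Proof. by rewrite -[k%:R * ln 2]mul1r -powR_pow2 powRr1. Qed.

End dyadic_powers.

Section ereal_ratio.
Context (R : realType).
Implicit Types (u : \bar R) (c y : R).

Lemma lt_ediv u c y : 0 < y -> (c%:E < u / y%:E)%E = ((c * y)%:E < u)%E.
Proof.
move=> y0; rewrite inver gt_eqF//; case: u => [r| |].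
- by rewrite -EFinM !lte_fin ltr_pdivlMr.
- by rewrite gt0_mulye ?lte_fin ?invr_gt0// !ltry.
- by rewrite gt0_mulNye ?lte_fin ?invr_gt0// !ltNge !leNye.
Qed.

Lemma le_edivr u c y : 0 < y -> (u / y%:E <= c%:E)%E = (u <= (c * y)%:E)%E.
Proof. by move=> y0; rewrite !leNgt lt_ediv. Qed.

Lemma lt_edivr u c y : 0 < y -> (u / y%:E < c%:E)%E = (u < (c * y)%:E)%E.
Proof.
move=> y0; rewrite inver gt_eqF//; case: u => [r| |].
- by rewrite -EFinM !lte_fin ltr_pdivrMr.
- by rewrite gt0_mulye ?lte_fin ?invr_gt0// !ltNge !leey.
- by rewrite gt0_mulNye ?lte_fin ?invr_gt0// !ltNyr.
Qed.

Lemma le_ediv u c y : 0 < y -> (c%:E <= u / y%:E)%E = ((c * y)%:E <= u)%E.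
Proof. by move=> y0; rewrite !leNgt lt_edivr. Qed.

End ereal_ratio.

(** * Small noise limits and uniformity over the parameter set *)

Section small_noise.
Context (R : realType).
Implicit Types (A : R) (S : set (R * R)) (r : R -> R * R -> R).

Lemma near0_gt0 : \forall eps \near (0 : R)^'+, 0 < eps.
Proof. exact: nbhs_right_gt. Qed.

Lemma near0_ln_ge A : \forall eps \near (0 : R)^'+, A <= ln eps^-1.
Proof.
near=> eps.
have e0 : 0 < eps by near: eps; exact: near0_gt0.
rewrite lnV ?posrE// lerNr -ler_expR lnK ?posrE//.
by near: eps; apply: nbhs_right_le; exact: expR_gt0.
Unshelve. all: by end_near. Qed.

Lemma near0_loglog_ge A : \forall eps \near (0 : R)^'+, A <= loglog eps.
Proof.
apply: filterS (near0_ln_ge (expR A)) => eps h; rewrite /loglog -ler_expR lnK//.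
by rewrite posrE (lt_le_trans _ h)// expR_gt0.
Qed.

(** The strict inequality yields one neighbourhood of zero on which the bound holds for all [kappa]
    in [S] at once, with the same constant. *)
Lemma limsup_sup_ratio_near S r (uad : R -> R) (c : R) :
  (limsup_sup_ratio S r uad < c%:E)%E ->
  (\forall eps \near (0 : R)^'+, 0 < uad eps) ->
  \forall eps \near (0 : R)^'+, forall kappa, S kappa ->
    (u_eps eps kappa (r eps kappa) <= (c * uad eps)%:E)%E.
Proof.
rewrite /limsup_sup_ratio limf_esupE => /ereal_inf_lt[_ [V FV <-] Vc] u0.
near=> eps => kappa Sk; rewrite -le_edivr; last by near: eps.
apply: ltW; apply: le_lt_trans Vc.
apply: (@le_trans _ _ (ereal_sup [set (u_eps eps kappa (r eps kappa) /
    (uad eps)%:E)%E | kappa in S])).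
  by apply: ereal_sup_ubound; exists kappa.
by apply: ereal_sup_ubound; exists eps => //; near: eps; exact: FV.
Unshelve. all: by end_near. Qed.

Lemma liminf_inf_ratio_near S r (uad : R -> R) (c : R) :
  (liminf_inf_ratio S r uad > c%:E)%E ->
  (\forall eps \near (0 : R)^'+, 0 < uad eps) ->
  \forall eps \near (0 : R)^'+, forall kappa, S kappa ->
    ((c * uad eps)%:E < u_eps eps kappa (r eps kappa))%E.
Proof.
rewrite /liminf_inf_ratio limf_einfE => /ereal_sup_gt[_ [V FV <-] Vc] u0.
near=> eps => kappa Sk; rewrite -lt_ediv; last by near: eps.
apply: lt_le_trans Vc _.
apply: (@le_trans _ _ (ereal_inf [set (u_eps eps kappa (r eps kappa) /
    (uad eps)%:E)%E | kappa in S])).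
  by apply: ereal_inf_lbound; exists eps => //; near: eps; exact: FV.
by apply: ereal_inf_lbound; exists kappa.
Unshelve. all: by end_near. Qed.

Lemma sqrt_loglog_gt0_near : \forall eps \near (0 : R)^'+, 0 < sqrt_loglog eps.
Proof.
apply: filterS (near0_loglog_ge 1) => eps h.
by rewrite sqrtr_gt0; lra.
Qed.

(** Compactness enters the proof through these bounds, on which the uniform constants are built. An
    empty [S] admits any bounds. *)
Lemma compact_positive_bounds S : compact S ->
  (forall kappa, S kappa -> 0 < kappa.1 /\ 0 < kappa.2) ->
  exists lo hi : R, [/\ 0 < lo, lo <= hi & forall kappa, S kappa ->
    lo <= kappa.1 <= hi /\ lo <= kappa.2 <= hi].
Proof.
move=> cS pS; have [->|/set0P S0] := eqVneq S set0.
  by exists 1, 1; split=> // kappa [].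
have c1 : {within S, continuous (fun kappa : R * R => kappa.1)}.
  by apply: continuous_subspaceT => x; exact: cvg_fst.
have c2 : {within S, continuous (fun kappa : R * R => kappa.2)}.
  by apply: continuous_subspaceT => x; exact: cvg_snd.
have [x1 /set_mem Sx1 M1] := compact_EVT_max S0 cS c1.
have [x2 /set_mem Sx2 M2] := compact_EVT_max S0 cS c2.
have [y1 /set_mem Sy1 m1] := compact_EVT_min S0 cS c1.
have [y2 /set_mem Sy2 m2] := compact_EVT_min S0 cS c2.
exists (Num.min y1.1 y2.2), (Num.max x1.1 x2.2); split.
- by rewrite lt_min (pS _ Sy1).1 (pS _ Sy2).2.
- rewrite ge_min le_max; apply/orP; left; apply/orP; left.
  exact: M1 (mem_set Sy1).
- move=> kappa /mem_set Sk.
  rewrite !ge_min !le_max m1// m2// M1// M2// !orbT//.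
Qed.

End small_noise.

(** * Upper bound *)

Section signal.
Context (R : realType).

Lemma sqr_le_of_sqr (x y : R) : 0 <= y -> x ^+ 2 <= y ^+ 2 -> x <= y.
Proof.
move=> y0 h; have [x0|/ltW x0] := leP 0 x; last exact: le_trans y0.
by rewrite -ler_sqr ?nnegrE.
Qed.

(* At the level [2 ^ n] with [n = o(ln (1 / eps))] the noise is polynomially
   small compared with any signal of polynomial size in [2 ^ n]. *)
Lemma mean_ge_threshold_floor (C T hi rho a b s : R) (n : nat) : 0 < C ->
  64 * C <= T -> 1 <= T -> 0 <= hi -> (0 < n)%N ->
  n%:R * (4 * hi + 1) <= T -> 0 <= a <= hi -> 0 <= b <= hi ->
  2 <= rho ^+ 2 * ((2 ^ n)%:R `^ a) ^+ 2 ->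
  rho ^+ 2 / 2 <= ((2 ^ n)%:R `^ b) ^+ 2 * s ->
  2 * threshold C n <=
  (2 * Num.sqrt (2 * (2 ^ n)%:R))^-1 * (s / expR (- T) ^+ 2).
Proof.
move=> C0 CT T1 hi0 n0 hn /andP[a0 ahi] /andP[b0 bhi].
pose y : R := n%:R * ln 2; rewrite !powR_pow2 -/y => h1 h2.
rewrite -expRM_natl in h1; rewrite -expRM_natl in h2.
have nR : 0 < n%:R :> R by rewrite ltr0n.
have nT : n%:R <= T by apply: le_trans hn; rewrite ler_peMr//; lra.
have yn : y <= n%:R by rewrite /y ler_piMr// ?ln2_le1// ltW.
have y0 : 0 <= y by rewrite mulr_ge0// ln_ge0// ler1n.
have s_ge : expR (- (4 * hi * y)) <= s.
  have h3 : expR (- (2 * (a * y))) <= rho ^+ 2 / 2.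
    rewrite expRN -[leLHS]mul1r ler_pdivrMr ?expR_gt0//.
    clear -h1; lra.
  have h4 : expR (- (2 * (a * y))) * expR (- (2 * (b * y))) <= s.
    rewrite [X in _ * X]expRN ler_pdivrMr ?expR_gt0// [leRHS]mulrC.
    exact: le_trans h3 h2.
  apply: le_trans h4; rewrite -expRD ler_expR.
  have := ler_wpM2r y0 ahi; have := ler_wpM2r y0 bhi; clear; lra.
have s0 : 0 <= s by exact: le_trans (expR_ge0 _) s_ge.
have thr_le : threshold C n <= Num.sqrt (C * T).
  rewrite /threshold ler_wsqrtr// ler_pM2l//.
  exact: le_trans (ltW (ln_sublinear nR)) nT.
have thr8 : 8 * Num.sqrt (C * T) <= T.
  apply: sqr_le_of_sqr; first by clear -T1; lra.
  have CT0 : 0 <= C * T by clear -C0 T1; nra.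
  rewrite exprMn sqr_sqrtr//; clear -CT T1; nra.
have n1 : 1 <= (2 ^ n)%:R :> R by rewrite ler1n expn_gt0.
have sq_le : Num.sqrt (2 * (2 ^ n)%:R) <= 2 * (2 ^ n)%:R :> R.
  apply: sqr_le_of_sqr; first by clear -n1; lra.
  by rewrite sqr_sqrtr; clear -n1; nra.
have sq0 : 0 < Num.sqrt (2 * (2 ^ n)%:R) :> R.
  by rewrite sqrtr_gt0; clear -n1; lra.
(* With [eps = expR (- T)], the value [expR T / 4] separates the sides: the threshold is of order
   [sqrt T], while the mean is at least [expR (2 * T - (4 * hi + 1) * y) / 4]. *)
apply: (@le_trans _ _ (expR T / 4)).
  have := expR_ge1Dx T; clear -thr8 thr_le; lra.
have eT0 : 0 < expR (- T) ^+ 2 by rewrite exprn_gt0// expR_gt0.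
apply: (@le_trans _ _ ((4 * (2 ^ n)%:R)^-1 * (s / expR (- T) ^+ 2))); last first.
  apply: ler_wpM2r; first by rewrite divr_ge0// ltW.
  rewrite lef_pV2 ?posrE; clear -sq_le sq0 n1; lra.
apply: (@le_trans _ _ ((4 * (2 ^ n)%:R)^-1 *
    (expR (- (4 * hi * y)) / expR (- T) ^+ 2))); last first.
  apply: ler_wpM2l; first by rewrite invr_ge0; clear -n1; lra.
  by rewrite ler_pM2r// invr_gt0.
have -> : (4 * (2 ^ n)%:R)^-1 * (expR (- (4 * hi * y)) / expR (- T) ^+ 2) =
    expR (2%:R * T - 4 * hi * y - y) / 4.
  rewrite pow2_expR -/y !expRB expRM_natl !expRN; field.
  by rewrite !gt_eqF ?expR_gt0.
rewrite ler_pM2r// ler_expR.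
have : y * (4 * hi + 1) <= n%:R * (4 * hi + 1).
  by rewrite ler_wpM2r//; clear -hi0; lra.
clear -hn; lra.
Qed.

(** Here [M] is the level of the statistic, [Mb] its power [M ^ b], and [WW] the corresponding
    quantity at the block. Squaring the claim gives factors [4] and [8], squaring the energy bound
    another [4], whence [128]; the bound [lnk <= 2 * ll] matches the [2] in [2 * eps ^+ 4]. *)
Lemma mean_ge_threshold_u (eps C Q ll lnk rho x2 M Mb WW s : R) :
  0 < eps -> 0 < C -> 0 < M -> 0 < Mb -> 0 <= s -> 0 <= lnk <= 2 * ll ->
  x2 = 128 * C * Q * ll -> 2 * eps ^+ 4 * x2 * WW < rho ^+ 4 ->
  M * Mb ^+ 4 <= Q * WW -> rho ^+ 2 / 2 <= Mb ^+ 2 * s ->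
  2 * Num.sqrt (C * lnk) <= (2 * Num.sqrt (2 * M))^-1 * (s / eps ^+ 2).
Proof.
move=> eps0 C0 M0 Mb0 s0 /andP[lnk0 lnkll] -> bigrho MQ hE.
have e2 : 0 < eps ^+ 2 by rewrite exprn_gt0.
have e4 : 0 < eps ^+ 4 by rewrite exprn_gt0.
apply: sqr_le_of_sqr.
  apply: mulr_ge0; last by rewrite divr_ge0// ltW.
  by rewrite invr_ge0 mulr_ge0// sqrtr_ge0.
have -> : (2 * Num.sqrt (C * lnk)) ^+ 2 = 4 * C * lnk.
  rewrite exprMn sqr_sqrtr; last exact: mulr_ge0 (ltW C0) lnk0.
  by ring.
have -> : ((2 * Num.sqrt (2 * M))^-1 * (s / eps ^+ 2)) ^+ 2 =
    s ^+ 2 / (8 * M * eps ^+ 4).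
  rewrite exprMn exprVn exprMn sqr_sqrtr; last by rewrite mulr_ge0// ltW.
  by field; rewrite !gt_eqF.
rewrite ler_pdivlMr; last by do 2 apply: mulr_gt0 => //.
have Mb4 : 0 < Mb ^+ 4 by rewrite exprn_gt0.
have hs2 : rho ^+ 4 <= 4 * Mb ^+ 4 * s ^+ 2.
  have h : (rho ^+ 2 / 2) ^+ 2 <= (Mb ^+ 2 * s) ^+ 2.
    have r0 : 0 <= rho ^+ 2 / 2 by rewrite divr_ge0// sqr_ge0.
    by rewrite lerXn2r// nnegrE//; exact: le_trans hE.
  move: h; clear; lra.
have h1 : C * eps ^+ 4 * lnk * (M * Mb ^+ 4) <=
    C * eps ^+ 4 * (2 * ll) * (Q * WW).
  have Ce : 0 < C * eps ^+ 4 by exact: mulr_gt0.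
  apply: ler_pM => //; [by apply: mulr_ge0 => //; exact: ltW| |].
    by apply: mulr_ge0; exact: ltW.
  by rewrite ler_pM2l.
have h2 : 4 * Mb ^+ 4 * (4 * C * lnk * (8 * M * eps ^+ 4)) <=
    4 * Mb ^+ 4 * s ^+ 2.
  apply: le_trans hs2; apply: le_trans (ltW bigrho).
  move: h1; clear; lra.
by rewrite ler_pM2l in h2; last exact: mulr_gt0.
Qed.

(* A block at frequency [2 ^ k'] shows that [u_eps] is small unless [rho] is
   large compared with the noise at that frequency. *)
Lemma rho_gt_of_u (lo hi eps x rho : R) (j0 k' : nat) (kappa : R * R) :
  0 < eps -> 0 < lo -> 4 * hi + 1 <= 2 * lo * j0%:R -> 0 <= x ->
  lo <= kappa.1 <= hi -> lo <= kappa.2 <= hi ->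
  rho ^+ 2 * ((2 ^ (k' + j0))%:R `^ kappa.1) ^+ 2 < 2 ->
  (x%:E < u_eps eps kappa rho)%E ->
  2 * eps ^+ 4 * x ^+ 2 * ((2 ^ k')%:R * ((2 ^ k')%:R `^ kappa.2) ^+ 4) < rho ^+ 4.
Proof.
move=> eps0 lo0 hj0 x0 /andP[a1 a2] /andP[b1 b2] lt2 hu.
set a := kappa.1 in a1 a2 lt2 *; set b := kappa.2 in b1 b2 *.
rewrite ltNge; apply/negP => h; move: hu; rewrite ltNge => /negP; apply.
apply: (u_eps_le _ _ _ _ _ (2 ^ k')%N) => //.
- by rewrite -/a; clear -a1 lo0; lra.
- by rewrite -/b; clear -b1 lo0; lra.
- by rewrite expn_gt0.
pose l2 : R := ln 2; have l20 : 0 < l2 by rewrite ln_gt0// ltr1n.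
move: lt2; rewrite -/a -/b !powR_2 !powR_pow2 -/l2 -!expRD exprMn -!expRM_natl.
move=> lt2.
have -> : 2%:R * (a * l2 + b * l2 + a * (k'%:R * l2)) =
    2 * (a * ((k' + j0)%:R * l2)) + 2 * l2 * (a + b - a * j0%:R).
  by rewrite natrD; ring.
rewrite expRD [_ * rho ^+ 2]mulrC [rho ^+ 2 * _]mulrA; apply: (@le_trans _ _ (2 *
    expR (2 * l2 * (a + b - a * j0%:R)))).
  by rewrite ler_pM2r ?expR_gt0// ltW.
have e2 : expR l2 = 2 by rewrite /l2 lnK ?posrE.
rewrite -{1}e2 -expRD -[leRHS]expR0 ler_expR.
have -> : l2 + 2 * l2 * (a + b - a * j0%:R) =
    l2 * (1 + 2 * a + 2 * b - 2 * a * j0%:R) by ring.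
rewrite pmulr_rle0//.
have j0R : 0 <= j0%:R :> R by exact: ler0n.
have := ler_wpM2r j0R a1; clear -hj0 a2 b2; lra.
Qed.

Lemma exists_dyadic_level (rho a : R) : 0 < rho -> 0 < a ->
  exists k, 2 <= rho ^+ 2 * ((2 ^ k)%:R `^ a) ^+ 2.
Proof.
move=> rho0 a0; pose l2 : R := ln 2.
have l20 : 0 < l2 by rewrite ln_gt0// ltr1n.
pose k := (Num.truncn (2 / (rho ^+ 2 * (a * l2)))).+1.
have al : 0 < a * l2 by rewrite mulr_gt0.
have r2 : 0 < rho ^+ 2 by rewrite exprn_gt0.
have hk : 2 <= rho ^+ 2 * (a * (k%:R * l2)).
  have := truncnS_gt (2 / (rho ^+ 2 * (a * l2))); rewrite -/k.
  rewrite ltr_pdivrMr; last exact: mulr_gt0.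
  by move=> /ltW; clear; lra.
exists k; apply: le_trans hk _; rewrite ler_pM2l// powR_pow2 -/l2.
have := expR_ge1Dx (a * (k%:R * l2)); set E := expR _.
have : 0 <= a * (k%:R * l2) by rewrite !mulr_ge0// ltW.
clear; nra.
Qed.

(* At the first dyadic level past which the high frequencies are negligible
   the signal is visible: a block with half that frequency shows that
   [u_eps] is at most a constant multiple of the mean of the statistic. *)
Lemma adaptive_level_exists (lo hi C : R) : 0 < lo -> lo <= hi -> 2 < C ->
  exists (D T0 : R) (j : nat), [/\ 0 < D, (0 < j)%N &
  forall (eps : R) (n : nat), 0 < eps -> T0 <= ln eps^-1 -> (j <= n)%N ->
    n%:R * (4 * hi + 1) <= ln eps^-1 ->
  forall (kappa : R * R) (rho : R) (eta : nat -> R),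
    lo <= kappa.1 <= hi -> lo <= kappa.2 <= hi -> 0 < rho ->
    ((D * sqrt_loglog eps)%:E < u_eps eps kappa rho)%E ->
    Theta_kappa kappa rho eta ->
  exists2 k, (n <= k)%N & 2 * threshold C k <=
    (2 * Num.sqrt (2 * (2 ^ k)%:R))^-1 * \sum_(i < (2 ^ k)%N) (eta i / eps) ^+ 2].
Proof.
move=> lo0 lohi C2.
pose l2 : R := ln 2; have l2h : 2^-1 <= l2 by exact: ln2_ge_half.
have l20 : 0 <= l2 by apply: le_trans l2h; rewrite invr_ge0.
(* The gap between the block and the first failing level: it makes [1 + 2 * a + 2 * b - 2 * a * j0]
   nonpositive for all admissible exponents, so that the block fits in the ellipsoid. *)
pose j0 := (Num.truncn ((4 * hi + 1) / (2 * lo))).+1.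
have hj0 : 4 * hi + 1 <= 2 * lo * j0%:R.
  have := truncnS_gt ((4 * hi + 1) / (2 * lo)); rewrite -/j0.
  by rewrite ltr_pdivrMr ?mulr_gt0// => /ltW; clear; lra.
have hi0 : 0 <= hi by clear -lo0 lohi; lra.
(* [Q] bounds the growth of [m * m ^ (4 * b)] over [j0.+1] dyadic levels. *)
pose Q : R := (2 ^ j0.+1)%:R * expR (hi * (j0.+1%:R * l2)) ^+ 4.
have Q1 : 1 <= Q.
  rewrite -[leLHS]mulr1; apply: ler_pM => //.
    by rewrite ler1n expn_gt0.
  by rewrite -expRM_natl -[leLHS]expR0 ler_expR !mulr_ge0.
pose D := Num.sqrt (128 * C * Q).
have CQ : 2 <= 128 * C * Q by clear -C2 Q1; nra.
have D2 : D ^+ 2 = 128 * C * Q by rewrite sqr_sqrtr//; clear -CQ; lra.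
have D0 : 0 < D by rewrite sqrtr_gt0; clear -CQ; lra.
(* The summands of [T0] serve separate needs: [64 * C] the case of the lowest level, [10 + j0] the
   bound [k0 <= T ^ 2], and [expR 1] the bound [1 <= loglog eps]. *)
exists D, (64 * C + 10 + j0%:R + expR 1), j0.+1; split => //.
move=> eps n e0; set T := ln eps^-1 => hT jn hn kappa rho eta ab1 ab2 rho0 hu hth.
have /andP[a1 a2] := ab1; have /andP[b1 b2] := ab2.
set a := kappa.1 in a1 a2 *; set b := kappa.2 in b1 b2 *.
have eT : eps = expR (- T) by rewrite /T lnV ?posrE// opprK lnK.
have e1 : 0 < expR 1 :> R by exact: expR_gt0.
have j0R : 0 <= j0%:R :> R by exact: ler0n.
have C0 : 0 < C by clear -C2; lra.
have T1 : 1 <= T by clear -hT C0 e1 j0R; lra.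
have CT : 64 * C <= T by clear -hT C0 e1 j0R; lra.
have ll1 : 1 <= loglog eps.
  rewrite /loglog -/T -ler_expR lnK ?posrE.
    by clear -hT C0 e1 j0R; lra.
  by clear -T1; lra.
have a0 : 0 < a by clear -a1 lo0; lra.
have b0 : 0 < b by clear -b1 lo0; lra.
have energy k : 2 <= rho ^+ 2 * ((2 ^ k)%:R `^ a) ^+ 2 ->
    rho ^+ 2 / 2 <= ((2 ^ k)%:R `^ b) ^+ 2 * \sum_(0 <= i < 2 ^ k) eta i ^+ 2.
  move=> h; apply: (Theta_kappa_low_energy _ kappa) => //; [exact: ltW..|].
  by rewrite expn_gt0.
have sumE k : \sum_(i < (2 ^ k)%N) (eta i / eps) ^+ 2 =
    (\sum_(0 <= i < 2 ^ k) eta i ^+ 2) / eps ^+ 2.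
  rewrite big_mkord mulr_suml; apply: eq_bigr => i _.
  by rewrite expr_div_n.
case: (ex_minnP (exists_dyadic_level rho a rho0 a0)) => k0 hk0 mink0.
(* If [k0] is below the scanned range, the lowest scanned level [n] is used in its place; its energy
   condition follows by monotonicity. *)
have [k0n|nk0] := leqP k0 n.
  exists n => //; rewrite sumE eT.
  have hPn : 2 <= rho ^+ 2 * ((2 ^ n)%:R `^ a) ^+ 2.
    apply: le_trans hk0 _; rewrite ler_wpM2l ?sqr_ge0//.
    rewrite lerXn2r ?nnegrE ?powR_ge0//; apply: ge0_ler_powR.
    - exact: ltW.
    - by rewrite nnegrE.
    - by rewrite nnegrE.
    - by rewrite ler_nat leq_exp2l.
  apply: (mean_ge_threshold_floor _ _ hi rho a b) => //.
  - exact: leq_trans jn.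
  - by rewrite a2 ltW.
  - by rewrite b2 ltW.
  - exact: energy.
exists k0; first exact: ltnW.
(* The subtraction does not truncate because [k0 > n >= j0.+1]. By minimality of [k0] the condition
   fails at [k0.-1], which is what [rho_gt_of_u] requires. *)
pose k' := (k0.-1 - j0)%N.
have k0gt0 : (0 < k0)%N by exact: leq_ltn_trans nk0.
have k1E : k0.-1 = (k' + j0)%N.
  by rewrite /k' subnK// -ltnS prednK//; exact: ltn_trans nk0.
have k0E : k0 = (k' + j0.+1)%N by rewrite addnS -k1E prednK.
have lt2 : rho ^+ 2 * ((2 ^ (k' + j0))%:R `^ a) ^+ 2 < 2.
  rewrite -k1E ltNge; apply/negP => h.
  by have := mink0 _ h; rewrite leqNgt ltn_predL k0gt0.
have rho2 : rho ^+ 2 < 2.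
  apply: le_lt_trans lt2; rewrite ler_peMr ?sqr_ge0//.
  rewrite powR_pow2 -/l2 -expRM_natl -[leLHS]expR0 ler_expR !mulr_ge0//.
  exact: ltW.
pose x := D * sqrt_loglog eps.
have x2 : x ^+ 2 = 128 * C * Q * loglog eps.
  by rewrite exprMn D2 sqr_sqrtr//; clear -ll1; lra.
have x0 : 0 <= x by rewrite mulr_ge0// ?sqrtr_ge0// ltW.
have bigrho := rho_gt_of_u lo hi eps x rho j0 k' kappa e0 lo0 hj0 x0 ab1 ab2 lt2 hu.
have hE := energy k0 hk0.
set s := \sum_(0 <= i < _) _ in hE.
rewrite sumE -/s.
pose W : R := (2 ^ k')%:R; pose Wb := W `^ b.
have W0 : 0 < W by rewrite ltr0n expn_gt0.
have Wb1 : 1 <= Wb.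
  rewrite /Wb /W powR_pow2 -[leLHS]expR0 ler_expR !mulr_ge0//.
  exact: ltW.
have Wb4 : 1 <= Wb ^+ 4 by exact: exprn_ege1.
rewrite -/W -/b -/Wb in bigrho.
have e4 : 0 < eps ^+ 4 by rewrite exprn_gt0.
have rho4 : rho ^+ 4 < 4.
  have -> : rho ^+ 4 = rho ^+ 2 * rho ^+ 2 by ring.
  have := sqr_ge0 rho; clear -rho2; nra.
have x22 : 2 <= x ^+ 2 by rewrite x2; clear -CQ ll1; nra.
(* Bounds the level: since [rho] is bounded, the inequality [bigrho] forces [2 ^ k' < eps ^ (-4)].
   Thus [k0] is linear in [T], and the crude [k0 <= T ^ 2] costs only a factor 2 in [ln k0]. *)
have W4 : W * eps ^+ 4 < 1.
  have We0 : 0 < W * eps ^+ 4 by exact: mulr_gt0.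
  have h1 : 2 * eps ^+ 4 * x ^+ 2 * (W * Wb ^+ 4) < 4.
    exact: lt_trans rho4.
  have h2 : 2 * (W * eps ^+ 4) * 2 <= 2 * (W * eps ^+ 4) * x ^+ 2.
    by rewrite ler_pM2l// mulr_gt0.
  have h3 : 2 * (W * eps ^+ 4) * x ^+ 2 <=
      2 * (W * eps ^+ 4) * x ^+ 2 * Wb ^+ 4.
    rewrite ler_peMr//; apply: mulr_ge0; last exact: sqr_ge0.
    by apply: mulr_ge0 => //; exact: ltW.
  clear -h1 h2 h3; lra.
have k0T : k0%:R <= T ^+ 2.
  move: W4; rewrite /W pow2_expR eT -expRM_natl -expRD -[ltRHS]expR0 ltr_expR -/l2.
  have k'0 : 0 <= k'%:R :> R by [].
  have -> : k0%:R = k'%:R + j0%:R + 1 :> R.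
    by rewrite k0E -addn1 !natrD addrA.
  have := ler_wpM2l k'0 l2h => h1 h2.
  have h3 : k'%:R <= 8 * T by clear -h1 h2; lra.
  have h4 : 10 + j0%:R <= T by clear -hT C0 e1; lra.
  clear -h3 h4 j0R; nra.
have k0R : 1 <= k0%:R :> R by rewrite ler1n.
have lnk0 : ln k0%:R <= 2 * loglog eps.
  rewrite /loglog -/T mulr_natl -lnXn; last exact: lt_le_trans T1.
  rewrite ler_ln ?posrE//; first exact: lt_le_trans k0R.
  by rewrite exprn_gt0//; exact: lt_le_trans T1.
have lnk00 : 0 <= ln k0%:R :> R by apply: ln_ge0.
pose M : R := (2 ^ k0)%:R; pose Mb := M `^ b.
have ME : M = (2 ^ j0.+1)%:R * W.
  by rewrite /M /W k0E -natrM -expnD addnC.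
have MbE : Mb = expR (b * (j0.+1%:R * l2)) * Wb.
  rewrite /Mb /M /Wb /W !powR_pow2 -/l2 -expRD; congr expR.
  by rewrite k0E natrD; ring.
have M0 : 0 < M by rewrite ltr0n expn_gt0.
have Mb0 : 0 < Mb by rewrite powR_gt0.
have Wb0 : 0 <= Wb by exact: le_trans Wb1.
have MQ : M * Mb ^+ 4 <= Q * (W * Wb ^+ 4).
  have -> : Q * (W * Wb ^+ 4) = M * ((expR (hi * (j0.+1%:R * l2)) * Wb) ^+ 4).
    by rewrite ME /Q exprMn; ring.
  rewrite ler_pM2l// lerXn2r ?nnegrE//.
  - exact: ltW.
  - by rewrite mulr_ge0 ?expR_ge0.
  - rewrite MbE ler_wpM2r// ler_expR ler_wpM2r//.
    by rewrite mulr_ge0.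
have s0 : 0 <= s by apply: sumr_ge0 => i _; exact: sqr_ge0.
apply: (mean_ge_threshold_u eps C Q (loglog eps) _ rho (x ^+ 2) M Mb
  (W * Wb ^+ 4) s) => //.
by rewrite lnk00.
Qed.

End signal.

Section errors.
Context (d : measure_display) (Omega : measurableType d) (R : realType).
Variables (P : probability Omega R) (xi : nat -> {RV P >-> R}).
Hypothesis hxi : iid_standard_normal xi.
Implicit Types (Theta : set (nat -> R)) (psi : (nat -> R) -> R) (eps : R).
Local Notation seqT := (g_sigma_algebraType (@cylinders R)).

Lemma is_test_onem psi : is_test psi -> is_test (fun y => 1 - psi y).
Proof.
move=> [mpsi psi01]; split; first exact: measurable_funB.
by move=> y; have /andP[h1 h2] := psi01 y; apply/andP; split; lra.
Qed.

Lemma is_test_cst1 : is_test (fun=> 1 : R).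
Proof.
by split=> [|y]; [exact: measurable_cst|rewrite ler01 lexx].
Qed.

Lemma alpha_err_ge0 eps psi : is_test psi -> 0 <= alpha_err xi eps psi.
Proof. by move=> [_ psi01]; apply: Eobs_ge0 => y; case/andP: (psi01 y). Qed.

Lemma Eobs_le_beta_err eps Theta psi eta : is_test psi -> Theta eta ->
  Eobs xi eps eta (fun y => 1 - psi y) <= beta_err xi eps Theta psi.
Proof.
move=> tpsi hT; apply: ub_le_sup; last by exists eta.
exists 1 => _ [eta' _ <-]; have [m1 h1] := is_test_onem _ tpsi.
exact: Eobs_le1.
Qed.

Lemma beta_err_le eps Theta psi (x : R) : 0 <= x ->
  (forall eta, Theta eta -> Eobs xi eps eta (fun y => 1 - psi y) <= x) ->
  beta_err xi eps Theta psi <= x.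
Proof.
move=> x0 h; rewrite /beta_err; set E := (E in sup E).
(* For an empty alternative the supremum is zero, which explains the assumption [0 <= x]. *)
have [->|/set0P E0] := eqVneq E set0; first by rewrite sup0.
by apply: ge_sup => // _ [eta hT <-]; exact: h.
Qed.

Lemma beta_err_ge0 eps Theta psi : is_test psi -> 0 <= beta_err xi eps Theta psi.
Proof.
move=> tpsi; have [->|/set0P[eta hT]] := eqVneq Theta set0.
  by rewrite /beta_err image_set0 sup0.
apply: le_trans (Eobs_le_beta_err eps Theta psi eta tpsi hT).
have [_ h1] := is_test_onem _ tpsi.
by apply: Eobs_ge0 => y; case/andP: (h1 y).
Qed.

Lemma gamma_err_le eps Theta psi : is_test psi ->
  gamma_err xi eps Theta <= alpha_err xi eps psi + beta_err xi eps Theta psi.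
Proof.
move=> tpsi; apply: ge_inf; last by exists psi.
exists 0 => _ [psi' tpsi' <-].
by rewrite addr_ge0 ?alpha_err_ge0 ?beta_err_ge0.
Qed.

Lemma gamma_err_ge eps Theta (x : R) :
  (forall psi, is_test psi ->
    x <= alpha_err xi eps psi + beta_err xi eps Theta psi) ->
  x <= gamma_err xi eps Theta.
Proof.
move=> h; apply: lb_le_inf; last by move=> _ [psi tpsi <-]; exact: h.
exists (alpha_err xi eps (fun=> 1) + beta_err xi eps Theta (fun=> 1)).
by exists (fun=> 1) => //; exact: is_test_cst1.
Qed.

Lemma gamma_err_le1 eps Theta : gamma_err xi eps Theta <= 1.
Proof.
apply: le_trans (gamma_err_le eps Theta _ is_test_cst1) _.
rewrite -[leRHS]addr0 lerD//.
  have [m1 h1] := is_test_cst1; exact: Eobs_le1.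
apply: beta_err_le => // eta _.
by rewrite EobsE; under eq_integral do rewrite subrr; rewrite integral0.
Qed.

End errors.

Section upper_bound.
Context (d : measure_display) (Omega : measurableType d) (R : realType).
Variables (P : probability Omega R) (xi : nat -> {RV P >-> R}).
Hypothesis hxi : iid_standard_normal xi.

Lemma int_natE (l : int) : 0 <= (l%:~R : R) -> l = `|l|%N%:Z.
Proof. by rewrite ler0z => l0; rewrite gez0_abs. Qed.

Lemma alpha_err_psi_adaptive_cvg (C : R) (L : R -> int) : 2 < C ->
  (L eps)%:~R @[eps --> 0^'+] --> (+oo : set_system R) ->
  alpha_err xi eps (psi_adaptive C (L eps) eps) @[eps --> 0^'+] --> (0 : R).
Proof.
move=> C2 /cvgryPge Loo; apply/cvgrPdist_le => e e0.
pose q := C / 2 - 1; have q0 : 0 < q by rewrite /q; lra.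
pose K := expR 1 * q^-1.
have K0 : 0 < K by rewrite mulr_gt0 ?expR_gt0 ?invr_gt0.
(* The solution of [K * A ^ (- q) = e]. *)
pose A := expR (- ln (e / K) / q).
near=> eps.
have eps0 : 0 < eps by near: eps; exact: near0_gt0.
have LA : 2 + A <= (L eps)%:~R by near: eps; exact: Loo.
have LC : 3072 * C ^+ 3 <= (L eps)%:~R by near: eps; exact: Loo.
have A0 : 0 < A by exact: expR_gt0.
have L0 : 0 <= ((L eps)%:~R : R) by lra.
have LE := int_natE _ L0; set n := `|L eps|%N in LE.
rewrite LE -pmulrn in LA LC.
have n2 : (2 <= n)%N by rewrite -(ler_nat R); lra.
rewrite LE sub0r normrN ger0_norm; last first.
  by apply: alpha_err_ge0; exact: is_test_psi_adaptive.
apply: le_trans (alpha_psi_adaptive_le _ _ _ _ _ hxi C n eps C2 eps0 n2 LC) _.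
rewrite -/q -/K mulrC -ler_pdivlMr// -[leRHS]lnK ?posrE ?divr_gt0// ler_expR.
have n1 : A <= n.-1%:R.
  rewrite -subn1 natrB; last exact: ltnW.
  by clear -LA; lra.
have : - ln (e / K) / q <= ln n.-1%:R.
  by rewrite -ler_expR lnK// posrE; lra.
by rewrite ler_pdivrMr//; lra.
Unshelve. all: by end_near. Qed.

Lemma beta_err_psi_adaptive_cvg (S : set (R * R)) (C : R) : compact S ->
  (forall kappa, S kappa -> 0 < kappa.1 /\ 0 < kappa.2) -> 2 < C ->
  exists2 D : R, 0 < D & forall L : R -> int,
    (L eps)%:~R @[eps --> 0^'+] --> (+oo : set_system R) ->
    (L eps)%:~R / ln eps^-1 @[eps --> 0^'+] --> (0 : R) ->
  forall r : R -> R * R -> R, radii_family S r ->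
    (liminf_inf_ratio S r (@sqrt_loglog R) > D%:E)%E ->
    beta_err xi eps (Theta_family S r eps) (psi_adaptive C (L eps) eps)
      @[eps --> 0^'+] --> (0 : R).
Proof.
move=> cS pS C2; have [lo [hi [lo0 lohi Sb]]] := compact_positive_bounds _ _ cS pS.
have [D [T0 [j [D0 j0 level]]]] := adaptive_level_exists _ lo hi C lo0 lohi C2.
exists D => // L /cvgryPge Loo /cvgrPdist_le Lo r [rpos _] hD.
have hi1 : 0 < 4 * hi + 1 by lra.
have uD := liminf_inf_ratio_near _ _ _ _ _ hD (sqrt_loglog_gt0_near _).
(* At the level found the mean is at least twice the threshold, so the error is at most
   [expR (1 - H_k)], which is below [e] once [H_k >= B]. *)
apply/cvgrPdist_le => e e0; pose B := 1 - ln e.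
near=> eps.
have eps0 : 0 < eps by near: eps; exact: near0_gt0.
have LB : 1 + j%:R + expR (B ^+ 2) <= (L eps)%:~R by near: eps; exact: Loo.
have hT0 : T0 <= ln eps^-1 by near: eps; exact: near0_ln_ge.
have hT1 : 1 <= ln eps^-1 by near: eps; exact: near0_ln_ge.
have Lsmall : `|0 - (L eps)%:~R / ln eps^-1| <= (4 * hi + 1)^-1.
  by near: eps; apply: Lo; rewrite invr_gt0.
have rp : forall kappa, S kappa -> 0 < r eps kappa by near: eps; exact: rpos.
have hu : forall kappa, S kappa ->
    ((D * sqrt_loglog eps)%:E < u_eps eps kappa (r eps kappa))%E.
  by near: eps; exact: uD.
have jR : 0 <= j%:R :> R by [].
have eB : 0 < expR (B ^+ 2) by exact: expR_gt0.
have L0 : 0 <= ((L eps)%:~R : R) by lra.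
have LE := int_natE _ L0; set n := `|L eps|%N in LE.
rewrite LE -pmulrn in LB Lsmall.
have n1 : 1 <= n%:R :> R by lra.
have jn : (j <= n)%N by rewrite -(ler_nat R); lra.
have hn : n%:R * (4 * hi + 1) <= ln eps^-1.
  have T00 : 0 < ln eps^-1 by lra.
  move: Lsmall; rewrite sub0r normrN ger0_norm; last first.
    by rewrite divr_ge0// ltW.
  rewrite ler_pdivrMr// mulrC ler_pdivlMr// mulrC; lra.
have thrB : B <= threshold C n.
  apply: sqr_le_of_sqr; first exact: sqrtr_ge0.
  have lnB : B ^+ 2 <= ln n%:R by rewrite -ler_expR lnK ?posrE; lra.
  have lnn : 0 <= ln n%:R :> R by exact: ln_ge0.
  rewrite sqr_sqrtr; last by rewrite mulr_ge0//; lra.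
  by apply: le_trans lnB _; rewrite ler_peMl//; lra.
have tpsi := is_test_psi_adaptive _ C (L eps) eps.
rewrite sub0r normrN ger0_norm; last exact: beta_err_ge0.
apply: beta_err_le; first exact: ltW.
move=> eta [kappa Sk hT].
have [k1 k2] := Sb _ Sk.
have [k nk hk] := level eps n eps0 hT0 jn hn kappa _ eta k1 k2 (rp _ Sk) (hu _ Sk) hT.
have k0 : (0 < k)%N by apply: leq_trans nk; exact: leq_trans jn.
have Lk : L eps <= k%:Z by rewrite LE lez_nat.
apply: le_trans (type_II_psi_adaptive_le _ _ _ _ _ hxi C (L eps) eps eta k eps0 k0 Lk) _.
rewrite -[leRHS]lnK ?posrE// ler_expR.
have : threshold C n <= threshold C k.
  rewrite /threshold ler_wsqrtr// ler_pM2l//; last by lra.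
  by rewrite ler_ln ?posrE ?ltr0n ?ler_nat//; exact: leq_trans jn.
have : B = 1 - ln e by [].
lra.
Unshelve. all: by end_near. Qed.

End upper_bound.

(** * Lower bound *)

Section ge0_integral_real.
Context (d : measure_display) (T : measurableType d) (R : realType).
Variable m : {measure set T -> \bar R}.
Local Open Scope ereal_scope.

Lemma ge0_integral_EFinD (f g : T -> R) :
  measurable_fun setT f -> measurable_fun setT g ->
  (forall x, 0 <= f x)%R -> (forall x, 0 <= g x)%R ->
  \int[m]_x (f x + g x)%:E = \int[m]_x (f x)%:E + \int[m]_x (g x)%:E.
Proof.
move=> mf mg f0 g0; under eq_integral do rewrite EFinD.
by rewrite ge0_integralD//; [move=> x _|apply/measurable_EFinP
  |move=> x _|apply/measurable_EFinP]; rewrite ?lee_fin.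
Qed.

Lemma ge0_integral_EFinZ (c : R) (f : T -> R) :
  (0 <= c)%R -> measurable_fun setT f -> (forall x, 0 <= f x)%R ->
  \int[m]_x (c * f x)%:E = c%:E * \int[m]_x (f x)%:E.
Proof.
move=> c0 mf f0; under eq_integral do rewrite EFinM.
rewrite ge0_integralZl_EFin//; first by move=> x _; rewrite lee_fin.
exact/measurable_EFinP.
Qed.

Lemma ge0_integral_EFin_sum (I : finType) (f : I -> T -> R) :
  (forall i, measurable_fun setT (f i)) -> (forall i x, 0 <= f i x)%R ->
  \int[m]_x (\sum_i f i x)%:E = \sum_i \int[m]_x (f i x)%:E.
Proof.
move=> mf f0; under eq_integral do rewrite -sumEFin.
rewrite ge0_integral_sum//; first by move=> i; apply/measurable_EFinP.
by move=> i x _; rewrite lee_fin.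
Qed.

Lemma ge0_le_integral_EFin (f g : T -> R) :
  measurable_fun setT f -> measurable_fun setT g ->
  (forall x, 0 <= f x <= g x)%R ->
  \int[m]_x (f x)%:E <= \int[m]_x (g x)%:E.
Proof.
move=> mf mg fg; apply: ge0_le_integral => //.
- by move=> x _; rewrite lee_fin; case/andP: (fg x).
- exact/measurable_EFinP.
- exact/measurable_EFinP.
- by move=> x _; rewrite lee_fin; case/andP: (fg x).
Qed.

End ge0_integral_real.

Lemma integral_probability_cst (d : measure_display) (T : measurableType d)
    (R : realType) (P : probability T R) (c : R) :
  (\int[P]_x c%:E = c%:E)%E.
Proof.
have h : (\int[P]_x c%:E = c%:E * P setT)%E.
  exact: (integral_cst P measurableT c%:E).
by rewrite h probability_setT mule1.
Qed.

(** * Second-moment method for randomly signed blocks *)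

Section bayes_lower_bound.
Context (d : measure_display) (Omega : measurableType d) (R : realType).
Variables (P : probability Omega R) (xi : nat -> {RV P >-> R}).
Hypothesis hxi : iid_standard_normal xi.
Local Notation seqT := (g_sigma_algebraType (@cylinders R)).

(** Likelihood ratio of the equal mixture of the normal laws with means [v] and [- v], that is
    [expR (- v ^+ 2 / 2) * cosh (v * x)]. *)
Definition clik (v x : R) : R := (lik v x + lik (- v) x) / 2.

Lemma clik_ge0 v x : 0 <= clik v x.
Proof. by rewrite divr_ge0// addr_ge0// lik_ge0. Qed.

Lemma measurable_clik v : measurable_fun setT (clik v).
Proof.
by apply: measurable_funM => //; apply: measurable_funD; exact: measurable_lik.
Qed.

Let measurable_lik_xi v k : measurable_fun setT (fun w => lik v (xi k w)).
Proof.
by apply: (measurableT_comp (measurable_lik _ _)); exact: measurable_funP.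
Qed.

Let measurable_clik_xi v k : measurable_fun setT (fun w => clik v (xi k w)).
Proof.
by apply: (measurableT_comp (measurable_clik _)); exact: measurable_funP.
Qed.

Lemma expectation_clik v k : (\int[P]_w (clik v (xi k w))%:E = 1)%E.
Proof.
rewrite /clik; under eq_integral do rewrite mulrC.
have m1 := measurable_lik_xi v k; have m2 := measurable_lik_xi (- v) k.
rewrite ge0_integral_EFinZ//; last first.
- by move=> w; rewrite addr_ge0// lik_ge0.
- exact: measurable_funD.
rewrite ge0_integral_EFinD//; [|by move=> w; exact: lik_ge0..].
rewrite !(expectation_lik _ _ _ _ _ hxi) -EFinD -EFinM; congr EFin; by field.
Qed.

Lemma expectation_likM u v k :
  (\int[P]_w (lik u (xi k w) * lik v (xi k w))%:E = (expR (u * v))%:E)%E.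
Proof.
rewrite (eq_integral (fun w => (expR (u * v) * lik (u + v) (xi k w))%:E)).
  rewrite ge0_integral_EFinZ ?expR_ge0//; last by move=> w; exact: lik_ge0.
  by rewrite (expectation_lik _ _ _ _ _ hxi) mule1.
move=> w _; rewrite /lik -!expRD; congr (expR _)%:E; by field.
Qed.

(** The value is [cosh (u * v)]: random signs cancel the term linear in [u * v], which is why fourth
    powers of the amplitudes govern the second moment. *)
Lemma expectation_clikM u v k :
  (\int[P]_w (clik u (xi k w) * clik v (xi k w))%:E =
   ((expR (u * v) + expR (- (u * v))) / 2)%:E)%E.
Proof.
have mM a b : measurable_fun setT (fun w => lik a (xi k w) * lik b (xi k w)).
  exact: measurable_funM.
have M0 a b w : 0 <= lik a (xi k w) * lik b (xi k w).
  by rewrite mulr_ge0// lik_ge0.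
rewrite (eq_integral (fun w => (4^-1 *
    ((lik u (xi k w) * lik v (xi k w) + lik u (xi k w) * lik (- v) (xi k w)) +
     (lik (- u) (xi k w) * lik v (xi k w) +
      lik (- u) (xi k w) * lik (- v) (xi k w))))%:E)); last first.
  by move=> w _; rewrite /clik; congr EFin; field.
rewrite ge0_integral_EFinZ ?invr_ge0//; last first.
- by move=> w; rewrite !addr_ge0.
- by do !apply: measurable_funD.
rewrite ge0_integral_EFinD//; last first.
- by move=> w; rewrite addr_ge0.
- by move=> w; rewrite addr_ge0.
- exact: measurable_funD.
- exact: measurable_funD.
rewrite !ge0_integral_EFinD// !expectation_likM -!EFinD -EFinM.
congr EFin; rewrite !mulrN !mulNr opprK; by field.
Qed.

Section mixture.
Variables (J N : nat) (v : 'I_J -> nat -> R) (eps : R).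
Hypotheses (J0 : (0 < J)%N) (eps0 : 0 < eps).
Hypothesis vdisj : forall j j' k, j != j' -> v j k * v j' k = 0.

(* The likelihood ratio of the prior putting independent uniform signs on the
   amplitudes [v j]. *)
Definition sign_mixture (j : 'I_J) (w : Omega) : R :=
  \prod_(k < N) clik (v j k / eps) (xi k w).

Lemma sign_mixture_ge0 j w : 0 <= sign_mixture j w.
Proof. by apply: prodr_ge0 => k _; exact: clik_ge0. Qed.

Lemma measurable_sign_mixture j : measurable_fun setT (sign_mixture j).
Proof. by apply: measurable_prod => k _; exact: measurable_clik_xi. Qed.

Let prod_iota (F : nat -> R) : \prod_(k <- iota 0 N) F k = \prod_(k < N) F k.
Proof. by rewrite -(big_mkord xpredT F) /index_iota subn0. Qed.

Lemma expectation_sign_mixture j : (\int[P]_w (sign_mixture j w)%:E = 1)%E.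
Proof.
have mc k : measurable_fun setT (clik (v j k / eps)) by exact: measurable_clik.
have := @ge0_expectation_prod _ _ _ _ _ hxi.1 (fun k => clik (v j k / eps))
  (fun=> 1) _ (iota_uniq 0 N) mc (fun k x => clik_ge0 _ x)
  (fun k => expectation_clik _ k).
rewrite big1// => <-; apply: eq_integral => w _; congr EFin.
by rewrite (prod_iota (fun k => clik (v j k / eps) (xi k w))).
Qed.

(** Distinct blocks have disjoint supports, so every factor is [cosh 0 = 1] and the expectation is
    exactly one. For equal blocks each factor is at most [expR (2 * (v j k / eps) ^+ 4)]. *)
Lemma expectation_sign_mixtureM j j' (B : R) :
  \sum_(k < N) (v j k / eps) ^+ 4 <= B ->
  (\int[P]_w (sign_mixture j w * sign_mixture j' w)%:E <=
   (1 + (j == j')%:R * expR (2 * B))%:E)%E.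
Proof.
move=> hB.
pose g k (x : R) := clik (v j k / eps) x * clik (v j' k / eps) x.
have mg k : measurable_fun setT (g k).
  by apply: measurable_funM; exact: measurable_clik.
have g0 k x : 0 <= g k x by rewrite mulr_ge0// clik_ge0.
have := @ge0_expectation_prod _ _ _ _ _ hxi.1 g _ _ (iota_uniq 0 N) mg g0
  (fun k => expectation_clikM _ _ k).
rewrite (prod_iota (fun k => (expR (v j k / eps * (v j' k / eps)) +
  expR (- (v j k / eps * (v j' k / eps)))) / 2)) => H.
rewrite (eq_integral (fun w => (\prod_(k <- iota 0 N) g k (xi k w))%:E)); last first.
  move=> w _; congr EFin; rewrite (prod_iota (fun k => g k (xi k w))).
  by rewrite /sign_mixture -big_split.
rewrite H lee_fin; have [<-|jj'] := eqVneq j j'; last first.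
  rewrite mul0r addr0 big1// => k _.
  by rewrite mulrACA vdisj// mul0r oppr0 expR0; field.
rewrite mul1r; apply: (@le_trans _ _ (expR (2 * B))); last by rewrite lerDr.
apply: (@le_trans _ _ (\prod_(k < N) expR (2 * (v j k / eps) ^+ 4))).
  apply: ler_prod => k _; apply/andP; split.
    by rewrite divr_ge0// addr_ge0// expR_ge0.
  rewrite -expr2; apply: le_trans (cosh_le_expR _ _) _.
  by rewrite -exprM.
by rewrite -expR_sum ler_expR -mulr_sumr ler_pM2l.
Qed.

(** The signal selected by the sign vector [f], extended by zero past [N] so that the finite change
    of measure applies. *)
Definition signed (j : 'I_J) (f : {ffun 'I_N -> bool}) (k : nat) : R :=
  if insub k is Some i then (if f i then v j k else - v j k) else 0.

(** Expanding the product of two-point averages over all sign vectors exhibits the mixture as an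
    average of likelihood ratios of genuine alternatives. *)
Lemma sign_mixtureE j w :
  sign_mixture j w = \sum_(f : {ffun 'I_N -> bool})
    (2 ^+ N)^-1 * \prod_(k < N) lik (signed j f k / eps) (xi k w).
Proof.
have := bigA_distr_bigA (fun (k : 'I_N) (b : bool) =>
  lik (if b then v j k / eps else - (v j k / eps)) (xi k w)).
move=> h; rewrite -mulr_sumr.
rewrite (eq_bigr (fun f : {ffun 'I_N -> bool} => \prod_(k < N)
    lik (if f k then v j k / eps else - (v j k / eps)) (xi k w))); last first.
  move=> f _; apply: eq_bigr => k _; rewrite /signed valK.
  by case: (f k); rewrite ?mulNr.
rewrite -h /sign_mixture /clik.
rewrite big_split/= prodr_const card_ord -exprVn mulrC; congr (_ * _).
by apply: eq_bigr => k _; rewrite big_bool.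
Qed.

Variable Theta : set (nat -> R).
Hypothesis vTheta : forall j f, Theta (signed j f).

Lemma sign_mixture_type_II j psi : is_test psi ->
  (\int[P]_w ((1 - psi (observation xi eps (fun=> 0%R) w)) *
     sign_mixture j w)%:E <= (beta_err xi eps Theta psi)%:E)%E.
Proof.
move=> tpsi; have [m1 h1] := is_test_onem _ _ tpsi.
pose p w := 1 - psi (observation xi eps (fun=> 0) w).
have p0 w : 0 <= p w by case/andP: (h1 (observation xi eps (fun=> 0) w)).
have mp : measurable_fun setT p.
  exact: (measurable_comp_observation _ _ _ _ xi eps (fun=> 0) _ m1).
pose l f w := \prod_(k < N) lik (signed j f k / eps) (xi k w).
have l0 f w : 0 <= l f w by apply: prodr_ge0 => k _; exact: lik_ge0.
have ml f : measurable_fun setT (l f).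
  exact: (measurable_prod_lik _ _ _ _ xi (fun k => signed j f k / eps)).
have c0 : 0 <= (2 ^+ N)^-1 :> R by rewrite invr_ge0 exprn_ge0.
have pl0 f w : 0 <= p w * l f w by exact: mulr_ge0.
have mpl f : measurable_fun setT (fun w => p w * l f w) by exact: measurable_funM.
rewrite (eq_integral (fun w => (\sum_(f : {ffun 'I_N -> bool})
    (2 ^+ N)^-1 * (p w * l f w))%:E)); last first.
  move=> w _; congr EFin; rewrite sign_mixtureE mulr_sumr.
  by apply: eq_bigr => f _; rewrite mulrCA.
rewrite ge0_integral_EFin_sum; last 2 first.
- by move=> f; exact: measurable_funM.
- by move=> f w; exact: mulr_ge0.
apply: (@le_trans _ _ (\sum_(f : {ffun 'I_N -> bool})
    ((2 ^+ N)^-1 * beta_err xi eps Theta psi)%:E)%E).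
  apply: lee_sum => f _; rewrite ge0_integral_EFinZ// EFinM.
  apply: lee_wpmul2l; first by rewrite lee_fin.
  have sN i : (N <= i)%N -> signed j f i = 0.
    by move=> Ni; rewrite /signed insubF// ltnNge Ni.
  rewrite -(change_of_measure _ _ _ _ _ hxi eps (signed j f) N
    (fun y => 1 - psi y) eps0 sN m1); last by move=> y; case/andP: (h1 y).
  rewrite -(EobsEFin _ _ _ _ xi eps (signed j f) (fun y => 1 - psi y) m1 h1) lee_fin.
  exact: Eobs_le_beta_err.
rewrite sumEFin sumr_const card_ffun card_bool card_ord lee_fin.
by rewrite -[_ *+ (2 ^ N)%N]mulr_natl natrX mulrA divff ?mul1r.
Qed.

(* With [Z] the averaged likelihood ratio, testing against the average gives
   [alpha + beta >= 1 - E |Z - 1| / 2], and [|z - 1| / 2] is at most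
   [(z - 1) ^+ 2 / (4 * delta) + delta / 4]. *)
Lemma sign_mixture_test_lower_bound psi (B delta : R) : 0 < delta ->
  (forall j, \sum_(k < N) (v j k / eps) ^+ 4 <= B) -> is_test psi ->
  1 - expR (2 * B) / J%:R / (4 * delta) - delta / 4 <=
  alpha_err xi eps psi + beta_err xi eps Theta psi.
Proof.
move=> delta0 hB tpsi; have [mpsi psi01] := tpsi.
have [m1psi h1] := is_test_onem _ _ tpsi.
have JR : 0 < J%:R :> R by rewrite ltr0n.
have Ji0 : 0 <= J%:R^-1 :> R by rewrite invr_ge0 ltW.
pose q w := psi (observation xi eps (fun=> 0) w).
have q01 w : 0 <= q w <= 1 by exact: psi01.
have mq : measurable_fun setT q.
  exact: (measurable_comp_observation _ _ _ _ xi eps (fun=> 0) _ mpsi).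
pose L w := \sum_j J%:R^-1 * sign_mixture j w.
have mJ j : measurable_fun setT (fun w => J%:R^-1 * sign_mixture j w).
  by apply: measurable_funM => //; exact: measurable_sign_mixture.
have J0s j w : 0 <= J%:R^-1 * sign_mixture j w.
  by rewrite mulr_ge0// sign_mixture_ge0.
have mL : measurable_fun setT L by exact: measurable_sum.
have L0 w : 0 <= L w by exact: sumr_ge0.
have EL : (\int[P]_w (L w)%:E = 1)%E.
  rewrite ge0_integral_EFin_sum// (eq_bigr (fun=> J%:R^-1%:E)); last first.
    move=> j _; rewrite ge0_integral_EFinZ//.
    - by rewrite expectation_sign_mixture mule1.
    - exact: measurable_sign_mixture.
    - exact: sign_mixture_ge0.
  rewrite sumEFin sumr_const card_ord -[_ *+ J]mulr_natl divff//.
  by rewrite gt_eqF.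
have EL2 : (\int[P]_w (L w * L w)%:E <= (1 + expR (2 * B) / J%:R)%:E)%E.
  rewrite (eq_integral (fun w => (\sum_(i : 'I_J * 'I_J)
      J%:R^-1 ^+ 2 * (sign_mixture i.1 w * sign_mixture i.2 w))%:E)); last first.
    move=> w _; congr EFin; rewrite /L mulr_suml.
    rewrite -(pair_bigA _ (fun i j => J%:R^-1 ^+ 2 *
      (sign_mixture i w * sign_mixture j w)))/=.
    apply: eq_bigr => i _; rewrite mulr_sumr; apply: eq_bigr => j _.
    by rewrite mulrACA expr2.
  have ss0 i j w : 0 <= sign_mixture i w * sign_mixture j w.
    by rewrite mulr_ge0// sign_mixture_ge0.
  have mss i j : measurable_fun setT (fun w => sign_mixture i w * sign_mixture j w).
    by apply: measurable_funM; exact: measurable_sign_mixture.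
  rewrite ge0_integral_EFin_sum; last 2 first.
  - by move=> i; exact: measurable_funM.
  - by move=> i w; rewrite mulr_ge0// sqr_ge0.
  apply: (@le_trans _ _ (\sum_(i : 'I_J * 'I_J)
      (J%:R^-1 ^+ 2 * (1 + (i.1 == i.2)%:R * expR (2 * B)))%:E)%E).
    apply: lee_sum => i _; rewrite ge0_integral_EFinZ ?sqr_ge0// [leRHS]EFinM.
    rewrite lee_wpmul2l ?lee_fin ?sqr_ge0//.
    exact: expectation_sign_mixtureM.
  rewrite sumEFin lee_fin -mulr_sumr big_split/= sumr_const card_prod card_ord.
  rewrite -mulr_suml.
  rewrite -(pair_bigA _ (fun i j : 'I_J => (i == j)%:R))/=.
  rewrite (eq_bigr (fun=> 1)); last first.
    move=> i _; rewrite (bigD1 i)//= eqxx big1 ?addr0// => j.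
    by rewrite eq_sym => /negbTE ->.
  rewrite sumr_const card_ord natrM le_eqVlt; apply/orP; left; apply/eqP.
  by field; rewrite gt_eqF.
have E1 : (\int[P]_w (q w)%:E = (alpha_err xi eps psi)%:E)%E.
  by rewrite /alpha_err (EobsEFin _ _ _ _ xi eps (fun=> 0)).
have E2 : (\int[P]_w ((1 - q w) * L w)%:E <= (beta_err xi eps Theta psi)%:E)%E.
  have q10 w : 0 <= 1 - q w by case/andP: (q01 w); lra.
  have mq1 : measurable_fun setT (fun w => 1 - q w) by exact: measurable_funB.
  rewrite (eq_integral (fun w => (\sum_j J%:R^-1 *
      ((1 - q w) * sign_mixture j w))%:E)); last first.
    move=> w _; congr EFin; rewrite /L mulr_sumr.
    by apply: eq_bigr => j _; rewrite mulrCA.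
  have mj j : measurable_fun setT (fun w => (1 - q w) * sign_mixture j w).
    by apply: measurable_funM => //; exact: measurable_sign_mixture.
  have j0 j w : 0 <= (1 - q w) * sign_mixture j w.
    by rewrite mulr_ge0// sign_mixture_ge0.
  rewrite ge0_integral_EFin_sum; last 2 first.
  - by move=> j; exact: measurable_funM.
  - by move=> j w; rewrite mulr_ge0.
  apply: (@le_trans _ _ (\sum_(j < J) (J%:R^-1 * beta_err xi eps Theta psi)%:E)%E).
    apply: lee_sum => j _; rewrite ge0_integral_EFinZ// EFinM.
    by rewrite lee_wpmul2l ?lee_fin//; exact: sign_mixture_type_II.
  rewrite sumEFin lee_fin sumr_const card_ord -[_ *+ J]mulr_natl mulrA divff ?mul1r//.
  by rewrite gt_eqF.
have d40 : 0 <= (4 * delta)^-1 by rewrite invr_ge0; lra.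
(* The pointwise inequality is rearranged as [f <= g] with only nonnegative terms: the part
   [- L / (2 * delta)] of the square is moved to the left and enters [c1]. *)
pose c0 := (4 * delta)^-1 + delta / 4.
have c00 : 0 <= c0 by rewrite /c0; lra.
pose c1 := 2^-1 + (2 * delta)^-1.
have c10 : 0 <= c1 by rewrite /c1 addr_ge0// invr_ge0; lra.
pose f w := 2^-1 + c1 * L w.
pose g w := (q w + (1 - q w) * L w) + ((4 * delta)^-1 * (L w * L w) + c0).
have mL2 : measurable_fun setT (fun w => L w * L w) by exact: measurable_funM.
have mq1L : measurable_fun setT (fun w => (1 - q w) * L w).
  by apply: measurable_funM => //; exact: measurable_funB.
have q1L0 w : 0 <= (1 - q w) * L w.
  by rewrite mulr_ge0//; case/andP: (q01 w); lra.
have q0 w : 0 <= q w by case/andP: (q01 w).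
have L20 w : 0 <= L w * L w by rewrite mulr_ge0.
have fg w : 0 <= f w <= g w.
  apply/andP; split; first by rewrite /f addr_ge0// mulr_ge0.
  have [qw0 qw1] := andP (q01 w); have Lw := L0 w.
  set y := q w in qw0 qw1 *; set z := L w in Lw *.
  (* With [s] equal to plus and minus one half this bounds [|z - 1| / 2]; and [y + (1 - y) * z] is
     at least the minimum of [1] and [z]. *)
  have amgm s : s * (z - 1) <= (z - 1) ^+ 2 / (4 * delta) + s ^+ 2 * delta.
    rewrite -subr_ge0 (_ : _ - _ = (z - 1 - 2 * delta * s) ^+ 2 / (4 * delta)).
      by rewrite divr_ge0 ?sqr_ge0//; lra.
    by field; rewrite gt_eqF.
  have : g w - f w = (y + (1 - y) * z) - (z + 1) / 2 +
      ((z - 1) ^+ 2 / (4 * delta) + delta / 4).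
    by rewrite /g /f -/y -/z /c0 /c1; field; rewrite gt_eqF.
  have := amgm 2^-1; have := amgm (- 2^-1).
  rewrite sqrrN !exprVn => a1 a2 gf.
  rewrite -subr_ge0 gf.
  by have [z1|/ltW z1] := leP z 1; nra.
have := ge0_le_integral_EFin _ _ _ P f g.
have mf : measurable_fun setT f.
  by apply: measurable_funD => //; exact: measurable_funM.
have mg : measurable_fun setT g.
  apply: measurable_funD; first exact: measurable_funD.
  by apply: measurable_funD => //; exact: measurable_funM.
move=> /(_ mf mg fg).
have -> : (\int[P]_w (f w)%:E = (2^-1 + c1)%:E)%E.
  rewrite /f ge0_integral_EFinD//; last 2 first.
  - exact: measurable_funM.
  - by move=> w; rewrite mulr_ge0.
  by rewrite integral_probability_cst ge0_integral_EFinZ// EL mule1.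
have -> : (\int[P]_w (g w)%:E = ((alpha_err xi eps psi)%:E +
    \int[P]_w ((1 - q w) * L w)%:E) +
    (((4 * delta)^-1)%:E * \int[P]_w (L w * L w)%:E + c0%:E))%E.
  rewrite /g ge0_integral_EFinD//.
  - rewrite ge0_integral_EFinD// E1 ge0_integral_EFinD//.
    + by rewrite ge0_integral_EFinZ// integral_probability_cst.
    + exact: measurable_funM.
    + by move=> w; rewrite mulr_ge0.
  - exact: measurable_funD.
  - by apply: measurable_funD => //; exact: measurable_funM.
  - by move=> w; rewrite addr_ge0.
  - by move=> w; rewrite addr_ge0// mulr_ge0.
move=> /le_trans/(_ (leeD (leeD (lexx _) E2)
  (leeD (lee_wpmul2l _ EL2) (lexx _)))).
have d4E : (0%R <= ((4 * delta)^-1)%:E)%E by rewrite lee_fin.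
move=> /(_ d4E); rewrite -EFinM -!EFinD lee_fin.
rewrite /c0 /c1.
have -> : (2 * delta)^-1 = 2 * (4 * delta)^-1 by field; rewrite gt_eqF.
rewrite [(4 * delta)^-1 * (1 + _)]mulrDr mulr1.
have -> : expR (2 * B) / J%:R / (4 * delta) =
  (4 * delta)^-1 * (expR (2 * B) / J%:R) by rewrite mulrC.
lra.
Qed.

End mixture.
End bayes_lower_bound.

(** * Blocks at critical frequencies *)

Section dyadic_block.
Context (R : realType).
Implicit Types (kappa : R * R) (eps rho v c ll : R).

(* The frequency [2 ^ p] balances the two constraints, so a block there is an
   alternative; otherwise [rho] is so large that [u_eps] exceeds [c * sqrt ll]. *)
Lemma dyadic_block_alternative (lo hi eps ll c v rho : R) (p j : nat) kappa
    (s : nat -> R) : 0 < eps -> 0 <= ll -> 0 <= c -> 0 < lo ->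
  4 * hi + 1 <= 2 * lo * j%:R ->
  32 * c ^+ 2 * expR (ln 2 * (j%:R + 4 * hi * j%:R + 8 * hi)) <= 1 ->
  lo <= kappa.1 <= hi -> lo <= kappa.2 <= hi ->
  expR (- ((4 * kappa.1 + 4 * kappa.2 + 1) * (p%:R * ln 2))) =
    eps ^+ 4 * ll / 4 ->
  (u_eps eps kappa rho <= (c * Num.sqrt ll)%:E)%E ->
  v ^+ 2 = expR (- (p%:R * ln 2 +
    2 * (kappa.1 + kappa.2) * (p.+1%:R * ln 2))) ->
  (forall i, s i ^+ 2 = v ^+ 2) ->
  Theta_kappa kappa rho (block _ (2 ^ p) s).
Proof.
move=> eps0 ll0 c0 lo0 hj hc /andP[a1 a2] /andP[b1 b2] hp hu hv sv.
have n2E : ((2 ^ p).*2 = 2 ^ p.+1)%N by rewrite -mul2n -expnS.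
set a := kappa.1 in a1 a2 hp hv *; set b := kappa.2 in b1 b2 hp hv *.
have a0 : 0 <= a by clear -a1 lo0; lra.
have b0 : 0 <= b by clear -b1 lo0; lra.
pose l2 : R := ln 2; have l20 : 0 < l2 by rewrite ln_gt0// ltr1n.
rewrite -/l2 in hp hv hc; pose y := p%:R * l2.
have e2 : expR l2 = 2 by rewrite /l2 lnK ?posrE.
(* The amplitude [v] makes the ellipsoid bound at the upper end of the block an equality. *)
apply: (Theta_kappa_block _ _ _ _ v) => //.
  rewrite n2E !powR_pow2 -/a -/b -/l2 hv pow2_expR -/l2 -expRD -expRM_natl.
  rewrite -!expRD -[leRHS]expR0 ler_expR le_eqVlt; apply/orP; left; apply/eqP.
  by ring.
have -> : (2 ^ p)%:R * (((2 ^ p)%:R `^ kappa.2) ^+ 2 * v ^+ 2) =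
    expR (- (2 * (a * (p.+1%:R * l2) + b * l2))).
  rewrite powR_pow2 -/b -/l2 hv pow2_expR -/l2 -expRM_natl -!expRD.
  by congr expR; rewrite -[p.+1]addn1 natrD; ring.
(* If [rho] exceeded the energy of the block, the frequencies beyond [2 ^ (p + j)] would be
   negligible; [u_eps_le_bound] would then bound [rho ^+ 4] by less than the square of that energy,
   by the choice of [c]. *)
rewrite leNgt; apply/negP => hr.
have m0 : (0 < 2 ^ (p + j))%N by rewrite expn_gt0.
have hm : 2 <= rho ^+ 2 * ((2 ^ (p + j))%:R `^ kappa.1) ^+ 2.
  rewrite powR_pow2 -/a -/l2 -expRM_natl.
  apply: (@le_trans _ _ (expR (- (2 * (a * (p.+1%:R * l2) + b * l2))) *
      expR (2%:R * (a * ((p + j)%:R * l2))))); last first.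
    by rewrite ler_pM2r ?expR_gt0// ltW.
  rewrite -expRD -{1}e2 ler_expR.
  have -> : - (2 * (a * (p.+1%:R * l2) + b * l2)) + 2%:R * (a * ((p + j)%:R * l2))
    = l2 * (2 * a * j%:R - 2 * a - 2 * b).
    by rewrite -[p.+1]addn1 !natrD; ring.
  rewrite ler_peMr//; first exact: ltW.
  have j0 : 0 <= j%:R :> R by exact: ler0n.
  have := ler_wpM2r j0 a1; clear -hj a2 b2; lra.
have := u_eps_le_bound _ _ _ _ _ _ eps0 (mulr_ge0 c0 (sqrtr_ge0 ll)) a0 b0 m0 hm hu.
apply/negP; rewrite -ltNge exprMn sqr_sqrtr//.
have -> : 8 * eps ^+ 4 * (c ^+ 2 * ll) *
    ((2 ^ (p + j))%:R * ((2 ^ (p + j))%:R `^ kappa.2) ^+ 4) =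
    32 * c ^+ 2 * (expR (- ((4 * a + 4 * b + 1) * y)) *
    expR ((p + j)%:R * l2) * expR (4%:R * (b * ((p + j)%:R * l2)))).
  by rewrite hp powR_pow2 pow2_expR -/b -/l2 -expRM_natl; field.
have -> : rho ^+ 4 = rho ^+ 2 * rho ^+ 2 by rewrite -exprD.
apply: (@le_lt_trans _ _ (expR (- (2 * (a * (p.+1%:R * l2) + b * l2))) *
    expR (- (2 * (a * (p.+1%:R * l2) + b * l2))))); last first.
  by apply: ltr_pM; rewrite ?expR_ge0.
rewrite -!expRD; set A := _ + _ + _; set X := _ + _.
have -> : A = (A - X) + X by ring.
rewrite expRD mulrA -[leRHS]mul1r ler_pM2r ?expR_gt0//.
apply: le_trans hc; apply: ler_wpM2l.
  by apply: mulr_ge0 => //; exact: sqr_ge0.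
rewrite ler_expR.
have -> : A - X = l2 * (j%:R + 4 * b * j%:R + 4 * a + 4 * b).
  by rewrite /A /X /y -[p.+1]addn1 !natrD; ring.
rewrite ler_pM2l//; have j0 : 0 <= j%:R :> R by exact: ler0n.
have := ler_wpM2r j0 b2; clear -a2 b2; lra.
Qed.

(** The critical equation says [phi kappa = 4 * p * ln 2 / Y]; an interval in the range of [phi]
    makes it solvable for every [p] in a window of length proportional to [Y]. *)
Lemma phi_frequency (S : set (R * R)) (a b Y : R) (p : nat) :
  (forall kappa, S kappa -> 0 < kappa.1 /\ 0 < kappa.2) ->
  `[a, b] `<=` @phi R @` S -> 0 < Y ->
  a * Y <= 4 * (p%:R * ln 2) <= b * Y ->
  exists2 kappa, S kappa &
    (4 * kappa.1 + 4 * kappa.2 + 1) * (p%:R * ln 2) = Y.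
Proof.
move=> pS abS Y0 /andP[h1 h2].
have [|kappa Sk hk] := abS (4 * (p%:R * ln 2) / Y).
  by rewrite /= in_itv/= ler_pdivlMr// h1 ler_pdivrMr.
exists kappa => //; move: hk; rewrite /phi.
have [k1 k2] := pS _ Sk.
have k0 : 0 < 4 * kappa.1 + 4 * kappa.2 + 1 by clear -k1 k2; lra.
move=> /eqP; rewrite eqr_div; [move=> /eqP h|by rewrite gt_eqF..].
have n4 : 4 != 0 :> R by rewrite pnatr_eq0.
by apply: (mulfI n4); rewrite h; ring.
Qed.

Lemma block_disjoint (p p' : nat) (s s' : nat -> R) k : p != p' ->
  block _ (2 ^ p) s k * block _ (2 ^ p') s' k = 0.
Proof.
have wl q q' : (q < q')%N -> ~~ ((2 ^ q <= k < (2 ^ q).*2)%N &&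
    (2 ^ q' <= k < (2 ^ q').*2)%N).
  by move=> /(leq_pexp2l (isT : 0 < 2)%N); rewrite expnS; lia.
rewrite neq_ltn /block => /orP[] /wl; rewrite negb_and => /orP[] /negbTE ->;
  by rewrite ?mul0r ?mulr0.
Qed.

Lemma sum_block_cst_pow4 (n N : nat) (v eps : R) :
  \sum_(k < N) (block _ n (fun=> v) k / eps) ^+ 4 <= n%:R * (v / eps) ^+ 4.
Proof.
rewrite -(big_mkord xpredT (fun k => (block _ n (fun=> v) k / eps) ^+ 4)).
apply: le_trans (sum_block _ n N _ _ _) _.
- by move=> i; rewrite exprn_even_ge0.
- by move=> i h; rewrite /block (negbTE h) mul0r expr0n.
have -> : n%:R * (v / eps) ^+ 4 = \sum_(n <= i < n.*2) (v / eps) ^+ 4.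
  by rewrite sumr_const_nat -addnn addnK mulr_natl.
by apply: ler_sum_nat => i h; rewrite /block h.
Qed.

End dyadic_block.

Section lower_bound.
Context (d : measure_display) (Omega : measurableType d) (R : realType).
Variables (P : probability Omega R) (xi : nat -> {RV P >-> R}).
Hypothesis hxi : iid_standard_normal xi.

(** Form of the lower bound at a fixed noise level; for fixed [delta] the middle term decays like
    the inverse square root of [ln eps^-1]. *)
Lemma gamma_err_ge_at (S : set (R * R)) (lo hi a b c eps delta : R) (j : nat)
    (r : R -> R * R -> R) : 0 < lo ->
  (forall kappa, S kappa -> lo <= kappa.1 <= hi /\ lo <= kappa.2 <= hi) ->
  4 * hi + 1 <= 2 * lo * j%:R -> 0 <= c ->
  32 * c ^+ 2 * expR (ln 2 * (j%:R + 4 * hi * j%:R + 8 * hi)) <= 1 ->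
  0 < a -> a < b -> `[a, b] `<=` @phi R @` S ->
  0 < eps -> 1 <= loglog eps -> 4 <= (b - a) * ln eps^-1 ->
  (forall kappa, S kappa ->
    (u_eps eps kappa (r eps kappa) <= (c * sqrt_loglog eps)%:E)%E) ->
  0 < delta ->
  1 - (2 * (b - a) * delta * Num.sqrt (ln eps^-1))^-1 - delta / 4 <=
  gamma_err xi eps (Theta_family S r eps).
Proof.
move=> lo0 Sb hj c0 hc a0 ab abS eps0 ll1 hT hu delta0.
set T := ln eps^-1 in hT *; pose ll := loglog eps.
have T1 : 1 < T.
  rewrite ltNge; apply/negP => /ln_le0; rewrite -/(loglog eps).
  by move: ll1; clear -hxi; lra.
have Tll : expR ll = T by rewrite lnK// posrE; exact: lt_trans T1.
have llT : ll <= T by have := expR_ge1Dx ll; rewrite Tll; clear -hxi; lra.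
have ll0 : 0 < ll / 4 by move: ll1; rewrite -/ll; clear -hxi; lra.
(* Minus the logarithm of [eps ^+ 4 * ll / 4], the right-hand side of the critical equation. *)
pose Y := 4 * T - ln (ll / 4).
have YT : 3 * T <= Y.
  by have := ln_sublinear ll0; rewrite /Y; clear -hxi llT T1; lra.
have xY : expR (- Y) = eps ^+ 4 * ll / 4.
  rewrite /Y opprB expRD lnK ?posrE// expRN expRM_natl -exprVn -expRN.
  by rewrite /T lnV ?posrE// opprK lnK ?posrE//; ring.
have Y0 : 0 < Y by clear -hxi T1 YT; lra.
have ba : 0 < b - a by rewrite subr_gt0.
pose l2 : R := ln 2; have l2h : 2^-1 <= l2 by exact: ln2_ge_half.
have l21 : l2 <= 1 by exact: ln2_le1.
have l20 : 0 < l2 by clear -hxi l2h; lra.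
have l24 : 0 < 4 * l2 by clear -hxi l20; lra.
(* The levels [j0 + i] with [i < J] lie in the window from [a * Y / (4 * ln 2)] to
   [b * Y / (4 * ln 2)], so each is critical for some [kappa] in [S]. *)
pose j0 := (Num.truncn (a * Y / (4 * l2))).+1.
pose J := Num.truncn ((b - a) * Y / (4 * l2)).
have aY : 0 <= a * Y / (4 * l2) by rewrite divr_ge0 ?mulr_ge0 ?ltW.
have baY : 0 <= (b - a) * Y / (4 * l2) by rewrite divr_ge0 ?mulr_ge0 ?ltW.
have [j01 j02] : a * Y <= j0%:R * (4 * l2) /\ j0%:R * (4 * l2) <= a * Y + 4 * l2.
  split; first by rewrite -ler_pdivrMr// ltW// truncnS_gt.
  rewrite /j0 -addn1 natrD mulrDl mul1r lerD2r -ler_pdivlMr//.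
  by rewrite truncn_le.
have [J1 J2] : J%:R * (4 * l2) <= (b - a) * Y /\ (b - a) * T / 2 <= J%:R.
  split; first by rewrite -ler_pdivlMr// truncn_le.
  have h : (b - a) * Y / 4 < J.+1%:R.
    apply: le_lt_trans (truncnS_gt ((b - a) * Y / (4 * l2))).
    rewrite ler_pM2l ?mulr_gt0// lef_pV2 ?posrE//; clear -hxi l21; lra.
  move: h; rewrite -[J.+1]addn1 natrD => h.
  have : (b - a) * (3 * T) <= (b - a) * Y by rewrite ler_pM2l.
  move: h hT; clear -hxi; lra.
have J0 : (0 < J)%N.
  by rewrite -(ltr_nat R); apply: lt_le_trans J2; move: hT; clear -hxi; lra.
have freq (i : 'I_J) : exists kappa, S kappa /\
    (4 * kappa.1 + 4 * kappa.2 + 1) * ((j0 + i)%:R * l2) = Y.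
  have [| |kappa Sk hk] := @phi_frequency _ S a b Y (j0 + i) _ abS Y0; last 1 first.
  - by exists kappa.
  - by move=> kappa /Sb[/andP[k1 _] /andP[k2 _]]; split; exact: lt_le_trans lo0 _.
  have i0 : 0 <= i%:R :> R by exact: ler0n.
  have i1 : i%:R + 1 <= J%:R :> R by rewrite natr1 ler_nat.
  have i0' := mulr_ge0 (ltW l20) i0.
  have i1' := ler_wpM2r (ltW l20) i1.
  rewrite -/l2 natrD; apply/andP; split; clear -hxi j01 j02 J1 i0' i1'; lra.
have [K KP] := choice freq.
pose vi (i : 'I_J) := expR (- ((j0 + i)%:R * l2 +
    2 * ((K i).1 + (K i).2) * ((j0 + i).+1%:R * l2)) / 2).
have vi2 i : vi i ^+ 2 = expR (- ((j0 + i)%:R * l2 +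
    2 * ((K i).1 + (K i).2) * ((j0 + i).+1%:R * l2))).
  by rewrite -expRM_natl; congr expR; rewrite mulrC divfK.
pose V (i : 'I_J) := block R (2 ^ (j0 + i)) (fun=> vi i).
pose N := (2 ^ (j0 + J))%N.
have VN i k : (N <= k)%N -> V i k = 0.
  move=> Nk; have nN : ((2 ^ (j0 + i)).*2 <= N)%N.
    by rewrite -mul2n -expnS leq_pexp2l// -addnS leq_add2l.
  by rewrite /V /block [(k < _)%N]ltnNge (leq_trans nN Nk) andbF.
have Vdisj i i' k : i != i' -> V i k * V i' k = 0.
  by move=> ii'; apply: block_disjoint; rewrite eqn_add2l.
have VTheta i f : Theta_family S r eps (signed _ J N V i f).
  have [Ski hki] := KP i; exists (K i) => //.
  (* Wherever the block or the sign vector is not defined the amplitude is set to [vi i], so that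
     its square is constant as [Theta_kappa_block] requires. *)
  have -> : signed _ J N V i f = block R (2 ^ (j0 + i)) (fun k =>
      if insub k is Some l then (if f l then vi i else - vi i) else vi i).
    apply/funext => k; have := VN i k; rewrite /signed /V /block.
    case: insubP => [l _ _ _|].
      by case: (f l) => //; case: ifP => //; rewrite oppr0.
    by rewrite -leqNgt => Nk /(_ Nk).
  have [s1 s2] := Sb _ Ski.
  apply: (@dyadic_block_alternative _ lo hi eps ll c (vi i) _ _ j) => //.
  - by move: ll0; clear -hxi; lra.
  - by rewrite -/l2 hki.
  - exact: hu.
  - by move=> k; case: insub => // l; case: (f l); rewrite ?sqrrN.
(* The quarter is what makes the second moment [expR (2 * (ll / 4))] equal to the square root of
   [T], small compared with the number [J] of blocks. *)
have B4 i : \sum_(k < N) (V i k / eps) ^+ 4 <= ll / 4.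
  apply: le_trans (sum_block_cst_pow4 _ _ _ _ _) _.
  have [Ski hki] := KP i; have [/andP[s1 _] /andP[s2 _]] := Sb _ Ski.
  have e4 : 0 < eps ^+ 4 by rewrite exprn_gt0.
  have -> : ll / 4 = expR (- Y) / eps ^+ 4.
    by rewrite xY; field; rewrite gt_eqF.
  rewrite expr_div_n [leLHS]mulrA ler_pM2r ?invr_gt0//.
  have -> : vi i ^+ 4 = vi i ^+ 2 * vi i ^+ 2 by rewrite -exprD.
  rewrite vi2 pow2_expR -/l2 -!expRD ler_expR -hki -[(_ + i).+1]addn1 natrD.
  have : 0 <= ((K i).1 + (K i).2) * l2.
    by rewrite mulr_ge0 ?(ltW l20)//; move: lo0 s1 s2; clear -hxi; lra.
  clear -hxi; lra.
apply: gamma_err_ge => psi tpsi.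
apply: le_trans (sign_mixture_test_lower_bound _ _ _ _ _ hxi J N V eps J0 eps0
  Vdisj _ VTheta psi (ll / 4) delta delta0 B4 tpsi).
rewrite lerD2r lerD2l lerN2.
pose h := expR (ll / 2).
have h0 : 0 < h by exact: expR_gt0.
have hh : h ^+ 2 = T by rewrite -expRM_natl -Tll; congr expR; rewrite mulrC divfK.
rewrite -hh sqrtr_sqr gtr0_norm// (_ : 2 * (ll / 4) = ll / 2) -/h; last by field.
rewrite ler_pdivrMr; last by rewrite mulr_gt0.
rewrite ler_pdivrMr ?ltr0n//.
have -> : (2 * (b - a) * delta * h)^-1 * (4 * delta) * J%:R =
    2 * J%:R / ((b - a) * h) by field; rewrite !gt_eqF.
rewrite ler_pdivlMr; last exact: mulr_gt0.
move: J2; rewrite -hh; clear -hxi; lra.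
Qed.

Lemma gamma_err_cvg1 (S : set (R * R)) (a b : R) : compact S ->
  (forall kappa, S kappa -> 0 < kappa.1 /\ 0 < kappa.2) ->
  0 < a -> a < b -> `[a, b] `<=` @phi R @` S ->
  exists2 dl : R, 0 < dl & forall r : R -> R * R -> R, radii_family S r ->
    (limsup_sup_ratio S r (@sqrt_loglog R) <= dl%:E)%E ->
    gamma_err xi eps (Theta_family S r eps) @[eps --> 0^'+] --> (1 : R).
Proof.
move=> cS pS a0 ab abS.
have [lo [hi [lo0 lohi Sb]]] := compact_positive_bounds _ _ cS pS.
pose j := (Num.truncn ((4 * hi + 1) / (2 * lo))).+1.
have hj : 4 * hi + 1 <= 2 * lo * j%:R.
  have := truncnS_gt ((4 * hi + 1) / (2 * lo)); rewrite -/j.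
  by rewrite ltr_pdivrMr ?mulr_gt0// => /ltW; clear -hxi; lra.
pose E := expR (ln 2 * (j%:R + 4 * hi * j%:R + 8 * hi)).
have E0 : 0 < 32 * E by rewrite mulr_gt0 ?expR_gt0.
pose c := Num.sqrt (32 * E)^-1.
have c0 : 0 < c by rewrite sqrtr_gt0 invr_gt0.
have hc : 32 * c ^+ 2 * E <= 1.
  have nE : 32 * E != 0 by rewrite gt_eqF.
  rewrite sqr_sqrtr; last by rewrite invr_ge0 ltW.
  by rewrite mulrAC divff.
(* Halving leaves room to pass from the assumed [<=] to the strict inequality needed for an eventual
   bound. *)
exists (c / 2); first by rewrite divr_gt0.
move=> r _ hr.
have hr' : (limsup_sup_ratio S r (@sqrt_loglog R) < c%:E)%E.
  by apply: le_lt_trans hr _; rewrite lte_fin; clear -hxi c0; lra.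
have hu := limsup_sup_ratio_near _ _ _ _ _ hr' (sqrt_loglog_gt0_near _).
apply/cvgrPdist_le => e e0.
have ba : 0 < b - a by rewrite subr_gt0.
near=> eps.
have eps0 : 0 < eps by near: eps; exact: near0_gt0.
have ll1 : 1 <= loglog eps by near: eps; exact: near0_loglog_ge.
have T4 : 4 / (b - a) <= ln eps^-1 by near: eps; exact: near0_ln_ge.
have Te : ((b - a) * e * e)^-1 ^+ 2 <= ln eps^-1 by near: eps; exact: near0_ln_ge.
have hT : 4 <= (b - a) * ln eps^-1 by rewrite mulrC -ler_pdivrMr.
have hue : forall kappa, S kappa ->
    (u_eps eps kappa (r eps kappa) <= (c * sqrt_loglog eps)%:E)%E.
  by near: eps; exact: hu.
have := gamma_err_ge_at S lo hi a b c eps e j r lo0 Sb hj (ltW c0) hc a0 ab abS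
  eps0 ll1 hT hue e0.
have := gamma_err_le1 _ _ _ _ xi eps (Theta_family S r eps).
set g := gamma_err _ _ _; set q := Num.sqrt _ => g1 gl.
rewrite ger0_norm ?subr_ge0//.
have be : 0 < (b - a) * e * e by do 2 apply: mulr_gt0 => //.
have q1 : ((b - a) * e * e)^-1 <= q.
  apply: sqr_le_of_sqr; first exact: sqrtr_ge0.
  by rewrite /q sqr_sqrtr//; apply: le_trans Te; exact: sqr_ge0.
have q0 : 0 < q by apply: lt_le_trans q1; rewrite invr_gt0.
have : (2 * (b - a) * e * q)^-1 <= e / 2.
  have be2 : 0 < 2 * (b - a) * e by do 2 apply: mulr_gt0 => //.
  rewrite -[leLHS]mul1r ler_pdivrMr ?mulr_gt0//.
  move: q1; rewrite -[leLHS]mul1r ler_pdivrMr//; clear -hxi; lra.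
move: gl e0; clear -hxi; lra.
Unshelve. all: by end_near. Qed.

End lower_bound.

(** * Adaptive separation rates *)

Section adaptive_rate.
Context (R : realType).
Implicit Types (kappa : R * R) (eps : R) (S : set (R * R)).

Lemma loglog_le eps : 0 < loglog eps -> loglog eps <= ln eps^-1.
Proof.
move=> h; have T1 : 0 < ln eps^-1.
  rewrite ltNge; apply/negP => T0; move: h.
  by rewrite /loglog ltNge ln_le0//; lra.
exact: ltW (ln_sublinear T1).
Qed.

Lemma r_adaptiveE eps kappa : 0 < eps -> 0 < loglog eps ->
  r_adaptive eps kappa = expR (- (4 * kappa.1 / (4 * kappa.1 + 4 * kappa.2 + 1) *
    (ln eps^-1 - ln (loglog eps) / 4))).
Proof.
move=> e0 l0; rewrite /r_adaptive {1}/powR.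
rewrite (gt_eqF (mulr_gt0 e0 (powR_gt0 _ l0))).
rewrite lnM ?posrE ?powR_gt0// ln_powR lnV ?posrE//.
by congr expR; ring.
Qed.

Lemma radii_family_r_adaptive S :
  (forall kappa, S kappa -> 0 < kappa.1 /\ 0 < kappa.2) ->
  radii_family S (@r_adaptive R).
Proof.
move=> pS; split.
  near=> eps => kappa _; rewrite r_adaptiveE ?expR_gt0//.
  by apply: (@lt_le_trans _ _ 1) => //; near: eps; exact: near0_loglog_ge.
move=> kappa /pS[a0 b0]; apply/cvgrPdist_le => e e0.
pose s := 4 * kappa.1 / (4 * kappa.1 + 4 * kappa.2 + 1).
have s0 : 0 < s by rewrite divr_gt0//; lra.
near=> eps.
have eps0 : 0 < eps by near: eps; exact: near0_gt0.
have ll1 : 1 <= loglog eps by near: eps; exact: near0_loglog_ge.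
have T1 : - ln e / s * 2 <= ln eps^-1 by near: eps; exact: near0_ln_ge.
have T0 : 0 <= ln eps^-1 by near: eps; exact: near0_ln_ge.
have ll0 : 0 < loglog eps by lra.
rewrite sub0r normrN r_adaptiveE// -/s ger0_norm ?expR_ge0//.
rewrite -[leRHS]lnK ?posrE// ler_expR lerNl mulrC -ler_pdivrMr//.
have := loglog_le _ ll0; have := ln_sublinear ll0; move: T1 T0.
set T := ln eps^-1; set l := ln (loglog eps); set v := - ln e / s.
clear; lra.
Unshelve. all: by end_near. Qed.

(** With [w] the logarithm of the critical frequency, the radius is [expR (- alpha * w)] and
    [expR (- (4 * alpha + 4 * beta + 1) * w)] is [eps ^+ 4 * loglog eps]. The lower bound uses the
    frequencies up to [j] dyadic levels above [w], the upper bound a block [j] levels below. *)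
Lemma u_eps_r_adaptive_bounds (lo hi : R) : 0 < lo -> lo <= hi ->
  exists c C : R, [/\ 0 < c, 0 < C &
    \forall eps \near 0^'+, forall kappa,
      lo <= kappa.1 <= hi -> lo <= kappa.2 <= hi ->
      (c%:E <= u_eps eps kappa (r_adaptive eps kappa) / (sqrt_loglog eps)%:E
        <= C%:E)%E].
Proof.
move=> lo0 lohi; pose l2 : R := ln 2.
have l20 : 0 < l2 by rewrite ln_gt0// ltr1n.
have l21 : l2 <= 1 by exact: ln2_le1.
have e2 : expR l2 = 2 by rewrite /l2 lnK ?posrE.
pose j := (Num.truncn ((4 * hi + 1) / (2 * lo))).+1.
have hj : 4 * hi + 1 <= 2 * lo * j%:R.
  have := truncnS_gt ((4 * hi + 1) / (2 * lo)); rewrite -/j.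
  by rewrite ltr_pdivrMr ?mulr_gt0// => /ltW; clear; lra.
have j0 : 0 <= j%:R :> R by exact: ler0n.
(* A shift by [j] levels, plus one for rounding in [C], changes [m * m ^ (4 * beta)] by at most the
   exponentials here, and [u_eps] scales as its inverse square root. *)
pose c := expR (- ((1 + 4 * hi) * (j%:R * l2)) / 2) / 4.
pose C := expR ((1 + 4 * hi) * ((j%:R + 1) * l2) / 2).
have c0 : 0 < c by rewrite divr_gt0 ?expR_gt0.
have C0 : 0 < C by exact: expR_gt0.
have c2 : c ^+ 2 = expR (- ((1 + 4 * hi) * (j%:R * l2))) / 16.
  rewrite expr_div_n -expRM_natl; congr (expR _ / _); first by rewrite mulrC divfK.
  by rewrite -natrX.
have C2 : C ^+ 2 = expR ((1 + 4 * hi) * ((j%:R + 1) * l2)).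
  by rewrite -expRM_natl; congr expR; rewrite mulrC divfK.
exists c, C; split => //; near=> eps => kappa ab1 ab2.
have eps0 : 0 < eps by near: eps; exact: near0_gt0.
have ll1 : 1 <= loglog eps by near: eps; exact: near0_loglog_ge.
have T1 : (8 * hi + 1) * j%:R <= ln eps^-1 by near: eps; exact: near0_ln_ge.
have ll0 : 0 < loglog eps by clear -ll1; lra.
have sl0 : 0 < sqrt_loglog eps by rewrite sqrtr_gt0.
have /andP[a1 a2] := ab1; have /andP[b1 b2] := ab2.
rewrite le_ediv// le_edivr// r_adaptiveE//.
set a := kappa.1 in a1 a2 *; set b := kappa.2 in b1 b2 *.
set ll := loglog eps in ll1 ll0 *; set T := ln eps^-1 in T1 *.
pose q := 4 * a + 4 * b + 1.
have q0 : 0 < q by rewrite /q; clear -a1 b1 lo0; lra.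
have nq : q != 0 by rewrite gt_eqF.
have a0 : 0 <= a by clear -a1 lo0; lra.
have b0 : 0 <= b by clear -b1 lo0; lra.
pose w := 4 * (T - ln ll / 4) / q.
have -> : - (4 * a / q * (T - ln ll / 4)) = - (a * w) by rewrite /w; field.
have ew : expR (- (q * w)) = eps ^+ 4 * ll.
  have -> : - (q * w) = ln ll - 4%:R * T by rewrite /w; field.
  rewrite expRB lnK ?posrE// expRM_natl /T lnV ?posrE// expRN lnK ?posrE//.
  by rewrite exprVn invrK mulrC.
(* Ensures [j <= k], so that the subtraction in [2 ^ (k - j)] is exact. *)
have wj : j%:R <= w.
  rewrite /w ler_pdivlMr//.
  have := ln_sublinear ll0; have := loglog_le _ ll0; rewrite -/ll -/T.
  have : j%:R * q <= j%:R * (8 * hi + 1).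
    by rewrite ler_wpM2l// /q; clear -a2 b2; lra.
  have T0 : 0 <= T by apply: le_trans T1; rewrite mulr_ge0//; clear -lo0 lohi; lra.
  clear -T1 T0; lra.
have w0 : 0 <= w / l2 by apply: divr_ge0; [exact: le_trans wj|exact: ltW].
pose k := Num.truncn (w / l2).
have k1 : k%:R * l2 <= w by rewrite -ler_pdivlMr// truncn_le.
have k2 : w <= (k%:R + 1) * l2.
  by rewrite -ler_pdivrMr// natr1 ltW// truncnS_gt.
have jk : (j <= k)%N.
  rewrite truncn_ge_nat// ler_pdivlMr//; apply: le_trans wj.
  by rewrite ler_piMr.
have jkR : (k - j)%:R = k%:R - j%:R :> R by rewrite natrB.
have sqC x : (x * sqrt_loglog eps) ^+ 2 = x ^+ 2 * ll.
  by rewrite exprMn sqr_sqrtr// ltW.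
have aj : lo * j%:R <= a * j%:R by rewrite ler_wpM2r.
have kw : 0 <= (k%:R + 1) * l2 - w by rewrite subr_ge0.
have bw : 0 <= (hi - b) * l2 by rewrite mulr_ge0 ?(ltW l20)// subr_ge0.
apply/andP; split.
  rewrite leNgt; apply/negP => /ltW hu.
  have m0 : (0 < 2 ^ (k + j))%N by rewrite expn_gt0.
  have hm : 2 <= expR (- (a * w)) ^+ 2 * ((2 ^ (k + j))%:R `^ kappa.1) ^+ 2.
    rewrite powR_pow2 -/a -/l2 -!expRM_natl -expRD -{1}e2 ler_expR natrD.
    have := ler_wpM2l a0 k2.
    have : l2 * 1 <= l2 * (2 * a * j%:R - 2 * a).
      by rewrite ler_pM2l//; clear -aj hj a2 lo0 lohi; lra.
    clear; lra.
  have := u_eps_le_bound _ _ _ _ _ _ eps0 (mulr_ge0 (ltW c0) (ltW sl0)) a0 b0 m0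
    hm hu.
  apply/negP; rewrite -ltNge sqC.
  have -> : 8 * eps ^+ 4 * (c ^+ 2 * ll) = 8 * c ^+ 2 * (eps ^+ 4 * ll) by ring.
  rewrite -ew c2 powR_pow2 pow2_expR -/b -/l2 -!expRM_natl.
  set x1 := - (_ * (_ * _)); set x2 := - (q * w); set x3 := (k + j)%:R * l2.
  have -> : 8 * (expR x1 / 16) * expR x2 * (expR x3 * expR (4%:R * (b * x3))) =
      expR (x1 + x2 + x3 + 4%:R * (b * x3)) / 2.
    by rewrite !expRD; field.
  apply: (@lt_le_trans _ _ (expR (x1 + x2 + x3 + 4%:R * (b * x3)))).
    by have := expR_gt0 (x1 + x2 + x3 + 4%:R * (b * x3)); clear; lra.
  rewrite ler_expR /x1 /x2 /x3 natrD /q.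
  have : 0 <= j%:R * ((hi - b) * l2) by rewrite mulr_ge0.
  have : b * (k%:R * l2) <= b * w by rewrite ler_wpM2l.
  move: k1; clear; lra.
apply: (u_eps_le _ _ _ _ _ (2 ^ (k - j))%N) => //.
- by rewrite mulr_ge0 ?ltW.
- by rewrite expn_gt0.
- rewrite !powR_2 powR_pow2 -/a -/b -/l2 -!expRD -expRM_natl -[leRHS]expR0 ler_expR.
  rewrite pmulr_rle0// jkR.
  have := ler_wpM2l a0 k1.
  have : 0 <= l2 * (a * j%:R - a - b).
    by rewrite mulr_ge0 ?(ltW l20)//; clear -aj hj a2 b2 lo0 lohi; lra.
  clear; lra.
- rewrite sqC.
  have -> : 2 * eps ^+ 4 * (C ^+ 2 * ll) = 2 * C ^+ 2 * (eps ^+ 4 * ll) by ring.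
  rewrite -ew C2 powR_pow2 pow2_expR -/b -/l2 -!expRM_natl jkR.
  set x1 := (1 + _) * _; set x2 := - (q * w); set x3 := (_ - _) * l2.
  have -> : 2 * expR x1 * expR x2 * (expR x3 * expR (4%:R * (b * x3))) =
      2 * expR (x1 + x2 + x3 + 4%:R * (b * x3)).
    by rewrite !expRD; ring.
  apply: (@le_trans _ _ (expR (x1 + x2 + x3 + 4%:R * (b * x3)))); last first.
    by have := expR_gt0 (x1 + x2 + x3 + 4%:R * (b * x3)); clear; lra.
  rewrite ler_expR /x1 /x2 /x3 /q.
  have : 0 <= (j%:R + 1) * ((hi - b) * l2) by rewrite mulr_ge0// addr_ge0.
  have := ler_wpM2l b0 k2; move: k2; clear; lra.
Unshelve. all: by end_near. Qed.

End adaptive_rate.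

Section separation.
Context (d : measure_display) (Omega : measurableType d) (R : realType).
Variables (P : probability Omega R) (xi : nat -> {RV P >-> R}).
Hypothesis hxi : iid_standard_normal xi.

Lemma gamma_err_ge0 eps Theta : 0 <= gamma_err xi eps Theta.
Proof.
by apply: gamma_err_ge => psi tpsi; rewrite addr_ge0 ?alpha_err_ge0 ?beta_err_ge0.
Qed.

Lemma sqrt_loglog_cvgy : (@sqrt_loglog R) eps @[eps --> 0^'+] --> +oo.
Proof.
apply/cvgryPge => A; near=> eps.
apply: le_trans (ler_norm A) _; rewrite -sqrtr_sqr ler_wsqrtr//.
by near: eps; exact: near0_loglog_ge.
Unshelve. all: by end_near. Qed.

(** An admissible lowest level, since part (b) leaves it free: it tends to infinity and is
    negligible against [ln eps^-1]. *)
Let L (eps : R) : int := Num.floor (Num.sqrt (ln eps^-1)).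

Let L_cvgy : (L eps)%:~R @[eps --> 0^'+] --> (+oo : set_system R).
Proof.
apply/cvgryPge => A; near=> eps.
have h : (`|A| + 1) ^+ 2 <= ln eps^-1 by near: eps; exact: near0_ln_ge.
have : `|A| + 1 <= Num.sqrt (ln eps^-1).
  by rewrite -[leLHS]ger0_norm ?addr_ge0// -sqrtr_sqr ler_wsqrtr.
have := floorD1_gt (Num.sqrt (ln eps^-1)); rewrite -/(L eps) intrD.
have := ler_norm A; lra.
Unshelve. all: by end_near. Qed.

Let L_small : (L eps)%:~R / ln eps^-1 @[eps --> 0^'+] --> (0 : R).
Proof.
apply/cvgrPdist_le => e e0; near=> eps.
have h : e^-1 ^+ 2 <= ln eps^-1 by near: eps; exact: near0_ln_ge.
have T0 : 0 < ln eps^-1 by apply: lt_le_trans h; rewrite exprn_gt0 ?invr_gt0.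
rewrite sub0r normrN ger0_norm; last first.
  by apply: divr_ge0; [rewrite ler0z floor_ge0 sqrtr_ge0|exact: ltW].
rewrite ler_pdivrMr//; apply: le_trans (floor_le_tmp _) _.
set q := Num.sqrt _; have q0 : 0 <= q by exact: sqrtr_ge0.
have Tq : ln eps^-1 = q ^+ 2 by rewrite sqr_sqrtr// ltW.
have eq : e^-1 <= q.
  by apply: sqr_le_of_sqr => //; rewrite -Tq.
rewrite Tq; move: eq; rewrite -[leLHS]mul1r ler_pdivrMr//; nra.
Unshelve. all: by end_near. Qed.

Lemma gamma_err_cvg0 (S : set (R * R)) : compact S ->
  (forall kappa, S kappa -> 0 < kappa.1 /\ 0 < kappa.2) ->
  exists2 D : R, 0 < D & forall r : R -> R * R -> R, radii_family S r ->
    (liminf_inf_ratio S r (@sqrt_loglog R) > D%:E)%E ->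
    gamma_err xi eps (Theta_family S r eps) @[eps --> 0^'+] --> (0 : R).
Proof.
move=> cS pS; have C2 : 2 < 3 :> R by rewrite ltr_nat.
have [D D0 hD] := beta_err_psi_adaptive_cvg _ _ _ _ _ hxi _ _ cS pS C2.
exists D => // r rr hr.
have ca := alpha_err_psi_adaptive_cvg _ _ _ _ _ hxi _ _ C2 L_cvgy.
have cb := hD L L_cvgy L_small r rr hr.
have cab : alpha_err xi eps (psi_adaptive 3 (L eps) eps) +
    beta_err xi eps (Theta_family S r eps) (psi_adaptive 3 (L eps) eps)
    @[eps --> 0^'+] --> (0 : R).
  by rewrite -[X in _ --> X]addr0; exact: cvgD.
apply: (squeeze_cvgr _ (cvg_cst 0) cab).
apply: nearW => eps; rewrite gamma_err_ge0/=.
by apply: gamma_err_le; exact: is_test_psi_adaptive.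
Qed.

Lemma adaptive_separation_rates_r_adaptive (S : set (R * R)) (a b : R) :
  compact S -> (forall kappa, S kappa -> 0 < kappa.1 /\ 0 < kappa.2) ->
  0 < a -> a < b -> `[a, b] `<=` @phi R @` S ->
  adaptive_separation_rates xi S (@sqrt_loglog R) (@r_adaptive R).
Proof.
move=> cS pS a0 ab abS; split.
- split; first exact: sqrt_loglog_cvgy.
  have [dl dl0 h1] := gamma_err_cvg1 _ _ _ _ _ hxi S a b cS pS a0 ab abS.
  have [D D0 h0] := gamma_err_cvg0 S cS pS.
  (* The maximum secures [dl <= Du]; raising the upper constant only strengthens its hypothesis. *)
  exists dl, (Num.max dl D); split => //; first by rewrite le_max lexx.
  move=> r rr; split=> hr; first by apply: h1 => //; exact: ltW.
  apply: h0 => //; apply: le_lt_trans hr.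
  by rewrite lee_fin le_max lexx orbT.
- exact: radii_family_r_adaptive.
- have [lo [hi [lo0 lohi Sb]]] := compact_positive_bounds _ _ cS pS.
  have [c [C [c0 C0 h]]] := u_eps_r_adaptive_bounds _ lo hi lo0 lohi.
  exists c, C; split => //; apply: filterS h => eps h kappa /Sb[s1 s2].
  exact: h.
Qed.

End separation.

Theorem theorem5p1 (R : realType) (d : measure_display)
    (Omega : measurableType d) (P : probability Omega R)
    (xi : nat -> {RV P >-> R}) (hxi : iid_standard_normal xi)
    (S : set (R * R)) (hScompact : compact S)
    (hSpos : forall kappa, S kappa -> 0 < kappa.1 /\ 0 < kappa.2) :
  let contains_interval :=
    exists a b : R, [/\ 0 < a, a < b & `[a, b] `<=` @phi R @` S] in
  [/\ (contains_interval ->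
       exists2 dl : R, 0 < dl &
         forall r : R -> R * R -> R, radii_family S r ->
           (limsup_sup_ratio S r (@sqrt_loglog R) <= dl%:E)%E ->
           gamma_err xi eps (Theta_family S r eps) @[eps --> 0^'+] --> (1 : R)),
      (forall C : R, 2 < C ->
       exists2 D : R, 0 < D &
         forall L : R -> int,
           (L eps)%:~R @[eps --> 0^'+] --> (+oo : set_system R) ->
           (L eps)%:~R / ln eps^-1 @[eps --> 0^'+] --> (0 : R) ->
           alpha_err xi eps (psi_adaptive C (L eps) eps)
             @[eps --> 0^'+] --> (0 : R) /\
           forall r : R -> R * R -> R, radii_family S r ->
             (liminf_inf_ratio S r (@sqrt_loglog R) > D%:E)%E ->
             beta_err xi eps (Theta_family S r eps)
               (psi_adaptive C (L eps) eps) @[eps --> 0^'+] --> (0 : R)) &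
      (contains_interval ->
       adaptive_separation_rates xi S (@sqrt_loglog R) (@r_adaptive R))].
Proof.
move=> contains_interval; split.
- case=> a [b [a0 ab abS]].
  exact: (gamma_err_cvg1 _ _ _ _ _ hxi S a b hScompact hSpos a0 ab abS).
- move=> C C2.
  have [D D0 hD] :=
    beta_err_psi_adaptive_cvg _ _ _ _ _ hxi S C hScompact hSpos C2.
  exists D => // L Loo Lo; split; last exact: hD.
  exact: (alpha_err_psi_adaptive_cvg _ _ _ _ _ hxi C L C2 Loo).
- case=> a [b [a0 ab abS]].
  exact: (adaptive_separation_rates_r_adaptive _ _ _ _ _ hxi S a b hScompact
    hSpos a0 ab abS).
Qed.
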